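(* Let $X^{c,\Delta}=(X^{c,\Delta}_t)_{0\le t\le T}$ be the path of the continuous Euler scheme with step $\Delta$ starting from $x\in\mathbb{R}^d$ at time $0$. Assume that for all $t\in[0,T]$ the coefficients $b(t,\cdot)$ and $\sigma(t,\cdot)$ are continuous and that for all $y\in\mathbb{R}^d$, $$\sup_{t\in[0,T]}|b(t,y)|\le C_b(1+|y|),\qquad \sup_{t\in[0,T]}\mathrm{Tr}(a(t,y))\le C_\sigma(1+|y|^2).$$ Set $\kappa(b,\sigma,T)=28(1+(C_\sigma\vee C_b)T)$. Then for every $1$-Lipschitz function $f:\mathcal{C}\to\mathbb{R}$, all $M\in\mathbb{N}^*$ and all $r\ge0$, $$\mathbb{P}_x\left(\left|\frac1M\sum_{k=1}^Mf((X^{c,\Delta})^k)-\mathbb{E}_x[f(X^{c,\Delta})]\right|\ge r\right)\le\begin{cases}2\exp\left(-\dfrac{r^2M}{(2(1+|x|))^2\exp(2\kappa(b,\sigma,T))}\right)&\text{if } r\le\frac{1}{\sqrt M}2(1+|x|)e^{\kappa(b,\sigma,T)},\\[2mm] 2\exp\left(-\dfrac{1}{4\kappa(b,\sigma,T)}\left(\log\left(\dfrac{r^2M}{(2(1+|x|))^2}\right)\right)^2\right)&\text{otherwise,}\end{cases}$$ where $((X^{c,\Delta})^k)_{1\le k\le M}$ are $M$ independent copies of $X^{c,\Delta}$. The same result holds with the path $X$ of the diffusion process in place of $X^{c,\Delta}$.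
   Context: $d,q\ge1$, $T>0$, $N\in\mathbb{N}^*$, $\Delta=T/N$, $t_i=i\Delta$, $\phi(t)=t_i$ for $t_i\le t<t_{i+1}$. $W$ is a $q$-dimensional Brownian motion; $b:[0,T]\times\mathbb{R}^d\to\mathbb{R}^d$, $\sigma:[0,T]\times\mathbb{R}^d\to\mathbb{R}^{d\times q}$ are measurable in time, $a=\sigma\sigma^*$. The diffusion $X$ is a solution to $X_t=x+\int_0^tb(s,X_s)ds+\int_0^t\sigma(s,X_s)dW_s$, $t\in[0,T]$. The continuous Euler scheme is $X^{c,\Delta}_t=x+\int_0^tb(\phi(s),X^{c,\Delta}_{\phi(s)})ds+\int_0^t\sigma(\phi(s),X^{c,\Delta}_{\phi(s)})dW_s$, $t\in[0,T]$. $\mathcal{C}=\mathcal{C}([0,T],\mathbb{R}^d)$ is the space of continuous functions equipped with the uniform norm $\|g\|_\infty=\sup_{0\le t\le T}|g(t)|$, and Lipschitz is with respect to this norm. *)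

(* Defs.v *)
From HB Require Import structures.
From mathcomp Require Import all_boot all_order all_algebra.
From mathcomp Require Import all_classical all_reals all_analysis.

Set Implicit Arguments.
Unset Strict Implicit.
Unset Printing Implicit Defensive.

Import Order.TTheory GRing.Theory Num.Theory.
Import numFieldNormedType.Exports.

Local Open Scope classical_set_scope.
Local Open Scope ring_scope.

(* Processes are functions [X : Omega -> R -> 'M_(m, n)]: [X w] is a path, and
   only its restriction to [0, T] is ever used. *)

Section euclidean_norm.
Variable R : realType.

(* The library norm on matrices is the sup norm; this is the Euclidean norm of
   a column vector, and the Frobenius norm of a matrix. *)
Definition enorm (m n : nat) (A : 'M[R]_(m, n)) : R :=
  Num.sqrt (\sum_(i < m) \sum_(j < n) A i j ^+ 2).

End euclidean_norm.

Section path_space.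
Variables (R : realType) (d : nat) (T : R).
Implicit Types (g h : R -> 'cV[R]_d).

Definition continuous_path g : Prop := {within `[0, T], continuous g}.

Definition unorm g : \bar R := ereal_sup [set (enorm (g t))%:E | t in `[0, T]].

(* Functionals on C([0, T], R^d) are represented by total functions of which
   only the values on continuous paths matter; a Lipschitz functional only sees
   the restriction of a path to [0, T]. *)
Definition lipschitz1 (f : (R -> 'cV[R]_d) -> R) : Prop :=
  forall g h, continuous_path g -> continuous_path h ->
    (`|f g - f h|%:E <= unorm (fun t => g t - h t)%R)%E.

(* The sigma-algebra generated by the evaluations at times of [0, T]; on
   C([0, T], R^d) it is the Borel sigma-algebra of the uniform norm. *)
Definition path_measurable : set (set (R -> 'cV[R]_d)) :=
  <<s [set A | exists (t : R) (i : 'I_d) (B : set R),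
         [/\ t \in `[0, T], measurable B & A = [set g : R -> 'cV[R]_d | B (g t i ord0)]] ] >>.

End path_space.

Section stochastic_calculus.
Context (R : realType) (disp : measure_display) (Omega : measurableType disp).
Variables (P : probability Omega R) (F : R -> set (set Omega)) (T : R).

Definition filtration : Prop :=
  (forall t, t \in `[0, T] ->
     sigma_algebra setT (F t) /\ F t `<=` measurable) /\
  (forall s t, 0 <= s -> s <= t -> t <= T -> F s `<=` F t).

Definition rv_measurable (m n : nat) (G : set (set Omega))
    (Y : Omega -> 'M[R]_(m, n)) : Prop :=
  forall i j (B : set R), measurable B -> G [set w | B (Y w i j)].

Definition adapted (m n : nat) (Y : Omega -> R -> 'M[R]_(m, n)) : Prop :=
  forall t, t \in `[0, T] -> rv_measurable (F t) (fun w => Y w t).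

(* The last clause says at once that W_t - W_s is independent of F_s, has
   independent coordinates, and that these have the law N(0, t - s) (the second
   parameter of [normal_prob] is the standard deviation). *)
Definition brownian_motion (q : nat) (W : Omega -> R -> 'cV[R]_q) : Prop :=
  [/\ adapted W,
      {ae P, forall w, W w 0 = 0},
      {ae P, forall w, continuous_path T (W w)} &
      forall s t, 0 <= s -> s < t -> t <= T ->
        forall (A : set Omega) (B : 'I_q -> set R),
          F s A -> (forall i, measurable (B i)) ->
          P (A `&` [set w | forall i, B i ((W w t - W w s) i ord0)]) =
          (P A * \prod_(i < q) normal_prob 0 (Num.sqrt (t - s)) (B i))%E].

Definition cvg_in_prob0 (Z : nat -> Omega -> \bar R) : Prop :=
  forall e : R, 0 < e -> P [set w | (e%:E <= Z n w)%E] @[n --> \oo] --> 0%E.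

Section ito.
Context (d q : nat).

(* sum_(i < n) xi_i 1_(s_i, s_(i+1)] *)
Record simple_process := SimpleProcess {
  sp_size : nat;
  sp_time : nat -> R;
  sp_coef : nat -> Omega -> 'M[R]_(d, q) }.

Definition simple_wf (H : simple_process) : Prop :=
  [/\ 0 <= sp_time H 0%N,
      forall i, (i < sp_size H)%N -> sp_time H i <= sp_time H i.+1,
      sp_time H (sp_size H) <= T &
      forall i, (i < sp_size H)%N ->
        rv_measurable (F (sp_time H i)) (sp_coef H i) /\
        exists C : R, forall w, enorm (sp_coef H i w) <= C].

Definition simple_val (H : simple_process) (w : Omega) (t : R)
    : 'M[R]_(d, q) :=
  \sum_(i < sp_size H)
    ((sp_time H i < t <= sp_time H i.+1)%R)%:R *: sp_coef H i w.

Definition simple_int (W : Omega -> R -> 'cV[R]_q) (H : simple_process)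
    (w : Omega) (t : R) : 'cV[R]_d :=
  \sum_(i < sp_size H)
    sp_coef H i w *m (W w (Num.min t (sp_time H i.+1))
                      - W w (Num.min t (sp_time H i))).

(* I_t = int_0^t H_s dW_s for all t in [0, T]: the Ito integral as the limit in
   probability of the integrals of simple processes H^n such that
   int_0^T |H^n_s - H_s|^2 ds tends to 0 in probability. *)
Definition ito_integral (W : Omega -> R -> 'cV[R]_q)
    (H : Omega -> R -> 'M[R]_(d, q)) (I : Omega -> R -> 'cV[R]_d) : Prop :=
  (forall t, t \in `[0, T] -> rv_measurable measurable (fun w => I w t)) /\
  exists Hn : nat -> simple_process,
    [/\ forall n, simple_wf (Hn n),
        cvg_in_prob0 (fun n w => (\int[lebesgue_measure]_(s in `[0%R, T])
          (enorm (simple_val (Hn n) w s - H w s) ^+ 2)%:E)%E) &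
        forall t, t \in `[0, T] ->
          cvg_in_prob0 (fun n w =>
            (enorm (simple_int W (Hn n) w t - I w t))%:E)].

(* X_t = x + int_0^t B_s ds + int_0^t S_s dW_s for all t in [0, T], where X is
   a continuous adapted process. *)
Definition ito_equation (W : Omega -> R -> 'cV[R]_q) (x : 'cV[R]_d)
    (B : Omega -> R -> 'cV[R]_d) (S : Omega -> R -> 'M[R]_(d, q))
    (X : Omega -> R -> 'cV[R]_d) : Prop :=
  [/\ forall w, continuous_path T (X w),
      adapted X &
      exists2 I, ito_integral W S I &
        forall t, t \in `[0, T] ->
          {ae P, forall w, X w t = x
             + (\col_i \int[lebesgue_measure]_(s in `[0, t]) B w s i ord0)
             + I w t}].

Definition diffusion (W : Omega -> R -> 'cV[R]_q)
    (b : R -> 'cV[R]_d -> 'cV[R]_d) (sigma : R -> 'cV[R]_d -> 'M[R]_(d, q))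
    (x : 'cV[R]_d) (X : Omega -> R -> 'cV[R]_d) : Prop :=
  ito_equation W x (fun w s => b s (X w s)) (fun w s => sigma s (X w s)) X.

(* phi(t) = i * Delta for i * Delta <= t < (i + 1) * Delta *)
Definition grid_floor (Delta t : R) : R :=
  (Num.floor (t / Delta))%:~R * Delta.

Definition euler_scheme (W : Omega -> R -> 'cV[R]_q)
    (b : R -> 'cV[R]_d -> 'cV[R]_d) (sigma : R -> 'cV[R]_d -> 'M[R]_(d, q))
    (x : 'cV[R]_d) (N : nat) (X : Omega -> R -> 'cV[R]_d) : Prop :=
  let phi := grid_floor (T / N%:R) in
  ito_equation W x (fun w s => b (phi s) (X w (phi s)))
    (fun w s => sigma (phi s) (X w (phi s))) X.

End ito.
End stochastic_calculus.

(* Y k, k < M, are independent random paths, possibly on another probability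
   space, with the law of X. *)
Definition independent_copies (R : realType) (d : nat) (T : R)
    (disp : measure_display) (Omega : measurableType disp)
    (P : probability Omega R) (X : Omega -> R -> 'cV[R]_d)
    (disp' : measure_display) (Omega' : measurableType disp')
    (P' : probability Omega' R) (M : nat)
    (Y : 'I_M -> Omega' -> R -> 'cV[R]_d) : Prop :=
  [/\ forall k w, continuous_path T (Y k w),
      forall k t, t \in `[0, T] -> rv_measurable measurable (fun w => Y k w t),
      forall k A, path_measurable T A -> P' (Y k @^-1` A) = P (X @^-1` A) &
      forall A : 'I_M -> set (R -> 'cV[R]_d),
        (forall k, path_measurable T (A k)) ->
        P' [set w | forall k, A k (Y k w)] =
        (\prod_(k < M) P' (Y k @^-1` A k))%E].

Section deviation.
Variable R : realType.

Definition kappa (Cb Csigma T : R) : R := 28 * (1 + Num.max Csigma Cb * T).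

Definition deviation_bound (d : nat) (K : R) (x : 'cV[R]_d) (M : nat) (r : R)
    : R :=
  let c := 2 * (1 + enorm x) in
  if r <= (Num.sqrt M%:R)^-1 * c * expR K
  then 2 * expR (- (r ^+ 2 * M%:R / (c ^+ 2 * expR (2 * K))))
  else 2 * expR (- ((4 * K)^-1 * ln (r ^+ 2 * M%:R / c ^+ 2) ^+ 2)).

(* The deviation is computed in the extended reals: it is infinite if
   f(X) is not integrable. *)
Definition monte_carlo_deviation (d : nat) (T K : R) (x : 'cV[R]_d)
    (disp : measure_display) (Omega : measurableType disp)
    (P : probability Omega R) (X : Omega -> R -> 'cV[R]_d) : Prop :=
  forall f : (R -> 'cV[R]_d) -> R, lipschitz1 T f ->
  forall M : nat, (0 < M)%N ->
  forall r : R, 0 <= r ->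
  forall (disp' : measure_display) (Omega' : measurableType disp')
         (P' : probability Omega' R) (Y : 'I_M -> Omega' -> R -> 'cV[R]_d),
    independent_copies T P X P' Y ->
    (P' [set w | r%:E <= `| ((M%:R)^-1 * \sum_(k < M) f (Y k w))%R%:E
                            - 'E_P[fun w0 => f (X w0)] |]
     <= (deviation_bound K x M r)%:E)%E.

End deviation.

(* Main.v *)
Require Import Defs.
From mathcomp Require Import all_boot all_order all_algebra.
From mathcomp Require Import all_classical all_reals all_analysis.
From mathcomp Require Import measurable_realfun ring lra zify.

(* All moments are estimated without stochastic calculus, by comparing X with a
   discrete chain on a coarse grid of mesh h.  On each cell the chain moves by a
   drift of norm at most C h (1 + |X| + eps) and by the Brownian increments of a
   simple process approximating the diffusion coefficient, projected onto the
   ball of squared radius C (1 + (|X| + eps)^2), X being taken at the last time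
   at which the coefficients were refreshed; the chain is frozen when it loses
   track of X.  A Gaussian increment satisfies
   E (a + |y + H dW|^2)^p <= E (a + |y|^2 + 6 p |H|^2 dt)^p, so that the
   quadratic growth of the coefficients gives
   E (1 + |Y_T|^2)^p <= ((1 + |x|^2) exp (C (4 + 15 p / 2) T))^p.
   On an event of probability close to 1 the chain stays close to X until 1 + |X|^2
   is large, hence, freezing it also when it leaves a ball, the same bound for the
   tail of sup |X|, and by a dyadic decomposition
   E (f(X) - E f(X))^(2 m) <= (25 (1 + |x|^2) exp (19 m C T))^m for every m >= 1.
   For a sum S of M independent centred variables with these moments,
   E S^(2 m) <= (2 16^m M zeta)^m with zeta the base of the power above, and the
   Markov inequality gives P <= (c^2 / (r^2 M))^m exp (21 (1 + C T) m^2) with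
   c = 2 (1 + |x|).  The theorem is the case m = 1 for small r, and the integer m
   following log (r^2 M / c^2) / (2 kappa) otherwise. *)
Set Implicit Arguments.
Unset Strict Implicit.
Unset Printing Implicit Defensive.

Import Order.TTheory GRing.Theory Num.Theory.
Import numFieldNormedType.Exports.
Local Open Scope classical_set_scope.
Local Open Scope ring_scope.

(** * Frobenius norm *)

(** The stochastic integral is given only as a limit in probability of integrals of simple
    processes: moments do not pass to such a limit, probabilities of events do. Hence moments are
    estimated for chains that obey the growth bounds on all of [Omega], thanks to the projections,
    and X enters only through the event on which it is tracked. Freezing replaces a maximal
    inequality: a chain stopped at its exit from a ball still has a large norm at time T, so the
    Markov inequality at the terminal time controls the running maximum. The grid has [np] periods
    of [ns] cells. Coefficients are refreshed once per period; for the Euler scheme the period is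
    the step T / N, however large, and [ns] makes the cells small enough for the one-step estimate.
    The tolerance [eps] = 1/16 costs the factor 5/4 in the level and the rate C (3 + 15 p / 2). With
    p = 2 m the exponent 4 + 15 m is at most 19 m; going from 19 to 21 leaves room for the powers of
    16 and the numerical factors; 28 = (4/3) 21 leaves the margin that pays for rounding the optimal
    exponent to an integer. *)

Section euclidean_norm.
Context {R : realType}.

(** Lagrange's identity: the sum of all (a_i b_j - a_j b_i)^2 is twice the difference of the two
    sides. *)
Lemma sum_cauchy_schwarz (I : finType) (a b : I -> R) :
  (\sum_i a i * b i) ^+ 2 <= (\sum_i a i ^+ 2) * (\sum_i b i ^+ 2).
Proof.
have H : 0 <= \sum_i \sum_j (a i * b j - a j * b i) ^+ 2.
  by apply: sumr_ge0 => i _; apply: sumr_ge0 => j _; exact: sqr_ge0.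
have E : \sum_i \sum_j (a i * b j - a j * b i) ^+ 2 =
    ((\sum_i a i ^+ 2) * (\sum_i b i ^+ 2)) *+ 2 - (\sum_i a i * b i) ^+ 2 *+ 2.
  rewrite mulr2n {2}(mulrC (\sum_i a i ^+ 2)) expr2 mulr2n !mulr_suml -!big_split -sumrB /=.
  apply: eq_bigr => i _; rewrite !mulr_sumr -!big_split -sumrB /=.
  by apply: eq_bigr => j _; ring.
lra.
Qed.

Definition mdot (m n : nat) (A B : 'M[R]_(m, n)) : R :=
  \sum_i \sum_j A i j * B i j.

Lemma mdotDl m n (A B C : 'M[R]_(m, n)) : mdot (A + B) C = mdot A C + mdot B C.
Proof.
rewrite /mdot -big_split; apply: eq_bigr => i _ /=; rewrite -big_split /=.
by apply: eq_bigr => j _; rewrite mxE mulrDl.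
Qed.

Lemma mdotC m n (A B : 'M[R]_(m, n)) : mdot A B = mdot B A.
Proof. by apply: eq_bigr => i _; apply: eq_bigr => j _; rewrite mulrC. Qed.

Lemma mdotDr m n (A B C : 'M[R]_(m, n)) : mdot A (B + C) = mdot A B + mdot A C.
Proof. by rewrite mdotC mdotDl !(mdotC A). Qed.

Lemma mdotZl m n k (A B : 'M[R]_(m, n)) : mdot (k *: A) B = k * mdot A B.
Proof.
rewrite /mdot mulr_sumr; apply: eq_bigr => i _; rewrite mulr_sumr.
by apply: eq_bigr => j _; rewrite mxE mulrA.
Qed.

Lemma mdotZr m n k (A B : 'M[R]_(m, n)) : mdot A (k *: B) = k * mdot A B.
Proof. by rewrite mdotC mdotZl mdotC. Qed.

Lemma mdot_cauchy_schwarz m n (A B : 'M[R]_(m, n)) :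
  mdot A B ^+ 2 <= mdot A A * mdot B B.
Proof.
by rewrite /mdot !pair_big /= (le_trans (sum_cauchy_schwarz _ _)).
Qed.

Lemma mdot_ge0 m n (A : 'M[R]_(m, n)) : 0 <= mdot A A.
Proof.
by apply: sumr_ge0 => i _; apply: sumr_ge0 => j _; rewrite -expr2 sqr_ge0.
Qed.

Lemma enorm_ge0 m n (A : 'M[R]_(m, n)) : 0 <= enorm A.
Proof. exact: sqrtr_ge0. Qed.
Hint Resolve enorm_ge0 : core.

Lemma enorm_sqr m n (A : 'M[R]_(m, n)) : enorm A ^+ 2 = mdot A A.
Proof.
rewrite /enorm sqr_sqrtr; last first.
  by apply: sumr_ge0 => i _; apply: sumr_ge0 => j _; rewrite sqr_ge0.
by apply: eq_bigr => i _; apply: eq_bigr => j _; rewrite expr2.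
Qed.

Lemma le_mdot_enorm m n (A B : 'M[R]_(m, n)) : `|mdot A B| <= enorm A * enorm B.
Proof.
rewrite -(@ler_pXn2r _ 2) ?nnegrE ?mulr_ge0//.
by rewrite exprMn !enorm_sqr real_normK ?num_real// mdot_cauchy_schwarz.
Qed.

Lemma enormD_sqr m n (A B : 'M[R]_(m, n)) :
  enorm (A + B) ^+ 2 = enorm A ^+ 2 + 2 * mdot A B + enorm B ^+ 2.
Proof. by rewrite !enorm_sqr mdotDl !mdotDr (mdotC B A); ring. Qed.

Lemma ler_enormD m n (A B : 'M[R]_(m, n)) : enorm (A + B) <= enorm A + enorm B.
Proof.
rewrite -(@ler_pXn2r _ 2) ?nnegrE ?addr_ge0// enormD_sqr.
have := le_trans (ler_norm _) (le_mdot_enorm A B); nra.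
Qed.

Lemma enormZ m n k (A : 'M[R]_(m, n)) : enorm (k *: A) = `|k| * enorm A.
Proof.
apply/eqP; rewrite -(@eqrXn2 _ 2) ?mulr_ge0// exprMn !enorm_sqr mdotZl mdotZr.
by rewrite real_normK ?num_real// mulrA -expr2.
Qed.

Lemma enormN m n (A : 'M[R]_(m, n)) : enorm (- A) = enorm A.
Proof. by rewrite -scaleN1r enormZ normrN1 mul1r. Qed.

Lemma enorm0 m n : enorm (0 : 'M[R]_(m, n)) = 0.
Proof. by rewrite -(scale0r 0) enormZ normr0 mul0r. Qed.

Lemma enorm_distC m n (A B : 'M[R]_(m, n)) : enorm (A - B) = enorm (B - A).
Proof. by rewrite -enormN opprB. Qed.

Lemma ler_enormB m n (A B C : 'M[R]_(m, n)) :
  enorm (A - C) <= enorm (A - B) + enorm (B - C).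
Proof. by rewrite (le_trans _ (ler_enormD _ _))// addrA subrK. Qed.

Lemma ler_enorm_dist m n (A B : 'M[R]_(m, n)) : enorm A <= enorm B + enorm (A - B).
Proof. by rewrite (le_trans _ (ler_enormD _ _))// addrC subrK. Qed.

Lemma ler_enorm_sum m n (I : Type) (r : seq I) (Q : pred I) (A : I -> 'M[R]_(m, n)) :
  enorm (\sum_(i <- r | Q i) A i) <= \sum_(i <- r | Q i) enorm (A i).
Proof.
elim/big_ind2 : _ => //; first by rewrite enorm0.
by move=> ? ? ? ? ? ?; rewrite (le_trans (ler_enormD _ _))// lerD.
Qed.

Lemma normr_le_enorm m n (A : 'M[R]_(m, n)) i j : `|A i j| <= enorm A.
Proof.
rewrite -(@ler_pXn2r _ 2) ?nnegrE// real_normK ?num_real// enorm_sqr /mdot.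
rewrite (bigD1 i)//= (bigD1 j)//= -expr2 -addrA lerDl addr_ge0//.
  by apply: sumr_ge0 => k _; rewrite -expr2 sqr_ge0.
by apply: sumr_ge0 => k _; apply: sumr_ge0 => l _; rewrite -expr2 sqr_ge0.
Qed.

Lemma enorm_le_sum m n (A : 'M[R]_(m, n)) : enorm A <= \sum_i \sum_j `|A i j|.
Proof.
rewrite {1}[A]matrix_sum_delta (le_trans (ler_enorm_sum _ _ _))// ler_sum// => i _.
rewrite (le_trans (ler_enorm_sum _ _ _))// ler_sum// => j _.
rewrite enormZ ler_piMr// -(@ler_pXn2r _ 2) ?nnegrE// expr1n enorm_sqr /mdot.
rewrite (bigD1 i)//= (bigD1 j)//= mxE !eqxx mulr1.
rewrite [X in _ + X + _]big1 ?[X in _ + _ + X]big1 ?addr0//.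
  by move=> k /negbTE ki; rewrite big1// => l _; rewrite mxE ki mul0r.
by move=> k /negbTE kj; rewrite mxE kj andbF mul0r.
Qed.

(** Continuity of paths refers to the sup norm; this comparison converts it to [enorm]. *)
Lemma enorm_le_normr m n (A : 'M[R]_(m, n)) : enorm A <= (m * n)%:R * `|A|.
Proof.
rewrite (le_trans (enorm_le_sum _))//.
rewrite (le_trans (ler_sum _ (G := fun=> \sum_(j < n) `|A|) _))//.
  move=> i _; rewrite ler_sum// => j _.
  rewrite /Num.norm/= mx_normrE; apply: (@le_bigmax _ _ _ 0 (fun ij => `|A ij.1 ij.2|) (i, j)).
by rewrite !sumr_const !card_ord -mulrnA mulr_natl mulnC.
Qed.

Lemma mxtrace_mul_tr m n (A : 'M[R]_(m, n)) : \tr (A *m A^T) = enorm A ^+ 2.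
Proof.
rewrite enorm_sqr; apply: eq_bigr => i _; rewrite mxE.
by apply: eq_bigr => j _; rewrite mxE.
Qed.

Definition ball_proj (m n : nat) (rho : R) (A : 'M[R]_(m, n)) : 'M[R]_(m, n) :=
  if enorm A <= rho then A else (rho / enorm A) *: A.

Lemma enorm_ball_proj m n rho (A : 'M[R]_(m, n)) : 0 <= rho ->
  enorm (ball_proj rho A) <= rho.
Proof.
move=> r0; rewrite /ball_proj; have [//|h] := leP (enorm A) rho.
have A0 : 0 < enorm A by exact: le_lt_trans r0 h.
by rewrite enormZ ger0_norm ?divr_ge0// divfK ?gt_eqF.
Qed.

(** Outside the ball, A moves by |A| - rho <= |A| - |B| <= |A - B|. With B a true coefficient,
    projecting an approximation A of it moves A no further than the error of the approximation. *)
Lemma ball_proj_dist m n rho (A B : 'M[R]_(m, n)) : enorm B <= rho ->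
  enorm (ball_proj rho A - A) <= enorm (A - B).
Proof.
move=> Br; rewrite /ball_proj; have [h|h] := leP (enorm A) rho.
  by rewrite subrr enorm0.
have A0 : 0 < enorm A by exact: le_lt_trans (le_trans (enorm_ge0 B) Br) h.
have -> : (rho / enorm A) *: A - A = (rho / enorm A - 1) *: A.
  by rewrite scalerBl scale1r.
rewrite enormZ distrC ger0_norm; last first.
  by rewrite subr_ge0 ler_pdivrMr// mul1r ltW.
rewrite mulrBl mul1r divfK ?gt_eqF// lerBlDr.
have := ler_enorm_dist A B; lra.
Qed.

End euclidean_norm.
#[global] Hint Resolve enorm_ge0 : core.

(** * Monotone integration and elementary inequalities *)

Section integral_lemmas.
Local Open Scope ereal_scope.
Context d (T : measurableType d) (R : realType) (mu : {measure set T -> \bar R}).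

(** The integral of a nonnegative function is a supremum over the simple functions below it, which
    is monotone for arbitrary functions. This spares a measurability proof at each pointwise
    comparison. *)
Lemma ge0_le_integral_nonmeas (D : set T) (f g : T -> \bar R) :
  (forall x, D x -> 0 <= f x) -> (forall x, D x -> f x <= g x) ->
  \int[mu]_(x in D) f x <= \int[mu]_(x in D) g x.
Proof.
move=> f0 fg.
rewrite ge0_integralE// ge0_integralE//; last first.
  by move=> x Dx; rewrite (le_trans (f0 x Dx)) ?fg.
apply: le_ereal_sup => _ [h hf <-]; exists h => // x.
rewrite (le_trans (hf x))// !patchE; case: ifPn => //; rewrite inE; exact: fg.
Qed.

End integral_lemmas.

Section real_lemmas.
Context {R : realType}.

(** From exp (-1/6) >= 5/6 one gets e <= (6/5)^6 < 3. *)
Lemma expR1_le3 : expR 1 <= 3 :> R.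
Proof.
have h : (5 / 6 : R) <= expR (- (1 / 6)).
  by apply: le_trans (expR_ge1Dx _); lra.
have -> : (1 : R) = 6%:R * (1 / 6) by lra.
rewrite expRM_natl; have : expR (1 / 6) <= (6 / 5 : R).
  rewrite -[_ (1 / 6)]invrK -expRN -[6 / 5]invrK lef_pV2 ?posrE ?expR_gt0//; lra.
move=> /(lerXn2r 6) => /(_ _ _)/le_trans; apply; rewrite ?nnegrE ?expR_ge0//; lra.
Qed.

(** The left side is one term of the power series of 2 cosh x, whose terms are all nonnegative. *)
Lemma exprn_le_cosh (x : R) (j : nat) :
  x ^+ j.*2 / (j.*2)`!%:R *+ 2 <= expR x + expR (- x).
Proof.
have cx := is_cvg_series_exp_coeff x; have cNx := is_cvg_series_exp_coeff (- x).
pose u := series (exp_coeff x) \+ series (exp_coeff (- x)).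
have uE n : u n = \sum_(0 <= k < n) (x ^+ k + (- x) ^+ k) / k`!%:R.
  by rewrite /u /series /= -big_split; apply: eq_bigr => k _; rewrite /exp_coeff /= mulrDl.
have pos k : 0 <= (x ^+ k + (- x) ^+ k) / k`!%:R.
  apply: divr_ge0 => //; rewrite exprNn; have [ok|ek] := boolP (odd k).
    by rewrite -signr_odd ok mulN1r subrr.
  by rewrite -signr_odd (negbTE ek) mul1r -mulr2n mulrn_wge0// exprn_even_ge0.
have -> : expR x + expR (- x) = limn u by apply/esym/cvg_lim => //; exact: cvgD.
apply: (@le_trans _ _ (u (j.*2).+1)).
  rewrite uE big_nat_recr//= exprNn -signr_odd odd_double mul1r -mulr2n -mulrnAl.
  by rewrite lerDr sumr_ge0.
apply: nondecreasing_cvgn_le; last exact: is_cvgD.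
by apply/nondecreasing_seqP => n; rewrite !uE big_nat_recr//= lerDl.
Qed.

Lemma fact_le_expn n : (n`! <= n ^ n)%N.
Proof.
elim: n => [//|n IH]; rewrite factS expnS leq_mul2l /= (leq_trans IH)//.
by have [->//|n0] := posnP n; rewrite leq_exp2r.
Qed.

(** Group the factors in pairs: (2p - 2j) (2p - 2j - 1) <= (p - j) 4p. *)
Lemma ffact_double_le p j : ((p.*2) ^_ (j.*2) <= p ^_ j * (4 * p) ^ j)%N.
Proof.
elim: j => [|j IH]; first by rewrite !ffactn0.
rewrite doubleS !ffactnSr expnSr.
apply: (@leq_trans ((p.*2)^_(j.*2) * ((p - j) * (4 * p)))); last first.
  by rewrite [X in (_ <= X)%N]mulnACA leq_mul.
rewrite -mulnA leq_mul2l; apply/orP; right.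
by rewrite -doubleB -mul2n mulnAC -[X in (_ <= X)%N]mulnCA; nia.
Qed.

Lemma sum_double (V : nmodType) (f : nat -> V) n :
  \sum_(i < n.*2) f i = \sum_(j < n) (f j.*2 + f j.*2.+1).
Proof.
elim: n => [|n IH]; first by rewrite !big_ord0.
by rewrite doubleS !big_ord_recr /= IH addrA.
Qed.

Lemma exprD_even (u v : R) p :
  (u + v) ^+ p.*2 + (u - v) ^+ p.*2 =
  (\sum_(j < p.+1) 'C(p.*2, j.*2)%:R * (u ^+ 2) ^+ (p - j) * (v ^+ 2) ^+ j) *+ 2.
Proof.
rewrite exprDn exprBn -big_split /=.
pose f i := u ^+ (p.*2 - i) * v ^+ i *+ 'C(p.*2, i) +
   (-1) ^+ i * u ^+ (p.*2 - i) * v ^+ i *+ 'C(p.*2, i).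
transitivity (\sum_(i < p.*2.+1) f i) => [//|].
(* The added term has index 2p + 1 and vanishes with its binomial coefficient; the even number of
   terms allows pairing them. *)
have -> : \sum_(i < p.*2.+1) f i = \sum_(i < (p.+1).*2) f i.
  by rewrite doubleS [RHS]big_ord_recr /= [X in _ = _ + X]/f bin_small ?addr0.
rewrite sum_double -sumrMnl; apply: eq_bigr => j _.
have e : (-1) ^+ j.*2 = 1 :> R by rewrite -signr_odd odd_double.
rewrite /f [(-1) ^+ j.*2.+1]exprS e !mulr1 mul1r mulN1r.
rewrite mulNr mulNrn subrr addr0 -doubleB -!mul2n !exprM -mulr2n.
by rewrite -[in LHS]mulr_natl mulrA.
Qed.

End real_lemmas.

(** * Gaussian moments *)

Section gaussian.
Context {R : realType}.
Local Notation mu := (@lebesgue_measure R).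

(** The change of variables is made with the Radon-Nikodym derivative, which equals the Gaussian
    density almost everywhere since both have the same integral on every measurable set. *)
Lemma ge0_integral_normal_prob (m s : R) (f : R -> \bar R) :
  measurable_fun [set: R] f -> (forall x, (0 <= f x)%E) ->
  (\int[normal_prob m s]_x f x = \int[mu]_x (f x * (normal_pdf m s x)%:E))%E.
Proof.
move=> mf f0; have dom := @normal_prob_dominates R m s.
rewrite -(Radon_Nikodym_SigmaFinite.change_of_variables dom)//.
have mpdf : measurable_fun [set: R] (fun x => (normal_pdf m s x)%:E).
  by apply/measurable_EFinP; exact: measurable_normal_pdf.
have irn := Radon_Nikodym_SigmaFinite.f_integrable dom.
apply: ae_eq_integral => //.
- by apply: emeasurable_funM => //; exact: measurable_int irn.
- exact: emeasurable_funM.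
- apply: ae_eqe_mul2l; apply: integral_ae_eq => //.
  by move=> A AE mA; rewrite -Radon_Nikodym_SigmaFinite.f_integral.
Qed.

Lemma integral_normal_prob_opp (s : R) (f : R -> \bar R) : s != 0 ->
  measurable_fun [set: R] f -> (forall x, (0 <= f x)%E) ->
  (\int[normal_prob 0 s]_x f (- x)%R = \int[normal_prob 0 s]_x f x)%E.
Proof.
move=> s0 mf f0.
have mN : measurable_fun [set: R] (fun x => f (- x)) by exact: measurableT_comp.
rewrite !ge0_integral_normal_prob//.
pose g x := (f x * (normal_pdf 0 s x)%:E)%E.
transitivity (\int[mu]_x g (- x)%R)%E.
  apply: eq_integral => x _; rewrite /g !normal_pdfE// /normal_fun.
  by rewrite !subr0 sqrrN.
have mg : measurable_fun [set: R] g.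
  apply: emeasurable_funM => //.
  by apply/measurable_EFinP; exact: measurable_normal_pdf.
have g0 x : (0 <= g x)%E by rewrite mule_ge0// lee_fin normal_pdf_ge0.
transitivity (\int[pushforward mu (-%R : _ -> measurableTypeR R)]_x g x)%E.
  by rewrite ge0_integral_pushforward.
by apply: eq_measure_integral => A mA _; exact: lebesgue_measureN.
Qed.

(** Completing the square turns exp (t x) times the density of N(0, s^2) into a constant times the
    density of N(t s^2, s^2). *)
Lemma normal_mgf (s t : R) : s != 0 ->
  (\int[normal_prob 0 s]_x (expR (t * x))%:E = (expR (t ^+ 2 * s ^+ 2 / 2))%:E)%E.
Proof.
move=> s0; rewrite ge0_integral_normal_prob//; last first.
  by apply/measurable_EFinP; apply: measurableT_comp => //; exact: measurable_funM.
transitivity (\int[mu]_x ((expR (t ^+ 2 * s ^+ 2 / 2))%:E *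
    (normal_pdf (t * s ^+ 2) s x)%:E))%E.
  apply: eq_integral => x _; rewrite -!EFinM !normal_pdfE// /normal_fun; congr EFin.
  rewrite mulrCA [RHS]mulrCA -!expRD; congr (_ * expR _); field.
  by rewrite s0.
rewrite ge0_integralZl//; first by rewrite integral_normal_pdf mule1.
- by apply/measurable_EFinP; exact: measurable_normal_pdf.
- by move=> x _; rewrite lee_fin normal_pdf_ge0.
Qed.

(* The even moments are bounded by integrating exprn_le_cosh at t z with
   t^2 s^2 = 2j. *)
Lemma normal_moment_le (s : R) (j : nat) : 0 < s ->
  (\int[normal_prob 0 s]_x (x ^+ j.*2)%:E <=
    ((j.*2)`!%:R * (3 * s ^+ 2 / (j.*2)%:R) ^+ j)%:E)%E.
Proof.
move=> s0; have [->|j0] := posnP j.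
  rewrite fact0 !mulr1.
  under eq_integral do rewrite expr0.
  rewrite integral_cst// [X in (_ * X)%E](_ : _ = 1%E) ?mule1//.
  exact: (@probability_setT _ _ _ (normal_prob 0 s)).
pose t := Num.sqrt (j.*2)%:R / s.
have j2 : 0 < (j.*2)%:R :> R by rewrite ltr0n double_gt0.
have t0 : 0 < t by rewrite divr_gt0// sqrtr_gt0.
have tE : t ^+ 2 * s ^+ 2 = (j.*2)%:R.
  by rewrite /t exprMn exprVn divfK ?expf_neq0 ?gt_eqF// sqr_sqrtr// ltW.
pose c := (j.*2)`!%:R / t ^+ j.*2 / 2.
have c0 : 0 <= c by rewrite !divr_ge0// exprn_ge0// ltW.
apply: (@le_trans _ _ (\int[normal_prob 0 s]_x
    (c%:E * ((expR (t * x))%:E + (expR (- t * x))%:E)))%E).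
  apply: ge0_le_integral_nonmeas => x _.
    by rewrite lee_fin exprn_even_ge0// odd_double.
  rewrite -EFinD -EFinM lee_fin mulNr.
  have := exprn_le_cosh (t * x) j; rewrite exprMn -mulr_natr => h.
  have f0 : 0 < (j.*2)`!%:R :> R by rewrite ltr0n fact_gt0.
  have tj : 0 < t ^+ j.*2 by rewrite exprn_gt0.
  apply: le_trans (ler_wpM2l c0 h).
  by rewrite le_eqVlt; apply/orP; left; apply/eqP; rewrite /c; field; rewrite !gt_eqF.
have mexp u : measurable_fun [set: R] (fun x => (expR (u * x))%:E).
  by apply/measurable_EFinP; apply: measurableT_comp => //; exact: measurable_funM.
rewrite ge0_integralZl//; last 2 first.
- by apply: emeasurable_funD; exact: mexp.
- by move=> x _; rewrite adde_ge0// lee_fin expR_ge0.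
rewrite ge0_integralD//; [|exact: mexp|exact: mexp].
rewrite !normal_mgf ?gt_eqF// sqrrN tE -EFinD -EFinM lee_fin.
have -> : (j.*2)%:R / 2 = j%:R * 1 :> R.
  by rewrite -mul2n natrM mulrAC divff// mul1r mulr1.
rewrite expRM_natl; have tV : (t ^+ j.*2)^-1 = (s ^+ 2 / (j.*2)%:R) ^+ j.
  rewrite -mul2n exprM -exprVn; congr (_ ^+ j).
  by rewrite mul2n -tE; field; rewrite !gt_eqF.
rewrite /c tV -[3 * _ / _]mulrA; set v := s ^+ 2 / _.
have v0 : 0 <= v by rewrite divr_ge0// sqr_ge0.
rewrite [leLHS](_ : _ = (j.*2)`!%:R * (expR 1 ^+ j * v ^+ j)); last by field.
rewrite ler_wpM2l// [leRHS]exprMn ler_wpM2r ?exprn_ge0//.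
by rewrite lerXn2r ?nnegrE ?expR_ge0 ?expR1_le3.
Qed.

End gaussian.

Section gaussian_quadratic.
Context {R : realType}.

(** The induction step reduces to t (1 - t) (u^p - v^p) (u - v) >= 0. *)
Lemma exprn_convex (t u v : R) p : 0 <= t <= 1 -> 0 <= u -> 0 <= v ->
  (t * u + (1 - t) * v) ^+ p <= t * u ^+ p + (1 - t) * v ^+ p.
Proof.
move=> /andP[t0 t1] u0 v0; elim: p => [|p IH]; first by rewrite !expr0; lra.
have w0 : 0 <= t * u + (1 - t) * v by rewrite addr_ge0// mulr_ge0// subr_ge0.
rewrite exprSr (le_trans (ler_wpM2r w0 IH))//.
have h : 0 <= (u ^+ p - v ^+ p) * (u - v).
  have [uv|/ltW vu] := leP u v.
    by rewrite mulr_le0// subr_le0// lerXn2r.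
  by rewrite mulr_ge0// subr_ge0// lerXn2r.
have t'0 : 0 <= 1 - t by rewrite subr_ge0.
have := mulr_ge0 (mulr_ge0 t0 t'0) h; rewrite !exprSr.
by move: (u ^+ p) (v ^+ p) => U V; nra.
Qed.

Lemma double_ereal_le (x : \bar R) (b : R) :
  (0 <= x -> x + x <= (b *+ 2)%:E -> x <= b%:E)%E.
Proof.
by case: x => [x| |]//= x0; rewrite -EFinD !lee_fin -mulr2n lerMn2r.
Qed.

(** Averaging over x and -x keeps the even terms of the binomial expansion; each of them is
    dominated by the term of the same index in the expansion of the right side. *)
Lemma normal_pow_le p (a c s : R) : 0 < s ->
  (\int[normal_prob 0 s]_x ((a + c * x) ^+ p.*2)%:E <=
   ((a ^+ 2 + (6 * p%:R * s ^+ 2) * c ^+ 2) ^+ p)%:E)%E.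
Proof.
move=> s0; pose g x := ((a + c * x) ^+ p.*2)%:E.
have g0 x : (0 <= g x)%E by rewrite lee_fin exprn_even_ge0// odd_double.
have mg : measurable_fun [set: R] g.
  apply/measurable_EFinP; apply: measurable_funX; apply: measurable_funD => //.
have mgN : measurable_fun [set: R] (fun x => g (- x)) by exact: measurableT_comp.
apply: double_ereal_le; first by apply: integral_ge0 => x _; exact: g0.
rewrite -{1}(integral_normal_prob_opp _ mg g0) ?gt_eqF// -ge0_integralD//.
pose h (j : nat) : R := ('C(p.*2, j.*2)%:R * (a ^+ 2) ^+ (p - j) * (c ^+ 2) ^+ j *+ 2)%R.
have -> : (\int[normal_prob 0 s]_x (g (- x)%R + g x) =
    \int[normal_prob 0 s]_x (\sum_(j < p.+1) ((h j)%:E * (x ^+ j.*2)%:E)))%E.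
  apply: eq_integral => x _; rewrite /g mulrN addeC -EFinD exprD_even -sumrMnl -sumEFin.
  apply: eq_bigr => j _; rewrite /h -EFinM; congr EFin.
  have -> : x ^+ j.*2 = (x ^+ 2) ^+ j by rewrite -exprM mul2n.
  rewrite (exprMn 2 c x) (exprMn j (c ^+ 2) (x ^+ 2)).
  by move: (_ ^+ (p - j)) (_ ^+ j) (_ ^+ j) => u v w; ring.
have mX j : measurable_fun [set: R] (fun x : R => (x ^+ j.*2)%:E).
  by apply/measurable_EFinP; exact: measurable_funX.
have X0 j x : (0 <= (x ^+ j.*2 : R)%:E)%E.
  by rewrite lee_fin exprn_even_ge0// odd_double.
have h0 j : 0 <= h j.
  by rewrite /h mulrn_wge0// !mulr_ge0// exprn_ge0// sqr_ge0.
rewrite ge0_integral_sum//; last 2 first.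
- by move=> j; apply: emeasurable_funM; [exact: measurable_cst|exact: mX].
- by move=> j x _; rewrite mule_ge0// lee_fin h0.
rewrite exprDn -sumrMnl -sumEFin lee_sum// => j _.
rewrite ge0_integralZl_EFin//; last exact: mX.
rewrite (le_trans (lee_wpmul2l _ (normal_moment_le j s0))) ?lee_fin ?h0//.
(* The origin of 6 p: C(2p, 2j) (2j)! is a falling factorial, at most C(p, j) j! (4p)^j by
   [ffact_double_le]; then j! <= j^j and 4p j (3 s^2 / 2j) = 6 p s^2. *)
have key : 'C(p.*2, j.*2)%:R * ((j.*2)`!%:R * (3 * s ^+ 2 / (j.*2)%:R) ^+ j) <=
    'C(p, j)%:R * (6 * p%:R * s ^+ 2) ^+ j.
  have [->|j0] := posnP j; first by rewrite double0 !bin0 !expr0 !mulr1.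
  have -> : (6 * p%:R * s ^+ 2) ^+ j =
      (j ^ j * (4 * p) ^ j)%:R * (3 * s ^+ 2 / (j.*2)%:R) ^+ j.
    rewrite -expnMn natrX -exprMn; congr (_ ^+ _); rewrite -mul2n !natrM; field.
    by rewrite pnatr_eq0 -lt0n.
  have : 0 <= (3 * s ^+ 2 / (j.*2)%:R) ^+ j.
    by rewrite exprn_ge0// divr_ge0// mulr_ge0// sqr_ge0.
  move: (_ ^+ j) => v v0; rewrite !mulrA -!natrM; apply: ler_wpM2r => //.
  rewrite bin_ffact ler_nat (leq_trans (ffact_double_le _ _))//.
  by rewrite mulnA leq_mul2r; apply/orP; right; rewrite -bin_ffact leq_mul2l fact_le_expn orbT.
have aux (K1 K2 A D F E : R) : K1 * F <= K2 * E -> 0 <= A * D ->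
    (K1 * A * D *+ 2) * F <= (A * (E * D) * K2) *+ 2.
  move=> KE AD; rewrite (_ : _ * F = (A * D) * (K1 * F) *+ 2); last by ring.
  rewrite (_ : _ * K2 = (A * D) * (K2 * E)); last by ring.
  by rewrite lerMn2r /= ler_wpM2l.
rewrite (exprMn j (6 * p%:R * s ^+ 2)) -(mulr_natr (_ * _) 'C(p, j)).
by apply: aux => //; rewrite mulr_ge0// exprn_ge0// sqr_ge0.
- by move=> x _; exact: g0.
Qed.

(** The condition on b makes the quadratic a convex combination of (sqrt a + sqrt c x)^2 and (sqrt a
    - sqrt c x)^2, for which [normal_pow_le] gives the same bound. *)
Lemma normal_quad_le p (a b c s : R) : 0 < s -> 0 <= a -> 0 <= c -> b ^+ 2 <= a * c ->
  (\int[normal_prob 0 s]_x ((a + 2 * b * x + c * x ^+ 2) ^+ p)%:E <=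
   ((a + (6 * p%:R * s ^+ 2) * c) ^+ p)%:E)%E.
Proof.
move=> s0 a0 c0 bac; pose al := Num.sqrt a; pose ga := Num.sqrt c.
have al2 : al ^+ 2 = a by rewrite sqr_sqrtr.
have ga2 : ga ^+ 2 = c by rewrite sqr_sqrtr.
have m0 : 0 <= al * ga by rewrite mulr_ge0// sqrtr_ge0.
have bm : `|b| <= al * ga.
  by rewrite -(@ler_pXn2r _ 2) ?nnegrE// real_normK ?num_real// exprMn al2 ga2.
(* If [al * ga] = 0 then b = 0, and the convention 1/0 = 0 gives t = 1/2, which is correct. *)
pose t := (1 + b / (al * ga)) / 2.
have tb : (2 * t - 1) * (al * ga) = b.
  have [e|e] := eqVneq (al * ga) 0.
    by rewrite e mulr0; move: bm; rewrite e normr_le0 => /eqP.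
  by rewrite /t; field; move: e; rewrite mulf_eq0 negb_or => /andP[-> ->].
have t01 : 0 <= t <= 1.
  have : `|b / (al * ga)| <= 1.
    rewrite normrM normfV (ger0_norm m0).
    have [->|e] := eqVneq (al * ga) 0; first by rewrite invr0 mulr0.
    by rewrite ler_pdivrMr ?mul1r// lt0r e.
  by rewrite ler_norml /t => /andP[]; lra.
have mg e : measurable_fun [set: R] (fun x : R => ((al + e * x) ^+ p.*2)%:E).
  by apply/measurable_EFinP; apply: measurable_funX; apply: measurable_funD.
have g0 e x : (0 <= ((al + e * x) ^+ p.*2)%:E)%E.
  by rewrite lee_fin exprn_even_ge0// odd_double.
have t0 : 0 <= t by case/andP: t01.
have t'0 : 0 <= 1 - t by rewrite subr_ge0; case/andP: t01.
apply: (@le_trans _ _ (\int[normal_prob 0 s]_x (t%:E * ((al + ga * x) ^+ p.*2)%:E +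
   (1 - t)%:E * ((al + (- ga) * x) ^+ p.*2)%:E)))%E.
  have E x : a + 2 * b * x + c * x ^+ 2 =
      t * (al + ga * x) ^+ 2 + (1 - t) * (al + - ga * x) ^+ 2.
    by rewrite -al2 -ga2 -tb; ring.
  apply: ge0_le_integral_nonmeas => x _.
    by rewrite lee_fin exprn_ge0// E addr_ge0// mulr_ge0// sqr_ge0.
  rewrite -!EFinM -EFinD lee_fin E -!mul2n !exprM.
  by apply: exprn_convex => //; exact: sqr_ge0.
rewrite ge0_integralD//; last 4 first.
- by move=> x _; rewrite mule_ge0// lee_fin.
- by apply: emeasurable_funM; [exact: measurable_cst|exact: mg].
- by move=> x _; rewrite mule_ge0// lee_fin.
- by apply: emeasurable_funM; [exact: measurable_cst|exact: mg].
rewrite !ge0_integralZl_EFin//.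
rewrite (le_trans (leeD (lee_wpmul2l _ (normal_pow_le p al ga s0))
  (lee_wpmul2l _ (normal_pow_le p al (- ga) s0))))// ?lee_fin//.
- by rewrite sqrrN al2 ga2 -mulrDl addrC subrK mul1r.
- exact: mg.
- exact: mg.
Qed.

End gaussian_quadratic.

(** * Independence *)

Section independence.
Context {R : realType} d (T : measurableType d) (P : probability T R).

Lemma g_sigma_sub (G : set (set T)) :
  G `<=` measurable -> <<s G >> `<=` measurable.
Proof. exact: (smallest_sub (@sigma_algebra_measurable _ T)). Qed.

Lemma measurable_id_g_sigma (G : set (set T)) : G `<=` measurable ->
  measurable_fun [set: T] (id : T -> g_sigma_algebraType G).
Proof. by move=> GM _ A mA; rewrite setTI; exact: (g_sigma_sub GM). Qed.

Lemma measurable_fun_g_sigma d' (T' : measurableType d') (G : set (set T))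
    (f : T -> T') : G `<=` measurable ->
  measurable_fun setT (f : g_sigma_algebraType G -> T') -> measurable_fun setT f.
Proof.
move=> GM mf; apply: (@measurableT_comp _ _ _ T (g_sigma_algebraType G) T' f _ id) => //.
exact: measurable_id_g_sigma.
Qed.

(** Both sides are finite measures in A that agree on a pi-system containing the whole space. *)
Lemma indep_g_sigma (G : set (set T)) (C : set T) (r : {nonneg R}) :
  G `<=` measurable -> setI_closed G -> G setT -> measurable C ->
  (forall A, G A -> P (A `&` C) = (P A * r%:num%:E)%E) ->
  forall A, <<s G >> A -> P (A `&` C) = (P A * r%:num%:E)%E.
Proof.
move=> GM GI GT mC H A sA.
have := @g_sigma_algebra_measure_unique _ R T G GM (fun=> setT) (fun=> GT) _
  (mrestr P mC) (mscale r P) _ _ _ A sA.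
rewrite /mrestr/= /mscale/= muleC; apply => //.
- by apply/seteqP; split=> // x _; exists 0%N.
- by move=> B GB; rewrite /mrestr/= /mscale/= H// muleC.
- by move=> k; rewrite /mrestr/= (le_lt_trans (probability_le1 _ _))// ?ltry// setTI.
Qed.

(** Conditioning on G without conditional expectations: the outcome w itself, seen through the
    sigma-algebra generated by G, is the first variable. The joint law of w and xi is then a
    product, and Tonelli's theorem applies. *)
Lemma indep_tonelli (G : set (set T)) (xi : T -> R) (mu : probability R R) :
  G `<=` measurable -> setI_closed G -> G setT -> measurable_fun [set: T] xi ->
  (forall A B, G A -> measurable B -> P (A `&` xi @^-1` B) = (P A * mu B)%E) ->
  forall g : T * R -> \bar R,
  measurable_fun [set: g_sigma_algebraType G * R] g -> (forall z, (0 <= g z)%E) ->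
  (\int[P]_w g (w, xi w) = \int[P]_w \int[mu]_z g (w, z))%E.
Proof.
move=> GM GI GT mxi H g mg g0.
have mid := measurable_id_g_sigma GM.
have mX : measurable_fun [set: T] (fun w => (w, xi w) : g_sigma_algebraType G * R).
  exact/measurable_fun_pair.
pose X : {RV P >-> (g_sigma_algebraType G * R)%type} := mfun_Sub (mem_set mX).
pose I : {RV P >-> g_sigma_algebraType G} := mfun_Sub (mem_set mid).
have XE w : X w = (w, xi w) by [].
transitivity (\int[distribution P X]_z g z)%E.
  by rewrite ge0_integral_distribution.
transitivity (\int[distribution P I \x mu]_z g z)%E.
  apply: eq_measure_integral => A mA _; apply/esym.
  apply: (@product_measure_unique _ _ _ _ _ (distribution P I) mu (distribution P X)) => // A1 B mA1 mB.
  rewrite /distribution /pushforward /=.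
  have mxB : measurable (xi @^-1` B) by rewrite -[X in measurable X]setTI; exact: mxi.
  have muB0 : 0 <= fine (mu B) by rewrite fine_ge0.
  have := @indep_g_sigma G (xi @^-1` B) (NngNum muB0) GM GI GT mxB _ A1 mA1.
  rewrite /= fineK ?fin_num_measure//; apply => A' GA'; exact: H.
rewrite fubini_tonelli1// ge0_integral_distribution//.
- exact: measurable_fun_fubini_tonelli_F.
- by move=> z; apply: integral_ge0.
Qed.

End independence.

(** * Measurability of matrix-valued maps *)

Section mx_measurable.
Context {R : realType} d (T : measurableType d).

Definition mx_measurable m n (Y : T -> 'M[R]_(m, n)) :=
  forall i j, measurable_fun [set: T] (fun w => Y w i j).

Lemma measurable_fun_bigsum (I : Type) (r : seq I) (Q : pred I) (f : I -> T -> R) :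
  (forall i, Q i -> measurable_fun [set: T] (f i)) ->
  measurable_fun [set: T] (fun w => \sum_(i <- r | Q i) f i w).
Proof.
move=> mf; elim: r => [|i r IH].
  rewrite [X in measurable_fun _ X](_ : _ = fun=> 0) //.
  by apply/funext => w; rewrite big_nil.
have [Qi|nQi] := boolP (Q i); last first.
  rewrite [X in measurable_fun _ X](_ : _ = fun w => \sum_(i <- r | Q i) f i w)//.
  by apply/funext => w; rewrite big_cons (negbTE nQi).
rewrite [X in measurable_fun _ X](_ : _ = fun w => f i w + \sum_(i <- r | Q i) f i w).
  by apply: measurable_funD => //; exact: mf.
by apply/funext => w; rewrite big_cons Qi.
Qed.

Lemma mx_measurable_cst m n (A : 'M[R]_(m, n)) : mx_measurable (fun=> A).
Proof. by move=> i j; exact: measurable_cst. Qed.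

Lemma mx_measurableD m n (Y Z : T -> 'M[R]_(m, n)) :
  mx_measurable Y -> mx_measurable Z -> mx_measurable (fun w => Y w + Z w).
Proof.
move=> mY mZ i j; rewrite [X in measurable_fun _ X](_ : _ = fun w => Y w i j + Z w i j).
  by apply: measurable_funD; [exact: mY|exact: mZ].
by apply/funext => w; rewrite mxE.
Qed.

Lemma mx_measurableB m n (Y Z : T -> 'M[R]_(m, n)) :
  mx_measurable Y -> mx_measurable Z -> mx_measurable (fun w => Y w - Z w).
Proof.
move=> mY mZ i j; rewrite [X in measurable_fun _ X](_ : _ = fun w => Y w i j - Z w i j).
  by apply: measurable_funB; [exact: mY|exact: mZ].
by apply/funext => w; rewrite !mxE.
Qed.

Lemma mx_measurableZ m n (k : T -> R) (Y : T -> 'M[R]_(m, n)) :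
  measurable_fun [set: T] k -> mx_measurable Y -> mx_measurable (fun w => k w *: Y w).
Proof.
move=> mk mY i j; rewrite [X in measurable_fun _ X](_ : _ = fun w => k w * Y w i j).
  by apply: measurable_funM => //; exact: mY.
by apply/funext => w; rewrite mxE.
Qed.

Lemma mx_measurable_sum m n (I : Type) (r : seq I) (Q : pred I)
    (Y : I -> T -> 'M[R]_(m, n)) : (forall i, Q i -> mx_measurable (Y i)) ->
  mx_measurable (fun w => \sum_(i <- r | Q i) Y i w).
Proof.
move=> mY i j; rewrite [X in measurable_fun _ X](_ : _ = fun w => \sum_(k <- r | Q k) Y k w i j).
  by apply: measurable_fun_bigsum => k Qk; exact: mY.
by apply/funext => w; rewrite summxE.
Qed.

Lemma mx_measurable_mul m n p (Y : T -> 'M[R]_(m, n)) (Z : T -> 'M[R]_(n, p)) :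
  mx_measurable Y -> mx_measurable Z -> mx_measurable (fun w => Y w *m Z w).
Proof.
move=> mY mZ i j; rewrite [X in measurable_fun _ X](_ : _ = fun w => \sum_k Y w i k * Z w k j).
  by apply: measurable_fun_bigsum => k _; apply: measurable_funM; [exact: mY|exact: mZ].
by apply/funext => w; rewrite mxE.
Qed.

Lemma measurable_mdot m n (Y Z : T -> 'M[R]_(m, n)) :
  mx_measurable Y -> mx_measurable Z -> measurable_fun [set: T] (fun w => mdot (Y w) (Z w)).
Proof.
move=> mY mZ; apply: measurable_fun_bigsum => i _; apply: measurable_fun_bigsum => j _.
by apply: measurable_funM; [exact: mY|exact: mZ].
Qed.

Lemma measurable_sqrtr : measurable_fun [set: R] (@Num.sqrt R).
Proof. by apply: continuous_measurable_fun; exact: sqrt_continuous. Qed.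

Lemma measurable_enorm m n (Y : T -> 'M[R]_(m, n)) :
  mx_measurable Y -> measurable_fun [set: T] (fun w => enorm (Y w)).
Proof.
move=> mY; apply: (measurableT_comp measurable_sqrtr).
apply: measurable_fun_bigsum => i _; apply: measurable_fun_bigsum => j _.
by apply: measurable_funX; exact: mY.
Qed.

Lemma mx_measurable_if m n (b : T -> bool) (Y Z : T -> 'M[R]_(m, n)) :
  measurable_fun [set: T] b -> mx_measurable Y -> mx_measurable Z ->
  mx_measurable (fun w => if b w then Y w else Z w).
Proof.
move=> mb mY mZ i j.
rewrite [X in measurable_fun _ X](_ : _ = fun w => if b w then Y w i j else Z w i j); last first.
  by apply/funext => w; case: ifP.
by apply: measurable_fun_ifT.
Qed.

Lemma measurable_funV (f : T -> R) : measurable_fun [set: T] f ->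
  (forall w, 0 <= f w) -> measurable_fun [set: T] (fun w => (f w)^-1).
Proof.
move=> mf f0.
rewrite [X in measurable_fun _ X](_ : _ = fun w => f w `^ (-1)); last first.
  by apply/funext => w; rewrite powRN powRr1.
exact: (measurableT_comp (@measurable_powR R (-1)) mf).
Qed.

Lemma mx_measurable_ball_proj m n (rho : T -> R) (Y : T -> 'M[R]_(m, n)) :
  measurable_fun [set: T] rho -> mx_measurable Y ->
  mx_measurable (fun w => ball_proj (rho w) (Y w)).
Proof.
move=> mr mY; rewrite /ball_proj; have mE := measurable_enorm mY.
apply: mx_measurable_if => //; first exact: measurable_fun_ler.
apply: mx_measurableZ => //; apply: measurable_funM => //; exact: measurable_funV.
Qed.

End mx_measurable.

(** A sub-sigma-algebra becomes a measurable type with the same carrier, so that adaptedness is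
    proved with the closure lemmas for measurable functions. *)
Lemma rv_measurableP (R : realType) d (T : measurableType d) (G : set (set T)) m n
    (Y : T -> 'M[R]_(m, n)) : sigma_algebra setT G ->
  rv_measurable G Y <-> @mx_measurable R _ (g_sigma_algebraType G) m n Y.
Proof.
move=> sG; split=> H i j.
  by move=> _ B mB; rewrite setTI; apply: sub_sigma_algebra; exact: H.
move=> B mB; have := H i j measurableT B mB; rewrite setTI.
by rewrite [X in X -> _](_ : _ = <<s G >> [set w | B (Y w i j)])// (sigma_algebra_id sG).
Qed.

Section independent_family.
Context {R : realType} d (T : measurableType d) (P : probability T R).
Variables (F : set (set T)) (n : nat) (xi : 'I_n -> T -> R)
  (mu : 'I_n -> probability R R).
Hypothesis FM : F `<=` measurable.
Hypothesis FI : setI_closed F.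
Hypothesis FT : F setT.
Hypothesis mxi : forall i, measurable_fun [set: T] (xi i).
Hypothesis indep : forall A (B : 'I_n -> set R), F A ->
  (forall i, measurable (B i)) ->
  P (A `&` [set w | forall i, B i (xi i w)]) = (P A * \prod_(i < n) mu i (B i))%E.

(* the pi-system generating the information on F and on all xi_i, i <> j *)
Definition others (j : 'I_n) : set (set T) :=
  [set C | exists A (B : 'I_n -> set R), [/\ F A, forall i, measurable (B i),
     B j = setT & C = A `&` [set w | forall i, B i (xi i w)]]].

Lemma others_sub j : others j `<=` measurable.
Proof.
move=> _ [A [B [FA mB _ ->]]]; apply: measurableI; first exact: FM.
rewrite (_ : [set w | _] = \bigcap_(i in [set: 'I_n]) (xi i @^-1` B i)); last first.
  by apply/seteqP; split => [w h i _|w h i]; apply: h.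
apply: fin_bigcap_measurable; first exact: finite_finset.
move=> i _; rewrite -[X in measurable X]setTI; exact: mxi.
Qed.

Lemma othersI j : setI_closed (others j).
Proof.
move=> _ _ [A [B [FA mB Bj ->]]] [A' [B' [FA' mB' Bj' ->]]].
exists (A `&` A'), (fun i => B i `&` B' i); split.
- exact: FI.
- by move=> i; exact: measurableI.
- by rewrite Bj Bj' setTI.
- apply/seteqP; split => w /=.
    by move=> [[Aw h] [Aw' h']]; split=> // i; split.
  by move=> [[Aw Aw'] h]; split; split=> // i; case: (h i).
Qed.

Lemma othersF j A : F A -> others j A.
Proof.
move=> FA; exists A, (fun=> setT); split => //.
by apply/seteqP; split => w; [split|case].
Qed.

Lemma others_xi j i : i != j ->
  measurable_fun [set: g_sigma_algebraType (others j)] (xi i).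
Proof.
move=> ij _ B mB; rewrite setTI; apply: sub_sigma_algebra.
exists setT, (fun k => if k == i then B else setT); split => //.
- by move=> k; case: ifP.
- by rewrite eq_sym (negbTE ij).
- apply/seteqP; split => w /=.
    by move=> Bw; split => // k; case: eqP => [->|].
  by move=> [_ /(_ i)]; rewrite eqxx.
Qed.

Lemma others_measurable j d' (T' : measurableType d') (f : T -> T') :
  measurable_fun [set: g_sigma_algebraType F] (f : g_sigma_algebraType F -> T') ->
  measurable_fun [set: g_sigma_algebraType (others j)] (f : g_sigma_algebraType (others j) -> T').
Proof.
move=> mf _ B mB; have := mf measurableT B mB; rewrite !setTI.
apply: smallest_sub; first exact: smallest_sigma_algebra.
by move=> A FA; apply: sub_sigma_algebra; exact: othersF.
Qed.

(** Replacing the trivial condition on [xi j] by an arbitrary Borel set yields again an event of the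
    product form, so [others j] is independent of [xi j], which can be integrated out with
    everything else fixed. *)
Lemma family_tonelli (j : 'I_n) (g : T * R -> \bar R) :
  measurable_fun [set: g_sigma_algebraType (others j) * R] g ->
  (forall z, (0 <= g z)%E) ->
  (\int[P]_w g (w, xi j w) = \int[P]_w \int[mu j]_z g (w, z))%E.
Proof.
apply: indep_tonelli => //.
- exact: others_sub.
- exact: othersI.
- exact: othersF.
move=> _ B [A [B' [FA mB' Bj ->]]] mB.
pose B'' i := if i == j then B else B' i.
have -> : A `&` [set w | forall i, B' i (xi i w)] `&` xi j @^-1` B =
    A `&` [set w | forall i, B'' i (xi i w)].
  apply/seteqP; split => w /=; rewrite /B''.
    by move=> [[Aw h] Bw]; split => // i; case: eqP => [->//|_].
  move=> [Aw h]; split; last by have := h j; rewrite eqxx.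
  by split => // i; have := h i; case: eqP => [->|//]; rewrite Bj.
rewrite (indep FA mB') (indep (B := B'') FA); last first.
  by move=> i; rewrite /B''; case: ifP.
rewrite (bigD1 j)//= [in RHS](bigD1 j)//= Bj probability_setT mul1e /B'' eqxx.
rewrite muleA muleAC; congr (_ * _ * _)%E.
by apply: eq_bigr => i /negbTE ->.
Qed.

End independent_family.

(* normal_prob lives on measurableTypeR R, whose display differs from that of R *)
Section normal_law.
Context {R : realType} (s : R).

Let idR : measurableTypeR R -> R := idfun.

Let midR : measurable_fun setT idR.
Proof. exact: measurable_id. Qed.

Let idRV : {RV (normal_prob 0 s) >-> R} := mfun_Sub (mem_set midR).

Definition normal_law : probability R R := distribution (normal_prob 0 s) idRV.

Lemma integral_normal_law (f : R -> \bar R) :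
  measurable_fun [set: R] f -> (forall x, (0 <= f x)%E) ->
  (\int[normal_law]_x f x = \int[normal_prob 0 s]_x f x)%E.
Proof. by move=> mf f0; rewrite ge0_integral_distribution. Qed.

End normal_law.

Section gaussian_step.
Context {R : realType} d (T : measurableType d) (P : probability T R).
Variables (F : set (set T)) (q : nat) (xi : 'I_q -> T -> R) (s : R).
Hypothesis FM : F `<=` measurable.
Hypothesis FI : setI_closed F.
Hypothesis FT : F setT.
Hypothesis mxi : forall i, measurable_fun [set: T] (xi i).
Hypothesis s0 : 0 < s.
Hypothesis indep : forall A (B : 'I_q -> set R), F A ->
  (forall i, measurable (B i)) ->
  P (A `&` [set w | forall i, B i (xi i w)]) =
  (P A * \prod_(i < q) normal_prob 0 s (B i))%E.

Local Notation TF := (g_sigma_algebraType F).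

(** The coordinates of the Gaussian vector are integrated out one by one. Given the others, the
    squared norm is a quadratic polynomial in the remaining one, and the columns of H contribute
    their squared norms, which add up to that of H. *)
Lemma gaussian_step n (p : nat) (a : T -> R) (y : T -> 'cV[R]_n) (H : T -> 'M[R]_(n, q)) :
  measurable_fun [set: TF] (a : TF -> R) -> (forall w, 0 <= a w) ->
  mx_measurable (y : TF -> _) -> mx_measurable (H : TF -> _) ->
  (\int[P]_w ((a w + enorm (y w + H w *m \col_i xi i w) ^+ 2) ^+ p)%:E <=
   \int[P]_w ((a w + enorm (y w) ^+ 2 + (6 * p%:R * s ^+ 2) * enorm (H w) ^+ 2) ^+ p)%:E)%E.
Proof.
move=> ma a0 my mH.
pose h i w := col i (H w); pose c : R := 6 * p%:R * s ^+ 2.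
have c0 : 0 <= c by apply: mulr_ge0; [exact: mulr_ge0|exact: sqr_ge0].
pose Y (k : nat) w := y w + \sum_(i < q | (i < k)%N) xi i w *: h i w.
pose S (k : nat) w := \sum_(i < q | (k <= i)%N) enorm (h i w) ^+ 2.
(* An interpolation: the first k coordinates are random, the others already replaced by their bound.
   [E q] is the left side of the claim and [E 0] its right side. *)
pose E k := (\int[P]_w ((a w + enorm (Y k w) ^+ 2 + c * S k w) ^+ p)%:E)%E.
have S0 k w : 0 <= S k w by apply: sumr_ge0 => i _; exact: sqr_ge0.
suff Edec k : (k <= q)%N -> (E k <= E 0%N)%E.
  have := Edec q (leqnn q); rewrite /E.
  under eq_integral => w _.
    have -> : S q w = 0 by rewrite /S big_pred0// => i; rewrite leqNgt ltn_ord.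
    rewrite mulr0 addr0.
    have -> : Y q w = y w + H w *m \col_i xi i w.
      rewrite /Y; congr (_ + _); apply/matrixP => i j; rewrite summxE mxE.
      by apply: eq_big => [k|k _]; rewrite ?ltn_ord// !mxE mulrC.
    over.
  under [X in (_ <= X)%E -> _]eq_integral => w _.
    have -> : Y 0%N w = y w by rewrite /Y big_pred0 ?addr0.
    have -> : S 0%N w = enorm (H w) ^+ 2.
      rewrite enorm_sqr /mdot exchange_big /=; apply: eq_bigr => j _.
      by rewrite enorm_sqr /mdot; apply: eq_bigr => i _; rewrite big_ord1 !mxE.
    over.
  by [].
elim: k => // k IH kq; apply: (le_trans _ (IH (ltnW kq))); rewrite /E.
pose j := Ordinal kq.
have YE w : Y k.+1 w = Y k w + xi j w *: h j w.
  rewrite /Y -addrA; congr (_ + _); rewrite (bigD1 j)//= addrC; congr (_ + _).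
  by apply: eq_bigl => i; rewrite ltnS ltn_neqAle andbC.
have SE w : S k w = S k.+1 w + enorm (h j w) ^+ 2.
  rewrite /S (bigD1 j)//= addrC; congr (_ + _).
  by apply: eq_bigl => i; rewrite ltn_neqAle andbC eq_sym.
pose G := g_sigma_algebraType (others F xi j).
have ma' : measurable_fun [set: G] (a : G -> R) by exact: others_measurable.
have mh i : mx_measurable (h i : G -> _).
  move=> u v; rewrite [X in measurable_fun _ X](_ : _ = fun w => H w u i).
    apply: others_measurable; exact: mH.
  by apply/funext => w; rewrite !mxE.
have mY : mx_measurable (Y k : G -> _).
  apply: mx_measurableD; first by move=> u v; apply: others_measurable; exact: my.
  apply: mx_measurable_sum => i ik; apply: mx_measurableZ => //.
  by apply: others_xi => //; rewrite -val_eqE /= ltn_eqF.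
have mS l : measurable_fun [set: G] (S l : G -> R).
  by apply: measurable_fun_bigsum => i _; apply: measurable_funX; exact: measurable_enorm.
pose A w := a w + c * S k.+1 w + enorm (Y k w) ^+ 2.
pose b w := mdot (Y k w) (h j w).
pose C w := enorm (h j w) ^+ 2.
have mA : measurable_fun [set: G] (A : G -> R).
  apply: measurable_funD; last by apply: measurable_funX; exact: measurable_enorm.
  by apply: measurable_funD => //; exact: measurable_funM.
have mb : measurable_fun [set: G] (b : G -> R) by exact: measurable_mdot.
have mC : measurable_fun [set: G] (C : G -> R).
  by apply: measurable_funX; exact: measurable_enorm.
have A0 w : 0 <= a w + c * S k.+1 w by rewrite addr_ge0// mulr_ge0.
have A0' w : 0 <= A w by rewrite addr_ge0// sqr_ge0.
(* The discriminant condition of [normal_quad_le] is the Cauchy-Schwarz inequality for [Y k] and the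
   j-th column. *)
have bAC w : b w ^+ 2 <= A w * C w.
  rewrite /b (le_trans (mdot_cauchy_schwarz _ _))// /C enorm_sqr ler_wpM2r ?mdot_ge0//.
  by rewrite /A enorm_sqr lerDr.
have pos w z : 0 <= A w + 2 * b w * z + C w * z ^+ 2.
  have := enormD_sqr (Y k w) (z *: h j w); rewrite mdotZr enormZ exprMn real_normK ?num_real//.
  move=> e; have := sqr_ge0 (enorm (Y k w + z *: h j w)); rewrite e -/(b w) -/(C w) /A.
  by have := A0 w; lra.
have mquad (u v x : R) : measurable_fun [set: R]
    (fun z : R => ((u + 2 * v * z + x * z ^+ 2) ^+ p)%:E).
  apply/measurable_EFinP; apply: measurable_funX.
  apply: measurable_funD; first apply: measurable_funD; first exact: measurable_cst.
    exact: mulrl_measurable.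
  apply: measurable_funM; [exact: measurable_cst|exact: exprn_measurable].
pose g (wz : T * R) := ((A wz.1 + 2 * b wz.1 * wz.2 + C wz.1 * wz.2 ^+ 2) ^+ p)%:E.
have -> : (\int[P]_w ((a w + enorm (Y k.+1 w) ^+ 2 + c * S k.+1 w) ^+ p)%:E =
    \int[P]_w g (w, xi j w))%E.
  apply: eq_integral => w _; congr ((_ ^+ p)%:E).
  rewrite YE enormD_sqr mdotZr enormZ exprMn real_normK ?num_real// /A /b /C /=; ring.
rewrite (@family_tonelli _ _ _ P F q xi (fun=> normal_law s) FM FI FT mxi indep)//.
- apply: ge0_le_integral_nonmeas => w _.
    by apply: integral_ge0 => z _; rewrite lee_fin exprn_ge0.
  rewrite integral_normal_law//; last 2 first.
  - exact: (mquad (A w) (b w) (C w)).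
  - by move=> z; rewrite lee_fin exprn_ge0.
  rewrite (le_trans (normal_quad_le _ s0 (A0' w) (sqr_ge0 _) (bAC w)))// lee_fin.
  by rewrite le_eqVlt; apply/orP; left; apply/eqP; congr (_ ^+ p); rewrite SE /A /C /c; ring.
- apply/measurable_EFinP; apply: measurable_funX.
  have m1 (f : G -> R) : measurable_fun [set: G] f ->
      measurable_fun [set: G * R] (fun wz : G * R => f wz.1).
    by move=> mf; exact: (measurableT_comp mf).
  apply: measurable_funD; first apply: measurable_funD; first exact: m1.
    by apply: measurable_funM => //; apply: measurable_funM => //; exact: m1.
  by apply: measurable_funM; [exact: m1|exact: measurable_funX].
- by move=> z; rewrite lee_fin exprn_ge0.
Qed.

End gaussian_step.

(** * Chains driven by Brownian increments *)

Lemma markov_le (R : realType) d (T : measurableType d) (P : probability T R)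
    (A : set T) (c : R) (f : T -> \bar R) : measurable A -> 0 <= c ->
  (forall w, (0 <= f w)%E) -> (forall w, A w -> (c%:E <= f w)%E) ->
  (c%:E * P A <= \int[P]_w f w)%E.
Proof.
move=> mA c0 f0 fA; rewrite -integral_cst// integral_mkcond.
apply: ge0_le_integral_nonmeas => w _; rewrite patchE; case: ifPn => //.
by rewrite inE; exact: fA.
Qed.

Section brownian.
Context {R : realType} d (Omega : measurableType d) (P : probability Omega R).
Context (F : R -> set (set Omega)) (T : R) (q : nat) (W : Omega -> R -> 'cV[R]_q).
Hypothesis hF : filtration F T.
Hypothesis hW : brownian_motion P F T W.

Definition FT (t : R) := g_sigma_algebraType (F t).

Lemma itv0T t : 0 <= t -> t <= T -> t \in `[0, T].
Proof. by move=> t0 tT; rewrite in_itv /= t0. Qed.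

Lemma F_sigma t : 0 <= t -> t <= T -> sigma_algebra setT (F t).
Proof. by move=> t0 tT; have [/(_ t (itv0T t0 tT))[]] := hF. Qed.

Lemma F_sub t : 0 <= t -> t <= T -> F t `<=` measurable.
Proof. by move=> t0 tT; have [/(_ t (itv0T t0 tT))[]] := hF. Qed.

Lemma F_mono_fun s t d' (T' : measurableType d') (f : Omega -> T') :
  0 <= s -> s <= t -> t <= T ->
  measurable_fun [set: FT s] (f : FT s -> T') -> measurable_fun [set: FT t] (f : FT t -> T').
Proof.
move=> s0 st tT mf _ B mB; have := mf measurableT B mB; rewrite !setTI.
by apply: sub_sigma_algebra2; exact: (hF.2 s t).
Qed.

Lemma F_mono_mx s t m n (Y : Omega -> 'M[R]_(m, n)) :
  0 <= s -> s <= t -> t <= T ->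
  mx_measurable (Y : FT s -> _) -> mx_measurable (Y : FT t -> _).
Proof. by move=> s0 st tT mY i j; exact: (F_mono_fun s0 st tT (mY i j)). Qed.

Lemma F_measurable_fun t d' (T' : measurableType d') (f : Omega -> T') :
  0 <= t -> t <= T ->
  measurable_fun [set: FT t] (f : FT t -> T') -> measurable_fun [set: Omega] f.
Proof. by move=> t0 tT; exact: measurable_fun_g_sigma (F_sub t0 tT). Qed.

Lemma F_measurable_mx t m n (Y : Omega -> 'M[R]_(m, n)) : 0 <= t -> t <= T ->
  mx_measurable (Y : FT t -> _) -> mx_measurable Y.
Proof. by move=> t0 tT mY i j; exact: (F_measurable_fun t0 tT (mY i j)). Qed.

Lemma W_measurable t : 0 <= t -> t <= T -> mx_measurable ((fun w => W w t) : FT t -> _).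
Proof.
move=> t0 tT; have [aW _ _ _] := hW.
by apply/(rv_measurableP _ (F_sigma t0 tT)); apply: aW; exact: itv0T.
Qed.

Lemma brownian_step n (p : nat) s t (a : Omega -> R) (y : Omega -> 'cV[R]_n)
    (H : Omega -> 'M[R]_(n, q)) : 0 <= s -> s <= t -> t <= T ->
  measurable_fun [set: FT s] (a : FT s -> R) -> (forall w, 0 <= a w) ->
  mx_measurable (y : FT s -> _) -> mx_measurable (H : FT s -> _) ->
  (\int[P]_w ((a w + enorm (y w + H w *m (W w t - W w s)) ^+ 2) ^+ p)%:E <=
   \int[P]_w ((a w + enorm (y w) ^+ 2 + (6 * p%:R * (t - s)) * enorm (H w) ^+ 2) ^+ p)%:E)%E.
Proof.
(* [gaussian_step] requires a positive standard deviation, so s = t, where the increment is zero, is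
   treated apart. *)
move=> s0 st tT ma a0 my mH; have [<-|/eqP snt] := eqVneq s t.
  rewrite le_eqVlt; apply/orP; left; apply/eqP; apply: eq_integral => w _.
  by rewrite !subrr mulmx0 addr0 mulr0 mul0r addr0.
have {}st : s < t by rewrite lt_neqAle st andbT; apply/eqP.
have sT : s <= T by rewrite (le_trans (ltW st)).
have t0 : 0 <= t by rewrite (le_trans s0)// ltW.
pose xi i w := (W w t - W w s) i ord0.
have e : (fun w => \col_i xi i w) = (fun w => W w t - W w s).
  by apply/funext => w; apply/matrixP => i j; rewrite mxE (ord1 j).
have mxi i : measurable_fun [set: Omega] (xi i).
  have mW r : 0 <= r -> r <= T -> mx_measurable (fun w => W w r).
    by move=> r0 rT; apply: (F_measurable_mx r0 rT); exact: W_measurable.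
  exact: (mx_measurableB (mW t t0 tT) (mW s s0 sT) i ord0).
have [FI FTT] : setI_closed (F s) /\ F s setT.
  have sF := F_sigma s0 sT.
  split; last by rewrite -(sigma_algebra_id sF); exact: (@measurableT _ (FT s)).
  by move=> A B; rewrite -(sigma_algebra_id sF); exact: (@measurableI _ (FT s)).
have ts : t - s = Num.sqrt (t - s) ^+ 2 by rewrite sqr_sqrtr// subr_ge0 ltW.
have st0 : 0 < Num.sqrt (t - s) by rewrite sqrtr_gt0 subr_gt0.
have ind A (B : 'I_q -> set R) : F s A -> (forall i, measurable (B i)) ->
    P (A `&` [set w | forall i, B i (xi i w)]) =
    (P A * \prod_(i < q) normal_prob 0 (Num.sqrt (t - s)) (B i))%E.
  by move=> FA mB; have [_ _ _ h] := hW; exact: h.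
have := @gaussian_step R _ _ P (F s) q xi _ (F_sub s0 sT) FI FTT mxi st0 ind n p a y H ma a0 my mH.
rewrite -ts; apply: le_trans.
by rewrite le_eqVlt; apply/orP; left; apply/eqP; apply: eq_integral => w _;
  rewrite -[W w t - W w s]/((fun w => W w t - W w s) w) -e.
Qed.

Section chain.
Context (u : nat -> R) (N : nat).
Hypothesis u0 : 0 <= u 0%N.
Hypothesis u_nd : forall i, (i < N)%N -> u i <= u i.+1.
Hypothesis uT : u N <= T.

Lemma chain_time_le i j : (i <= j)%N -> (j <= N)%N -> u i <= u j.
Proof.
elim: j => [|j IH]; first by rewrite leqn0 => /eqP ->.
rewrite leq_eqVlt => /predU1P[->//|]; rewrite ltnS => ij jN.
by rewrite (le_trans (IH ij (ltnW jN)))// u_nd.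
Qed.

Lemma chain_time_ge0 i : (i <= N)%N -> 0 <= u i.
Proof. by move=> iN; rewrite (le_trans u0)// chain_time_le. Qed.

Lemma chain_time_leT i : (i <= N)%N -> u i <= T.
Proof. by move=> iN; rewrite (le_trans _ uT)// chain_time_le. Qed.

Lemma chain_measurable n (y : Omega -> 'cV[R]_n) (H : nat -> Omega -> 'M[R]_(n, q)) k :
  (k <= N)%N -> mx_measurable (y : FT (u 0%N) -> _) ->
  (forall i, (i < N)%N -> mx_measurable (H i : FT (u i) -> _)) ->
  mx_measurable ((fun w => y w + \sum_(i < k) H i w *m (W w (u i.+1) - W w (u i)))
    : FT (u k) -> _).
Proof.
move=> kN my mH; apply: mx_measurableD.
  by apply: F_mono_mx my => //; [exact: chain_time_le|exact: chain_time_leT].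
apply: mx_measurable_sum => i _.
have iN : (i < N)%N by rewrite (leq_trans _ kN).
have kT := chain_time_leT kN.
have uik : u i <= u k by rewrite chain_time_le// ltnW.
have uik1 : u i.+1 <= u k by rewrite chain_time_le.
apply: mx_measurable_mul.
  by apply: F_mono_mx (mH i iN) => //; rewrite chain_time_ge0// ltnW.
apply: mx_measurableB.
  by apply: F_mono_mx (W_measurable _ _) => //; rewrite ?chain_time_ge0 ?chain_time_leT.
by apply: F_mono_mx (W_measurable _ _) => //; rewrite ?chain_time_ge0 ?chain_time_leT// ltnW.
Qed.

(** Iteration of [brownian_step]. The process a is a reserve from which each step pays the growth of
    the squared norm. It is random, with [a i.+1] known at time [u i], because the coefficients are
    bounded by random quantities only. *)
Lemma chain_le n p (a : nat -> Omega -> R) (y : Omega -> 'cV[R]_n)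
    (H : nat -> Omega -> 'M[R]_(n, q)) :
  mx_measurable (y : FT (u 0%N) -> _) ->
  (forall i, (i < N)%N -> mx_measurable (H i : FT (u i) -> _)) ->
  (forall i, (i < N)%N -> measurable_fun [set: FT (u i)] (a i.+1 : FT (u i) -> R)) ->
  (forall i w, (i <= N)%N -> 0 <= a i w) ->
  (forall i w, (i < N)%N ->
     a i.+1 w + 6 * p%:R * (u i.+1 - u i) * enorm (H i w) ^+ 2 <= a i w) ->
  (\int[P]_w ((a N w + enorm (y w + \sum_(i < N) H i w *m (W w (u i.+1) - W w (u i))) ^+ 2) ^+ p)%:E
   <= \int[P]_w ((a 0%N w + enorm (y w) ^+ 2) ^+ p)%:E)%E.
Proof.
move=> my mH ma a0 aH.
suff h k : (k <= N)%N ->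
    (\int[P]_w ((a k w + enorm (y w + \sum_(i < k) H i w *m (W w (u i.+1) - W w (u i))) ^+ 2) ^+ p)%:E
   <= \int[P]_w ((a 0%N w + enorm (y w) ^+ 2) ^+ p)%:E)%E by exact: h.
elim: k => [_|k IH kN].
  rewrite le_eqVlt; apply/orP; left; apply/eqP; apply: eq_integral => w _.
  by rewrite big_ord0 addr0.
apply: le_trans (IH (ltnW kN)).
set S := fun w => y w + \sum_(i < k) H i w *m (W w (u i.+1) - W w (u i)).
have uk0 : 0 <= u k by rewrite chain_time_ge0// ltnW.
have uk1 : u k <= u k.+1 by rewrite u_nd.
have := @brownian_step n p (u k) (u k.+1) (a k.+1) S (H k) uk0 uk1 (chain_time_leT kN)
  (ma k kN) (fun w => a0 k.+1 w kN) (chain_measurable (ltnW kN) my mH) (mH k kN).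
move=> step; apply: (le_trans _ (le_trans step _)).
  rewrite le_eqVlt; apply/orP; left; apply/eqP; apply: eq_integral => w _.
  by rewrite big_ord_recr /= addrA.
apply: ge0_le_integral_nonmeas => w _.
  rewrite lee_fin exprn_ge0// addr_ge0//.
    by rewrite addr_ge0 ?a0// sqr_ge0.
  by rewrite !mulr_ge0 ?subr_ge0 ?enorm_ge0.
rewrite lee_fin lerXn2r ?nnegrE//.
- rewrite !addr_ge0 ?a0 ?sqr_ge0//.
  by rewrite !mulr_ge0 ?subr_ge0 ?enorm_ge0.
- by rewrite addr_ge0 ?a0 ?sqr_ge0// ltnW.
- by rewrite addrAC lerD2r aH.
Qed.

(** An inequality of Lenglart type: cutting the coefficients makes the quadratic variation at most
    delta everywhere, without changing the sum on the event in question. Then [chain_le] applies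
    with p = 1 and the unspent variation, times 6, as reserve. *)
Lemma chain_tail n (G : nat -> Omega -> 'M[R]_(n, q)) (delta eps : R) :
  (forall i, (i < N)%N -> mx_measurable (G i : FT (u i) -> _)) ->
  0 <= delta -> 0 < eps ->
  (P ([set w | (\sum_(i < N) enorm (G i w) ^+ 2 * (u i.+1 - u i) <= delta)%R]
      `&` [set w | (eps <= enorm (\sum_(i < N) G i w *m (W w (u i.+1) - W w (u i))))%R])
   <= (6 * delta / eps ^+ 2)%:E)%E.
Proof.
move=> mG d0 e0; pose Q (k : nat) w := \sum_(i < k) enorm (G i w) ^+ 2 * (u i.+1 - u i).
(* [Q i.+1] includes the i-th coefficient and is still known at time [u i]; cutting before the
   budget is exceeded keeps [Q'] below delta. *)
pose G' (i : nat) w := if Q i.+1 w <= delta then G i w else 0.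
pose Q' (k : nat) w := \sum_(i < k) enorm (G' i w) ^+ 2 * (u i.+1 - u i).
have dt0 i : (i < N)%N -> 0 <= u i.+1 - u i by move=> iN; rewrite subr_ge0 u_nd.
have Qnd i j w : (i <= j)%N -> (j <= N)%N -> Q i w <= Q j w.
  elim: j => [|j IH]; first by rewrite leqn0 => /eqP ->.
  rewrite leq_eqVlt => /predU1P[->//|]; rewrite ltnS => ij jN.
  rewrite (le_trans (IH ij (ltnW jN)))// /Q big_ord_recr /= lerDl.
  by rewrite mulr_ge0 ?sqr_ge0 ?dt0.
have Q'Q k w : (k <= N)%N -> Q' k w <= Q k w.
  move=> kN; apply: ler_sum => i _; have iN : (i < N)%N by rewrite (leq_trans _ kN).
  rewrite ler_wpM2r ?dt0// /G'; case: ifP => // _; rewrite enorm0 expr0n; exact: sqr_ge0.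
have Q'd k w : (k <= N)%N -> Q' k w <= delta.
  elim: k => [|k IH] kN; first by rewrite /Q' big_ord0.
  have [h|h] := boolP (Q k.+1 w <= delta); first by rewrite (le_trans (Q'Q _ _ kN)).
  by rewrite /Q' big_ord_recr /= /G' (negbTE h) enorm0 expr0n mul0r addr0 IH// ltnW.
have mQ (H : nat -> Omega -> 'M[R]_(n, q)) i :
    (forall i, (i < N)%N -> mx_measurable (H i : FT (u i) -> _)) -> (i < N)%N ->
    measurable_fun [set: FT (u i)]
    ((fun w => \sum_(k < i.+1) enorm (H k w) ^+ 2 * (u k.+1 - u k)) : FT (u i) -> R).
  move=> mH iN; apply: measurable_fun_bigsum => k _; apply: measurable_funM => //.
  apply: measurable_funX; apply: measurable_enorm.
  have ki : (k <= i)%N by rewrite -ltnS.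
  by apply: F_mono_mx (mH k _); rewrite ?chain_time_ge0 ?chain_time_leT ?chain_time_le//
    ?(leq_ltn_trans ki)// ?(leq_trans ki)// ltnW.
have mG' i : (i < N)%N -> mx_measurable (G' i : FT (u i) -> _).
  move=> iN; apply: mx_measurable_if; [|exact: mG|exact: mx_measurable_cst].
  by apply: measurable_fun_ler; [exact: mQ|exact: measurable_cst].
have mG'A i : (i < N)%N -> mx_measurable (G i).
  by move=> iN; apply: (F_measurable_mx _ _ (mG i iN)); rewrite ?chain_time_ge0 ?chain_time_leT// ltnW.
pose a (i : nat) w := 6 * (delta - Q' i w).
have H := @chain_le n 1 a (fun=> 0) G' (mx_measurable_cst _) mG'.
have E6 : (\int[P]_w ((6 * (delta - Q' 0%N w) + enorm (0 : 'cV[R]_n) ^+ 2) ^+ 1)%:E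
    = (6 * delta)%:E)%E.
  under eq_integral do rewrite /Q' big_ord0 subr0 enorm0 expr0n addr0 expr1.
  rewrite (_ : (\int[P]__ _)%E = (\int[P]_(_ in [set: Omega]) cst (6 * delta)%:E tt)%E)//.
  by rewrite integral_cst// [X in (_ * X)%E](_ : _ = 1%E) ?mule1//; exact: probability_setT.
rewrite EFinM lee_pdivlMr ?exprn_gt0// muleC.
have mS : mx_measurable (fun w => \sum_(i < N) G i w *m (W w (u i.+1) - W w (u i))).
  apply: mx_measurable_sum => i _; apply: mx_measurable_mul; first exact: mG'A.
  by apply: mx_measurableB; apply: (F_measurable_mx _ _ (W_measurable _ _));
    rewrite ?chain_time_ge0 ?chain_time_leT// ltnW.
apply: (@le_trans _ _ (\int[P]_w
   ((6 * (delta - Q' N w) + enorm (0 + \sum_(i < N) G' i w *m (W w (u i.+1) - W w (u i))) ^+ 2) ^+ 1)%:E)%E).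
  apply: markov_le.
  - apply: measurableI.
      rewrite -[X in measurable X]setTI; apply: measurable_fun_ler => //.
      apply: measurable_fun_bigsum => k _; apply: measurable_funM => //.
      by apply: measurable_funX; apply: measurable_enorm; exact: mG'A.
    rewrite -[X in measurable X]setTI; apply: measurable_fun_ler => //.
    exact: measurable_enorm.
  - exact: sqr_ge0.
  - by move=> w; rewrite lee_fin expr1 addr_ge0 ?sqr_ge0// mulr_ge0// subr_ge0 Q'd.
  - move=> w /= [Qd eS]; rewrite lee_fin expr1 add0r.
    rewrite (eq_bigr (fun i : 'I_N => G i w *m (W w (u i.+1) - W w (u i)))); last first.
      by move=> i _; rewrite /G' (le_trans (Qnd _ _ w (ltn_ord i) (leqnn N)) Qd).
    rewrite (le_trans (_ : _ <= enorm (\sum_(i < N) G i w *m (W w (u i.+1) - W w (u i))) ^+ 2))//.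
      by apply: lerXn2r; rewrite ?nnegrE ?enorm_ge0 ?(ltW e0).
    by rewrite lerDr mulr_ge0// subr_ge0 Q'd.
rewrite -E6; apply: H.
- move=> i iN; apply: measurable_funM => //; apply: measurable_funB => //; exact: mQ.
- by move=> i w iN; rewrite mulr_ge0// subr_ge0 Q'd.
- move=> i w iN; rewrite /a [Q' i.+1 w]/Q' big_ord_recr /= -/(Q' i w); rewrite le_eqVlt; apply/orP; left; apply/eqP.
  by rewrite mulr1; ring.
Qed.

End chain.
End brownian.

(** * The discrete chain *)

(* One step of the energy recursion: ey is the norm of the discrete process,
   s and xt are those of the discrete process and of X at the start of the
   period, eb and dt bound the drift increment and its scalar product with the
   process, and b is the energy reserved for the rest of the period. *)
Lemma growth_bound (R : realType) (C m p b xt s ey eb dt : R) :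
  0 <= C -> 0 <= m -> 0 <= p -> C * m <= 1 / 5 ->
  0 <= xt -> 0 <= s -> 0 <= ey -> 0 <= eb -> xt <= s + 1 / 16 ->
  eb <= C * m * (1 + xt + 1 / 16) -> dt <= ey * eb ->
  1 + b + 6 * p * m * (C * (1 + (xt + 1 / 16) ^+ 2)) + (ey ^+ 2 + 2 * dt + eb ^+ 2) <=
  (1 + C * m) * (1 + ey ^+ 2) + C * (3 + (15 / 2) * p) * m * (1 + s ^+ 2) + b.
Proof.
move=> C0 m0 p0 c5 xt0 s0 ey0 eb0 xs bB dB.
have c0 : 0 <= C * m by exact: mulr_ge0.
move: c0 c5 bB; rewrite (_ : C * _ * m = (C * m) * (3 + 15 / 2 * p)); last by ring.
rewrite (_ : 6 * p * m * _ = 6 * p * (C * m) * (1 + (xt + 1 / 16) ^+ 2)); last by ring.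
move: (C * m) => c c0 c5 bB; set u := 1 + xt + 1 / 16 in bB.
have u0 : 0 <= u by rewrite /u; lra.
(* 145/64 = 1 + (9/8)^2, by Cauchy-Schwarz for 9/8 + s. The two drift terms then cost (6/5) (145/64)
   < 3, and the noise costs 6 p (5/4) = 15 p / 2: these are the constants of the rate. *)
have h1 : u ^+ 2 <= 145 / 64 * (1 + s ^+ 2).
  apply: (@le_trans _ _ ((9 / 8 + s) ^+ 2)).
    by rewrite lerXn2r ?nnegrE//; rewrite /u; lra.
  by have := sqr_ge0 (1 - 9 / 8 * s); nra.
have h2 : 1 + (xt + 1 / 16) ^+ 2 <= 5 / 4 * (1 + s ^+ 2).
  apply: (@le_trans _ _ (1 + (s + 1 / 8) ^+ 2)).
    by rewrite lerD2l lerXn2r ?nnegrE//; lra.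
  by have := sqr_ge0 (1 - s); nra.
have h3 : 2 * dt <= c * (ey ^+ 2 + u ^+ 2).
  apply: (@le_trans _ _ (2 * (ey * (c * u)))).
    by have := ler_wpM2l ey0 bB; lra.
  by have := mulr_ge0 c0 (sqr_ge0 (ey - u)); nra.
have h4 : eb ^+ 2 <= 1 / 5 * c * u ^+ 2.
  apply: (@le_trans _ _ ((c * u) ^+ 2)).
    by rewrite lerXn2r ?nnegrE// mulr_ge0.
  rewrite exprMn ler_wpM2r ?sqr_ge0// expr2 mulrC; exact: ler_wpM2r.
have pc : 0 <= 6 * p * c by rewrite !mulr_ge0.
have h5 := ler_wpM2l pc h2; have h6 := ler_wpM2l c0 h1.
have s2 := sqr_ge0 s; have cs : 0 <= c * (1 + s ^+ 2) by rewrite mulr_ge0// addr_ge0.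
move: (u ^+ 2) (s ^+ 2) (ey ^+ 2) (eb ^+ 2) ((xt + 1 / 16) ^+ 2) h1 h2 h3 h4 h5 h6 s2 cs.
move=> u2 s2 e2 b2 x2 h1 h2 h3 h4 h5 h6 ? cs; nra.
Qed.

Section core.
Context {R : realType} d (Omega : measurableType d) (P : probability Omega R).
Context (F : R -> set (set Omega)) (T : R) (q : nat) (W : Omega -> R -> 'cV[R]_q).
Hypothesis hF : filtration F T.
Hypothesis hW : brownian_motion P F T W.
Hypothesis T0 : 0 < T.
Local Notation FT := (FT F).
Context (n : nat) (x : 'cV[R]_n) (X : Omega -> R -> 'cV[R]_n).
Hypothesis aX : adapted F T X.
Context (C : R) (np ns : nat).
Hypothesis C0 : 0 <= C.
Hypothesis np0 : (0 < np)%N.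
Hypothesis ns0 : (0 < ns)%N.

Local Notation K := (np * ns)%N.
Definition eps : R := 1 / 16.
Definition mesh : R := T / K%:R.
Definition tk (k : nat) : R := k%:R * mesh.
(** Index of the cell at which the coefficients in force on cell k were last refreshed. For the
    diffusion ns = 1 and this is k. *)
Definition period_start (k : nat) : nat := (k %/ ns * ns)%N.
Hypothesis Cmesh : C * mesh <= 1 / 5.

Lemma K0 : (0 < K)%N. Proof. by rewrite muln_gt0 np0. Qed.
Lemma mesh0 : 0 < mesh. Proof. by rewrite divr_gt0// ltr0n K0. Qed.
Lemma eps0 : 0 < eps. Proof. by rewrite divr_gt0. Qed.
Lemma tk0 k : 0 <= tk k. Proof. by rewrite mulr_ge0// ltW// mesh0. Qed.
Lemma tk_le j k : (j <= k)%N -> tk j <= tk k.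
Proof. by move=> jk; rewrite ler_wpM2r ?ler_nat// ltW// mesh0. Qed.
Lemma tkK : tk K = T.
Proof. by rewrite /tk /mesh mulrC divfK// pnatr_eq0 -lt0n K0. Qed.
Lemma tk_leT k : (k <= K)%N -> tk k <= T.
Proof. by move=> kK; rewrite -tkK tk_le. Qed.
Lemma tkS k : tk k.+1 = tk k + mesh.
Proof. by rewrite /tk -natr1 mulrDl mul1r. Qed.
Lemma period_start_le k : (period_start k <= k)%N.
Proof. exact: leq_trunc_div. Qed.

Lemma X_measurable t : 0 <= t -> t <= T -> mx_measurable ((fun w => X w t) : FT t -> _).
Proof.
move=> t0 tT; apply/(rv_measurableP _ (F_sigma hF t0 tT)).
by apply: aX; exact: itv0T.
Qed.

Lemma X_measurable_tk j k : (j <= k)%N -> (k <= K)%N ->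
  mx_measurable ((fun w => X w (tk j)) : FT (tk k) -> _).
Proof.
move=> jk kK; apply: (F_mono_mx hF (tk0 j) (tk_le jk) (tk_leT kK)).
by apply: X_measurable; rewrite ?tk0// tk_leT// (leq_trans jk).
Qed.

Context (sz : nat) (tm : nat -> R) (cf : nat -> Omega -> 'M[R]_(n, q)).
Let Hs := SimpleProcess sz tm cf.
Hypothesis wfH : simple_wf F T Hs.

Definition drift_radius (k : nat) w : R := C * mesh * (1 + enorm (X w (tk (period_start k))) + eps).
Definition diff_radius (k : nat) w : R :=
  Num.sqrt (C * (1 + (enorm (X w (tk (period_start k))) + eps) ^+ 2)).

Context (beta : nat -> Omega -> 'cV[R]_n).
Hypothesis mbeta : forall k, (k < K)%N -> mx_measurable (beta k : FT (tk k) -> _).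
Hypothesis betaB : forall k w, (k < K)%N -> enorm (beta k w) <= drift_radius k w.

(** Clamping the nodes of a simple process to the k-th cell intersects its intervals with the cell,
    those outside becoming degenerate. This stands for a common refinement of the two partitions. *)
Definition clamp (k : nat) (s : R) : R := Num.max (tk k) (Num.min s (tk k.+1)).

Lemma clamp_ge k s : tk k <= clamp k s. Proof. by rewrite le_max lexx. Qed.
Lemma clamp_le k s : clamp k s <= tk k.+1.
Proof. by rewrite ge_max tk_le//= ge_min lexx orbT. Qed.
Lemma clamp_mono k s t : s <= t -> clamp k s <= clamp k t.
Proof.
move=> st; rewrite /clamp ge_max le_max lexx /=.
by rewrite le_max ge_min; apply/orP; right; rewrite le_min !ge_min st lexx !orbT.
Qed.

Lemma simple_int_incr k w : simple_int W Hs w (tk k.+1) - simple_int W Hs w (tk k) =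
  \sum_(i < sz) cf i w *m (W w (clamp k (tm i.+1)) - W w (clamp k (tm i))).
Proof.
rewrite /simple_int -sumrB; apply: eq_bigr => i _; rewrite -mulmxBr; congr (_ *m _).
have e s : W w (Num.min (tk k.+1) s) - W w (Num.min (tk k) s) =
    W w (clamp k s) - W w (tk k).
  rewrite /clamp; have tt := tk_le (leqnSn k).
  have [st|ts] := leP s (tk k).
    by rewrite (min_idPr (le_trans st tt)) (min_idPl (le_trans st tt)) (max_idPl st) !subrr.
  rewrite (minC s); congr (W w _ - _); apply/esym/max_idPr.
  by rewrite le_min tt ltW.
have e1 := e (tm i.+1); have e0 := e (tm i).
rewrite /= [LHS](_ : _ = (W w (Num.min (tk k.+1) (tm i.+1)) - W w (Num.min (tk k) (tm i.+1)))
  - (W w (Num.min (tk k.+1) (tm i)) - W w (Num.min (tk k) (tm i)))).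
  by rewrite e1 e0 opprB addrA subrK.
by rewrite !opprB addrACA [RHS]addrACA; congr (_ + _); rewrite addrC.
Qed.

Lemma tm_ge0 i : (i <= sz)%N -> 0 <= tm i.
Proof.
have [tm0 tm_nd _ _] := wfH; elim: i => [//|i IH] isz.
by rewrite (le_trans (IH (ltnW isz)))// tm_nd.
Qed.

(** If [tm i] is beyond the cell, the coefficient need not be known at the clamped time; it is then
    set to 0, which is harmless since the clamped increment vanishes. *)
Definition trunc_coef (k i : nat) w : 'M[R]_(n, q) :=
  if tm i < tk k.+1 then ball_proj (diff_radius k w) (cf i w) else 0.

Definition noise (k : nat) w : 'cV[R]_n :=
  \sum_(i < sz) trunc_coef k i w *m (W w (clamp k (tm i.+1)) - W w (clamp k (tm i))).

Lemma diff_radius_ge0 k w : 0 <= diff_radius k w.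
Proof. exact: sqrtr_ge0. Qed.

Lemma diff_radius_sqr k w :
  diff_radius k w ^+ 2 = C * (1 + (enorm (X w (tk (period_start k))) + eps) ^+ 2).
Proof. by rewrite sqr_sqrtr// mulr_ge0// addr_ge0// sqr_ge0. Qed.

Lemma measurable_diff_radius k : (k <= K)%N ->
  measurable_fun [set: FT (tk k)] (diff_radius k : FT (tk k) -> R).
Proof.
move=> kK; apply: (measurableT_comp measurable_sqrtr); apply: measurable_funM => //.
apply: measurable_funD => //; apply: measurable_funX; apply: measurable_funD => //.
by apply: measurable_enorm; apply: X_measurable_tk => //; exact: period_start_le.
Qed.

Lemma clamp_leT k s : (k < K)%N -> clamp k s <= T.
Proof. by move=> kK; rewrite (le_trans (clamp_le _ _))// tk_leT. Qed.

Lemma le_clamp k s : s < tk k.+1 -> s <= clamp k s.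
Proof. by move=> h; rewrite /clamp le_max (min_idPl (ltW h)) lexx orbT. Qed.

Lemma cf_measurable k i : (k < K)%N -> (i < sz)%N -> tm i < tk k.+1 ->
  mx_measurable (cf i : FT (clamp k (tm i)) -> _).
Proof.
move=> kK isz h; have [_ tm_nd tmT wf] := wfH.
have ti0 := tm_ge0 (ltnW isz).
apply: (F_mono_mx hF ti0 (le_clamp h) (clamp_leT _ kK)).
apply/(rv_measurableP _ (F_sigma hF ti0 _)); last exact: (wf i isz).1.
by rewrite (le_trans (le_clamp h))// clamp_leT.
Qed.

Lemma measurable_diff_radius_clamp k s : (k < K)%N ->
  measurable_fun [set: FT (clamp k s)] (diff_radius k : FT (clamp k s) -> R).
Proof.
move=> kK; apply: (F_mono_fun hF (tk0 k) (clamp_ge k s) (clamp_leT _ kK)).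
exact: measurable_diff_radius (ltnW kK).
Qed.

Lemma trunc_coef_measurable k i : (k < K)%N -> (i < sz)%N ->
  mx_measurable (trunc_coef k i : FT (clamp k (tm i)) -> _).
Proof.
move=> kK isz; have [h|h] := boolP (tm i < tk k.+1).
  rewrite (_ : trunc_coef k i = fun w => ball_proj (diff_radius k w) (cf i w)).
    apply: mx_measurable_ball_proj; [exact: measurable_diff_radius_clamp|exact: cf_measurable].
  by apply/funext => w; rewrite /trunc_coef h.
rewrite (_ : trunc_coef k i = fun=> 0); first exact: mx_measurable_cst.
by apply/funext => w; rewrite /trunc_coef (negbTE h).
Qed.

Lemma enorm_trunc_coef k i w : enorm (trunc_coef k i w) <= diff_radius k w.
Proof.
rewrite /trunc_coef; case: ifP => _; first exact: enorm_ball_proj (diff_radius_ge0 _ _).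
by rewrite enorm0 diff_radius_ge0.
Qed.

Lemma clamp_nd k i : (i < sz)%N -> clamp k (tm i) <= clamp k (tm i.+1).
Proof. by move=> isz; apply: clamp_mono; have [_ h _ _] := wfH; exact: h. Qed.

Context (A : R).

Definition on_track (k : nat) w (y : 'cV[R]_n) : bool :=
  (enorm (y - X w (tk k)) <= eps) && (1 + enorm y ^+ 2 < A).

(* The second component tells whether the discrete process still moves: it is
   frozen as soon as it leaves a ball or loses track of X. *)
Fixpoint stopped (k : nat) (w : Omega) : 'cV[R]_n * bool :=
  if k is k'.+1 then
    let: (y, alive) := stopped k' w in
    let y' := if alive then y + (beta k' w + noise k' w) else y in
    (y', alive && on_track k'.+1 w y')
  else (x, on_track 0 w x).

Definition frozen k w := (stopped k w).1.
Definition alive k w := (stopped k w).2.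

Lemma frozenS k w : frozen k.+1 w = if alive k w then frozen k w + (beta k w + noise k w) else frozen k w.
Proof. by rewrite /frozen /alive /=; case: (stopped k w). Qed.

Lemma aliveS k w : alive k.+1 w = alive k w && on_track k.+1 w (frozen k.+1 w).
Proof. by rewrite /frozen /alive /=; case: (stopped k w). Qed.

Lemma alive_on_track j k w : (j <= k)%N -> alive k w -> on_track j w (frozen j w).
Proof.
elim: k => [|k IH]; first by rewrite leqn0 => /eqP ->.
rewrite leq_eqVlt => /predU1P[->|]; first by rewrite aliveS => /andP[].
by rewrite ltnS aliveS => jk /andP[ak _]; exact: IH.
Qed.

Definition alive_coef k i w : 'M[R]_(n, q) := if alive k w then trunc_coef k i w else 0.
Definition alive_beta k w : 'cV[R]_n := if alive k w then beta k w else 0.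

Lemma frozenS_chain k w : frozen k.+1 w = (frozen k w + alive_beta k w) + \sum_(i < sz)
  alive_coef k i w *m (W w (clamp k (tm i.+1)) - W w (clamp k (tm i))).
Proof.
rewrite frozenS /alive_beta /alive_coef; case: ifP => _; first by rewrite addrA.
by rewrite addr0 big1 ?addr0// => i _; rewrite mul0mx.
Qed.

Lemma stopped_measurable k : (k <= K)%N ->
  mx_measurable (frozen k : FT (tk k) -> _) /\
  measurable_fun [set: FT (tk k)] (alive k : FT (tk k) -> bool).
Proof.
have mtrack j (y : Omega -> 'cV[R]_n) : (j <= K)%N -> mx_measurable (y : FT (tk j) -> _) ->
    measurable_fun [set: FT (tk j)] ((fun w => on_track j w (y w)) : FT (tk j) -> bool).
  move=> jK my; apply: measurable_and; last first.
    apply: measurable_fun_ltr => //; apply: measurable_funD => //.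
    by apply: measurable_funX; exact: measurable_enorm.
  apply: measurable_fun_ler => //; apply: measurable_enorm.
  by apply: mx_measurableB => //; exact: X_measurable_tk.
elim: k => [_|k IH kK].
  split; first exact: mx_measurable_cst.
  by apply: mtrack => //; exact: mx_measurable_cst.
have [mY mal] := IH (ltnW kK).
have tkk := tk_le (leqnSn k).
have mYS : mx_measurable (frozen k.+1 : FT (tk k.+1) -> _).
  rewrite (_ : frozen k.+1 = fun w => (frozen k w + alive_beta k w) + \sum_(i < sz)
    alive_coef k i w *m (W w (clamp k (tm i.+1)) - W w (clamp k (tm i)))); last first.
    by apply/funext => w; exact: frozenS_chain.
  apply: mx_measurableD.
    apply: (F_mono_mx hF (tk0 k) tkk (tk_leT kK)); apply: mx_measurableD => //.
    by apply: mx_measurable_if => //; exact: mbeta.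
  apply: mx_measurable_sum => i _; apply: mx_measurable_mul.
    have cl0 : 0 <= clamp k (tm i) by rewrite (le_trans (tk0 k))// clamp_ge.
    apply: (F_mono_mx hF cl0 (clamp_le _ _) (tk_leT kK)).
    apply: mx_measurable_if.
    - by apply: (F_mono_fun hF (tk0 k) (clamp_ge _ _) (clamp_leT _ kK)).
    - exact: trunc_coef_measurable.
    - exact: mx_measurable_cst.
  have mW s : mx_measurable ((fun w => W w (clamp k s)) : FT (tk k.+1) -> _).
    have cl0 : 0 <= clamp k s by rewrite (le_trans (tk0 k))// clamp_ge.
    apply: (F_mono_mx hF cl0 (clamp_le _ _) (tk_leT kK)).
    by apply: (W_measurable hF hW cl0); rewrite clamp_leT.
  exact: mx_measurableB.
split => //; rewrite (_ : alive k.+1 = fun w => alive k w && on_track k.+1 w (frozen k.+1 w)).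
  apply: measurable_and; last exact: mtrack.
  by apply: (F_mono_fun hF (tk0 k) tkk (tk_leT kK)).
by apply/funext => w; exact: aliveS.
Qed.

Context (p : nat).
Definition rate : R := C * (3 + (15 / 2) * p%:R).

Lemma rate_ge0 : 0 <= rate.
Proof. by rewrite mulr_ge0// addr_ge0// mulr_ge0. Qed.

Definition energy k w := 1 + enorm (frozen k w) ^+ 2.
Lemma energy_ge1 k w : 1 <= energy k w.
Proof. by rewrite lerDl sqr_ge0. Qed.

Lemma measurable_energy j k : (j <= k)%N -> (k <= K)%N ->
  measurable_fun [set: FT (tk k)] (energy j : FT (tk k) -> R).
Proof.
move=> jk kK; apply: (F_mono_fun hF (tk0 j) (tk_le jk) (tk_leT kK)).
have [mY _] := stopped_measurable (leq_trans jk kK).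
by apply: measurable_funD => //; apply: measurable_funX; exact: measurable_enorm.
Qed.

(** [chain_le] on one cell, with reserve 6 p times the time left in the cell times the squared
    radius of the projection. The term b is carried unchanged under the power: it will hold what the
    later cells of the period consume. *)
Lemma core_step k (b : Omega -> R) : (k < K)%N ->
  measurable_fun [set: FT (tk k)] (b : FT (tk k) -> R) -> (forall w, 0 <= b w) ->
  (\int[P]_w ((energy k.+1 w + b w) ^+ p)%:E <=
   \int[P]_w (((1 + C * mesh) * energy k w + rate * mesh * energy (period_start k) w + b w) ^+ p)%:E)%E.
Proof.
move=> kK mb b0; have [mY mal] := stopped_measurable (ltnW kK).
have m0 := mesh0.
(* A frozen chain does not move, so its reserve is zero. *)
pose r2 w := if alive k w then diff_radius k w ^+ 2 else 0.
have r20 w : 0 <= r2 w by rewrite /r2; case: ifP => // _; exact: sqr_ge0.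
pose a (i : nat) w := 1 + b w + 6 * p%:R * (tk k.+1 - clamp k (tm i)) * r2 w.
have cl0 s : 0 <= clamp k s by rewrite (le_trans (tk0 k))// clamp_ge.
have mono d' (T' : measurableType d') (f : Omega -> T') s :
    measurable_fun [set: FT (tk k)] (f : FT (tk k) -> T') ->
    measurable_fun [set: FT (clamp k s)] (f : FT (clamp k s) -> T').
  by move=> mf; apply: (F_mono_fun hF (tk0 k) (clamp_ge _ _) (clamp_leT _ kK)).
have mr2 : measurable_fun [set: FT (tk k)] (r2 : FT (tk k) -> R).
  apply: measurable_fun_ifT => //; apply: measurable_funX.
  exact: measurable_diff_radius (ltnW kK).
have ma i : measurable_fun [set: FT (tk k)] (a i : FT (tk k) -> R).
  apply: measurable_funD; first exact: measurable_funD.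
  exact: measurable_funM.
have := @chain_le _ _ _ P F T q W hF hW (fun i => clamp k (tm i)) sz (cl0 _)
  (@clamp_nd k) (clamp_leT _ kK) n p a (fun w => frozen k w + alive_beta k w) (alive_coef k).
move=> H; apply: (@le_trans _ _ (\int[P]_w ((a 0%N w + enorm (frozen k w + alive_beta k w) ^+ 2) ^+ p)%:E)%E).
  apply: (le_trans _ (H _ _ _ _ _)).
  - apply: ge0_le_integral_nonmeas => w _.
      by rewrite lee_fin exprn_ge0// addr_ge0// (le_trans ler01)// energy_ge1.
    rewrite lee_fin -frozenS_chain lerXn2r ?nnegrE//.
    + by rewrite addr_ge0// (le_trans ler01)// energy_ge1.
    + by rewrite !addr_ge0 ?sqr_ge0 ?mulr_ge0 ?subr_ge0 ?clamp_le.
    + rewrite /energy /a; have : 0 <= 6 * p%:R * (tk k.+1 - clamp k (tm sz)) * r2 w.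
        by rewrite !mulr_ge0 ?subr_ge0 ?clamp_le.
      lra.
  - apply: (F_mono_mx hF (tk0 k) (clamp_ge _ _) (clamp_leT _ kK)); apply: mx_measurableD => //.
    by apply: mx_measurable_if => //; exact: mbeta.
  - move=> i isz; apply: mx_measurable_if; [exact: mono|exact: trunc_coef_measurable|exact: mx_measurable_cst].
  - by move=> i isz; apply: mono; exact: ma.
  - by move=> i w _; rewrite !addr_ge0 ?mulr_ge0 ?subr_ge0 ?clamp_le.
  - move=> i w isz; rewrite /a /r2 /alive_coef; case: ifP => _; last first.
      by rewrite enorm0 expr0n /= !mulr0 addr0.
    have h : enorm (trunc_coef k i w) ^+ 2 <= diff_radius k w ^+ 2.
      by rewrite lerXn2r ?nnegrE ?enorm_ge0 ?diff_radius_ge0// enorm_trunc_coef.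
    have h2 : 0 <= 6 * p%:R * (clamp k (tm i.+1) - clamp k (tm i)) :> R.
      by rewrite !mulr_ge0// subr_ge0 clamp_nd.
    have := ler_wpM2l h2 h.
    by move: (clamp _ _) (clamp _ _) (diff_radius _ _ ^+ 2) (enorm _ ^+ 2) => c1 c0 D e; nra.
have pos w : 0 <= a 0%N w + enorm (frozen k w + alive_beta k w) ^+ 2.
  by rewrite !addr_ge0 ?sqr_ge0 ?mulr_ge0 ?subr_ge0 ?clamp_le.
apply: ge0_le_integral_nonmeas => w _; rewrite lee_fin ?exprn_ge0//.
have U1 := energy_ge1 (period_start k) w; have E1 := energy_ge1 k w.
have rm : 0 <= rate * mesh by rewrite mulr_ge0 ?rate_ge0// ltW.
have Cm0 : 0 <= C * mesh by rewrite mulr_ge0// ltW.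
rewrite lerXn2r ?nnegrE//.
  rewrite !addr_ge0 ?b0// mulr_ge0 ?(le_trans ler01 U1) ?(le_trans ler01 E1)//.
  by rewrite addr_ge0.
have tcl : tk k.+1 - clamp k (tm 0%N) <= mesh.
  by rewrite lerBlDr tkS addrC lerD2l clamp_ge.
have tcl0 : 0 <= tk k.+1 - clamp k (tm 0%N) by rewrite subr_ge0 clamp_le.
have p0 : 0 <= p%:R :> R by [].
have ar : a 0%N w <= 1 + b w + 6 * p%:R * mesh * r2 w.
  by rewrite lerD2l ler_wpM2r// ler_wpM2l// mulr_ge0.
rewrite (le_trans (lerD ar (lexx _)))// /r2 /alive_beta.
case: ifPn => [al|_]; last first.
  rewrite mulr0 !addr0; have := mulr_ge0 Cm0 (le_trans ler01 E1).
  have := mulr_ge0 rm (le_trans ler01 U1); rewrite /energy; lra.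
have /andP[close _] := alive_on_track (period_start_le k) al.
have := betaB w kK; rewrite diff_radius_sqr /drift_radius => bB.
have dot := le_trans (ler_norm _) (le_mdot_enorm (frozen k w) (beta k w)).
have XY := ler_enorm_dist (X w (tk (period_start k))) (frozen (period_start k) w).
rewrite enorm_distC in XY.
rewrite enormD_sqr /energy /rate; apply: growth_bound bB dot => //.
- exact: ltW.
- exact: (le_trans XY (lerD (lexx _) close)).
Qed.

Lemma measurable_energyA k : (k <= K)%N -> measurable_fun [set: Omega] (energy k).
Proof.
by move=> kK; apply: (F_measurable_fun hF (tk0 k) (tk_leT kK)); exact: measurable_energy.
Qed.

(** The energy at the start of the period enters the bound of each of its cells. Being random, it
    has to stay under the power: a provision for all [ns] cells is made at the start, and each cell
    takes one unit of it. *)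
Lemma period_energy i j : (i < np)%N -> (j <= ns)%N ->
  (\int[P]_w ((energy (i * ns + j)%N w + rate * mesh * (ns - j)%:R * energy (i * ns)%N w) ^+ p)%:E
   <= (((1 + C * mesh) ^+ p) ^+ j)%:E *
      \int[P]_w (((1 + rate * mesh * ns%:R) * energy (i * ns)%N w) ^+ p)%:E)%E.
Proof.
move=> inp; have m0 := ltW mesh0.
have Cm0 : 0 <= C * mesh by exact: mulr_ge0.
have r0 := rate_ge0.
have rm : 0 <= rate * mesh by exact: mulr_ge0.
have en0 k w : 0 <= energy k w by rewrite (le_trans ler01)// energy_ge1.
elim: j => [_|j IH jns].
  rewrite mul1e addn0 subn0 le_eqVlt; apply/orP; left; apply/eqP.
  by apply: eq_integral => w _; rewrite mulrDl mul1r.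
set k := (i * ns + j)%N.
have kK : (k < K)%N.
  apply: (@leq_trans (i.+1 * ns)); last by rewrite leq_mul2r inp orbT.
  by rewrite mulSn /k addnC ltn_add2r.
have pk : period_start k = (i * ns)%N.
  by rewrite /period_start /k divnMDl// divn_small// addn0.
have ik : (i * ns <= k)%N by rewrite leq_addr.
pose b w := rate * mesh * (ns - j.+1)%:R * energy (i * ns)%N w.
have b0 w : 0 <= b w.
  by apply: mulr_ge0; [apply: mulr_ge0|exact: en0].
have pos1 w : 0 <= energy k w + rate * mesh * (ns - j)%:R * energy (i * ns)%N w.
  by apply: addr_ge0; [exact: en0|apply: mulr_ge0; [apply: mulr_ge0|exact: en0]].
have C1 : 0 <= 1 + C * mesh by rewrite addr_ge0.
have pos2 w : 0 <= (1 + C * mesh) * energy k w + rate * mesh * energy (i * ns)%N w + b w.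
  by apply: addr_ge0; [apply: addr_ge0; apply: mulr_ge0|].
have mb : measurable_fun [set: FT (tk k)] (b : FT (tk k) -> R).
  by apply: measurable_funM => //; apply: measurable_energy => //; exact: ltnW.
rewrite addnS -/k; apply: (le_trans (core_step kK mb b0)); rewrite pk.
apply: (@le_trans _ _ (((1 + C * mesh) ^+ p)%:E * \int[P]_w
    ((energy k w + rate * mesh * (ns - j)%:R * energy (i * ns)%N w) ^+ p)%:E)%E).
  rewrite -ge0_integralZl//; last 3 first.
  - apply/measurable_EFinP; apply: measurable_funX; apply: measurable_funD.
      by apply: measurable_energyA; exact: ltnW.
    apply: measurable_funM => //; apply: measurable_energyA.
    by rewrite (leq_trans ik)// ltnW.
  - by move=> *; rewrite lee_fin exprn_ge0.
  - by rewrite lee_fin exprn_ge0// addr_ge0.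
  apply: ge0_le_integral_nonmeas => w _.
    by rewrite lee_fin exprn_ge0.
  rewrite -EFinM -exprMn lee_fin lerXn2r ?nnegrE//.
  - exact: mulr_ge0.
  have -> : (ns - j)%:R = (ns - j.+1)%:R + 1 :> R by rewrite natr1 subnSK.
  rewrite /b; have N0 : 0 <= (ns - j.+1)%:R :> R by [].
  move: (en0 (i * ns)%N w) (en0 k w) rm N0 Cm0.
  move: (rate * mesh) (energy _ _) (energy _ _) (_%:R) (C * mesh) => r U V N c U0 V0 rm0 N0 c0.
  have h : 0 <= c * (r * (N + 1) * V).
    by apply: mulr_ge0 => //; apply: mulr_ge0 => //; apply: mulr_ge0 => //; exact: addr_ge0.
  lra.
rewrite exprSr EFinM -muleA [X in (_ <= X)%E]muleCA lee_wpmul2l ?IH ?(ltnW jns)//.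
by rewrite lee_fin exprn_ge0// addr_ge0.
Qed.

Lemma energy_bound : (\int[P]_w (energy K w ^+ p)%:E <=
  (((1 + enorm x ^+ 2) * expR ((C + rate) * T)) ^+ p)%:E)%E.
Proof.
have m0 := ltW mesh0.
have Cm0 : 0 <= C * mesh by exact: mulr_ge0.
have r0 := rate_ge0.
have rm : 0 <= rate * mesh by exact: mulr_ge0.
have en0 k w : 0 <= energy k w by rewrite (le_trans ler01)// energy_ge1.
pose h : R := expR ((C + rate) * (mesh * ns%:R)).
suff H i : (i <= np)%N -> (\int[P]_w (energy (i * ns)%N w ^+ p)%:E <=
    ((h ^+ p) ^+ i * (1 + enorm x ^+ 2) ^+ p)%:E)%E.
  apply: (le_trans (H np (leqnn _))); rewrite lee_fin exprMn mulrC.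
  rewrite /h -!exprM mulnC exprM -expRM_natl.
  rewrite (_ : np%:R * _ = (C + rate) * T)//.
  by rewrite -[in RHS]tkK /tk natrM; ring.
elim: i => [_|i IH inp].
  rewrite mul0n expr0 mul1r.
  rewrite (_ : (\int[P]_w _)%E = (\int[P]_(w in [set: Omega]) cst ((1 + enorm x ^+ 2) ^+ p)%:E w)%E).
    by rewrite integral_cst// [X in (_ * X)%E](_ : _ = 1%E) ?mule1//; exact: probability_setT.
  by apply: eq_integral.
have := period_energy inp (leqnn ns).
rewrite subnn mulr0 mulSn addnC.
under eq_integral do rewrite mul0r addr0.
move=> /le_trans; apply.
apply: (@le_trans _ _ ((h ^+ p)%:E * \int[P]_w (energy (i * ns)%N w ^+ p)%:E)%E); last first.
  apply: (le_trans (lee_wpmul2l _ (IH (ltnW inp)))).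
    by rewrite lee_fin exprn_ge0// expR_ge0.
  by rewrite -EFinM lee_fin mulrA -exprS.
have iK : (i * ns <= K)%N by rewrite leq_mul2r (ltnW inp) orbT.
have -> : (\int[P]_w (((1 + rate * mesh * ns%:R) * energy (i * ns)%N w) ^+ p)%:E =
    ((1 + rate * mesh * ns%:R) ^+ p)%:E * \int[P]_w (energy (i * ns)%N w ^+ p)%:E)%E.
  rewrite -ge0_integralZl//; last 3 first.
  - by apply/measurable_EFinP; apply: measurable_funX; exact: measurable_energyA.
  - by move=> *; rewrite lee_fin exprn_ge0.
  - by rewrite lee_fin exprn_ge0// addr_ge0// mulr_ge0.
  by apply: eq_integral => w _; rewrite -EFinM exprMn.
rewrite muleA -EFinM lee_wpmul2r//.
  by apply: integral_ge0 => w _; rewrite lee_fin exprn_ge0.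
rewrite lee_fin -exprM mulnC exprM -exprMn lerXn2r ?nnegrE ?expR_ge0//.
  by rewrite mulr_ge0 ?exprn_ge0 ?addr_ge0// mulr_ge0.
rewrite /h (_ : (C + rate) * _ = ns%:R * (C * mesh) + rate * mesh * ns%:R); last by ring.
have Cn : 0 <= 1 + C * mesh by exact: addr_ge0.
have rn : 0 <= 1 + rate * mesh * ns%:R by apply: addr_ge0 => //; exact: mulr_ge0.
rewrite expRD expRM_natl; apply: ler_pM => //; first exact: exprn_ge0.
  by rewrite lerXn2r ?nnegrE ?expR_ge0// expR_ge1Dx.
exact: expR_ge1Dx.
Qed.

Lemma dead_frozen k w : ~~ alive k w -> (k <= K)%N -> frozen K w = frozen k w.
Proof.
move=> dk; suff H j : ~~ alive (k + j) w /\ frozen (k + j) w = frozen k w.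
  by move=> kK; rewrite -(subnKC kK); have [] := H (K - k)%N.
elim: j => [|j [dj Yj]]; first by rewrite addn0.
by rewrite addnS aliveS negb_and dj frozenS (negbTE dj).
Qed.

(** Freezing is remembered until the end: since tracking does not fail, the first failure of
    [on_track] would be an exit from the ball, after which the energy stays at least A up to the
    last step. So the terminal energy controls all grid times. *)
Lemma tracked w :
  (forall k, (k <= K)%N ->
    enorm (x + \sum_(j < k) (beta j w + noise j w) - X w (tk k)) <= eps) ->
  energy K w < A -> forall k, (k <= K)%N -> enorm (X w (tk k)) <= enorm (frozen k w) + eps /\ energy k w < A.
Proof.
move=> tr EA; have H k : (k <= K)%N -> alive k w /\ frozen k w = x + \sum_(j < k) (beta j w + noise j w).
  elim: k => [_|k IH kK].
    split; last by rewrite big_ord0 addr0.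
    apply/negPn/negP => d0; move: (EA); rewrite /energy (dead_frozen d0 (leq0n _)) => EA0.
    move: d0; rewrite /alive /= /on_track EA0 andbT.
    by have := tr 0%N (leq0n _); rewrite big_ord0 addr0 => ->.
  have [al Yk] := IH (ltnW kK).
  have Yk1 : frozen k.+1 w = x + \sum_(j < k.+1) (beta j w + noise j w).
    by rewrite frozenS al Yk big_ord_recr /= -addrA.
  split => //; apply/negPn/negP => dd; move: (EA); rewrite /energy (dead_frozen dd kK) => EA1.
  by move: dd; rewrite aliveS al /= /on_track EA1 andbT Yk1 tr.
move=> k kK; have [al _] := H k kK.
have /andP[cl En] := alive_on_track (leqnn k) al; split => //.
by rewrite (le_trans (ler_enorm_dist _ (frozen k w)))// lerD2l enorm_distC.
Qed.

(** The part of the coefficient removed by the projection; the corresponding integral is made small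
    in probability by [chain_tail]. *)
Definition err_coef (k i : nat) w : 'M[R]_(n, q) :=
  if tm i < tk k.+1 then cf i w - ball_proj (diff_radius k w) (cf i w) else 0.

Definition err (k : nat) w : 'cV[R]_n :=
  \sum_(i < sz) err_coef k i w *m (W w (clamp k (tm i.+1)) - W w (clamp k (tm i))).

Lemma noise_err k w : noise k w =
  simple_int W Hs w (tk k.+1) - simple_int W Hs w (tk k) - err k w.
Proof.
rewrite simple_int_incr /err /noise -sumrB; apply: eq_bigr => i _.
rewrite -mulmxBl /trunc_coef /err_coef; case: ifPn => [_|]; first by rewrite subKr.
rewrite -leNgt => h; rewrite subr0 mul0mx.
have tt : tk k <= tk k.+1 by exact: tk_le.
have [_ tm_nd _ _] := wfH.
have e s : tk k.+1 <= s -> clamp k s = tk k.+1.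
  by move=> hs; rewrite /clamp (min_idPr hs); exact/max_idPr.
rewrite e; last by rewrite (le_trans h)// tm_nd.
by rewrite e// subrr mulmx0.
Qed.

Lemma simple_int0 w : simple_int W Hs w (tk 0) = 0.
Proof.
rewrite /simple_int big1// => i _; rewrite /tk mul0r /=.
have ti : 0 <= tm i by exact/tm_ge0/ltnW.
have ti1 : 0 <= tm i.+1 by exact/tm_ge0.
by rewrite (min_idPl ti) (min_idPl ti1) subrr mulmx0.
Qed.

Lemma sum_noise k w : \sum_(j < k) noise j w =
  simple_int W Hs w (tk k) - \sum_(j < k) err j w.
Proof.
elim: k => [|k IH]; first by rewrite !big_ord0 simple_int0 subrr.
rewrite !big_ord_recr /= IH noise_err addrC addrA [_ - _ - err k w]addrAC subrK.
by rewrite opprD addrA addrAC.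
Qed.

Lemma err_coef_measurable k i : (k < K)%N -> (i < sz)%N ->
  mx_measurable (err_coef k i : FT (clamp k (tm i)) -> _).
Proof.
move=> kK isz; have [h|h] := boolP (tm i < tk k.+1).
  rewrite (_ : err_coef k i = fun w => cf i w - ball_proj (diff_radius k w) (cf i w)).
    apply: mx_measurableB; first exact: cf_measurable.
    apply: mx_measurable_ball_proj; [exact: measurable_diff_radius_clamp|exact: cf_measurable].
  by apply/funext => w; rewrite /err_coef h.
rewrite (_ : err_coef k i = fun=> 0); first exact: mx_measurable_cst.
by apply/funext => w; rewrite /err_coef (negbTE h).
Qed.

(** B is covered by the complement of E, the event that the terminal energy reaches A, and, for each
    cell, the event that the removed noise exceeds its share eps / (2 K) of the tolerance. The first
    and the last kind cost eta each. *)
Lemma core_tail (eta delta : R) (E B : set Omega) :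
  0 < A -> 0 <= delta -> K%:R * (6 * delta / (eps / (2 * K%:R)) ^+ 2) <= eta ->
  measurable E -> (P (~` E) <= eta%:E)%E ->
  (forall w k, E w -> (k < K)%N ->
    \sum_(i < sz) enorm (cf i w - ball_proj (diff_radius k w) (cf i w)) ^+ 2 *
      (clamp k (tm i.+1) - clamp k (tm i)) <= delta) ->
  (forall w k, E w -> (k <= K)%N ->
    enorm (x + \sum_(j < k) beta j w + simple_int W Hs w (tk k) - X w (tk k)) <= eps / 2) ->
  (forall w t, E w -> 0 <= t <= T -> exists2 k, (k <= K)%N &
    enorm (X w t - X w (tk k)) <= eps) ->
  measurable B ->
  (forall w, B w -> exists2 t, 0 <= t <= T & 5 / 4 * A < 1 + enorm (X w t) ^+ 2) ->
  (P B <= (eta + eta + (A^-1 * ((1 + enorm x ^+ 2) * expR ((C + rate) * T))) ^+ p)%:E)%E.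
Proof.
move=> A0 d0 eta0 mE PE Hcoef Htrack Hosc mB HB.
have K0' : 0 < K%:R :> R by rewrite ltr0n K0.
have e2 : 0 < eps / (2 * K%:R) by rewrite divr_gt0 ?eps0// mulr_gt0.
have cl0 k s : 0 <= clamp k s by rewrite (le_trans (tk0 k))// clamp_ge.
pose Qs k w := \sum_(i < sz) enorm (err_coef k i w) ^+ 2 * (clamp k (tm i.+1) - clamp k (tm i)).
pose Err k := [set w | Qs k w <= delta] `&` [set w | eps / (2 * K%:R) <= enorm (err k w)].
pose Hi := [set w | A <= energy K w].
have mHi : measurable Hi.
  rewrite -[X in measurable X]setTI; apply: measurable_fun_ler => //.
  exact: measurable_energyA.
have PHi : (P Hi <= ((A^-1 * ((1 + enorm x ^+ 2) * expR ((C + rate) * T))) ^+ p)%:E)%E.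
  rewrite exprMn exprVn EFinM muleC lee_pdivlMr ?exprn_gt0// muleC.
  apply: le_trans energy_bound; apply: markov_le => //.
  - by rewrite exprn_ge0// ltW.
  - by move=> w; rewrite lee_fin exprn_ge0// (le_trans ler01)// energy_ge1.
  - move=> w Aw; rewrite lee_fin lerXn2r ?nnegrE// ?(ltW A0)//.
    by rewrite (le_trans ler01)// energy_ge1.
have mcoef k i : (k < K)%N -> (i < sz)%N -> mx_measurable (err_coef k i).
  move=> kK isz; apply: (F_measurable_mx hF (cl0 k (tm i)) (clamp_leT _ kK)).
  exact: err_coef_measurable.
have mErr k : (k < K)%N -> measurable (Err k).
  move=> kK; apply: measurableI; rewrite -[X in measurable X]setTI.
    apply: measurable_fun_ler => //; apply: measurable_fun_bigsum => i _.
    apply: measurable_funM => //; apply: measurable_funX; apply: measurable_enorm.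
    exact: mcoef.
  apply: measurable_fun_ler => //; apply: measurable_enorm.
  apply: mx_measurable_sum => i _; apply: mx_measurable_mul; first exact: mcoef.
  have mW s : mx_measurable (fun w => W w (clamp k s)).
    apply: (F_measurable_mx hF (cl0 k s) (clamp_leT _ kK)).
    exact: (W_measurable hF hW (cl0 k s) (clamp_leT _ kK)).
  exact: mx_measurableB.
have PErr k : (k < K)%N -> (P (Err k) <= (6 * delta / (eps / (2 * K%:R)) ^+ 2)%:E)%E.
  move=> kK; apply: (@chain_tail _ _ _ P F T q W hF hW (fun i => clamp k (tm i)) sz (cl0 k _)
    (@clamp_nd k) (clamp_leT _ kK) n (err_coef k)) => //.
  by move=> i isz; exact: err_coef_measurable.
pose FF (i : nat) := match i with 0%N => ~` E | 1%N => Hi | j.+2 => Err j end.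
have sub : B `<=` \big[setU/set0]_(i < K.+2) FF i.
  rewrite !big_ord_recl => w Bw; have [Ew|] := pselect (E w); last by move=> ?; left.
  right; have [Hw|nHi] := pselect (Hi w); first by left.
  right; apply: contrapT => nErr.
  have EA : energy K w < A by rewrite ltNge; apply/negP.
  have err_small j : (j < K)%N -> enorm (err j w) <= eps / (2 * K%:R).
    move=> jK; rewrite leNgt; apply/negP => h; apply: nErr.
    rewrite -(bigcup_mkord K (fun j => FF j.+2)); exists j => //; split; last exact: ltW.
    apply: le_trans (Hcoef w j Ew jK); apply: ler_sum => i _.
    rewrite ler_wpM2r ?subr_ge0 ?clamp_nd// /err_coef; case: ifP => // _.
    by rewrite enorm0 expr0n sqr_ge0.
  have track k : (k <= K)%N ->
      enorm (x + \sum_(j < k) (beta j w + noise j w) - X w (tk k)) <= eps.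
    move=> kK; rewrite big_split /= sum_noise.
    rewrite (_ : _ - X w (tk k) = (x + \sum_(j < k) beta j w +
      simple_int W Hs w (tk k) - X w (tk k)) - \sum_(j < k) err j w); last first.
      by rewrite !addrA [LHS]addrAC.
    rewrite (le_trans (ler_enormD _ _))// enormN.
    have h : enorm (\sum_(j < k) err j w) <= eps / 2.
      rewrite (le_trans (ler_enorm_sum _ _ _))//.
      apply: (@le_trans _ _ (\sum_(j < k) eps / (2 * K%:R))).
        by apply: ler_sum => j _; apply: err_small; rewrite (leq_trans _ kK).
      rewrite sumr_const card_ord -(mulr_natl _ k).
      have aux (a b c : R) : 0 < c -> a * (b / (2 * c)) = b / 2 * (a / c).
        by move=> c0; field; rewrite gt_eqF.
      rewrite aux//.
      by rewrite ler_piMr ?divr_ge0 ?(ltW eps0)// ler_pdivrMr// mul1r ler_nat.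
    by have := Htrack w k Ew kK; lra.
  have [t tT tA] := HB w Bw.
  have [k kK oscX] := Hosc w t Ew tT.
  have [XY EkA] := tracked track EA kK.
  have Xt := ler_enorm_dist (X w t) (X w (tk k)).
  move: EkA tA oscX XY Xt (enorm_ge0 (frozen k w)) (enorm_ge0 (X w t)); rewrite /energy /eps.
  move: (enorm (X w t - _)) (enorm (X w t)) (enorm (frozen k w)) (enorm (X w (tk k))).
  move=> a b c dd EkA tA oscX XY Xt c0 b0.
  (* 1/8 is twice [eps]: once from t to the grid, once from X to the chain. Then 1 + (c + 1/8)^2 <=
     5/4 (1 + c^2), hence the factor 5/4 in front of A. *)
  have bc : b <= c + 1 / 8 by lra.
  have : b ^+ 2 <= (c + 1 / 8) ^+ 2.
    by rewrite lerXn2r ?nnegrE//; lra.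
  have := sqr_ge0 (1 - c); nra.
have mFF k : `I_K.+2 k -> measurable (FF k).
  by case: k => [|[|k]] /= kK; [exact: measurableC|exact: mHi|exact: mErr].
have cs := @content_subadditive _ _ _ P B FF K.+2 mFF mB sub.
apply: (le_trans cs); rewrite !big_ord_recl /=.
rewrite (_ : eta + eta + _ = eta + ((A^-1 * ((1 + enorm x ^+ 2) * expR ((C + rate) * T))) ^+ p + eta)).
  rewrite !EFinD leeD// leeD//.
  apply: (@le_trans _ _ (\sum_(i < K) (6 * delta / (eps / (2 * K%:R)) ^+ 2)%:E)%E).
    by apply: lee_sum => i _; rewrite add0n; apply: PErr; exact: ltn_ord.
  rewrite sumEFin lee_fin sumr_const card_ord.
  by rewrite mulr_natl in eta0.
by rewrite -addrA; congr (_ + _); rewrite addrC.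
Qed.

End core.

(** * Measurability of continuous processes *)

Section path_continuity.
Context {R : realType} (d : nat) (T : R).
Implicit Type g : R -> 'cV[R]_d.

Lemma mx_continuous_eps m n k l (f : 'M[R]_(m, n) -> 'M[R]_(k, l)) i j y e :
  continuous f -> 0 < e ->
  exists2 de, 0 < de & forall y', enorm (y' - y) < de -> `|f y' i j - f y i j| < e.
Proof.
move=> cf e0.
have cfij : f y' i j @[y' --> y] --> f y i j.
  exact: (cvg_comp _ _ (cf y) (@coord_continuous R k l i j (f y))).
move/cvgrPdist_lt : cfij => /(_ e e0) /nbhs_ballP[de /= de0 H].
exists de => // y' yy'; rewrite distrC; apply: H; split=> // u v.
have := normr_le_enorm (y' - y) u v; rewrite !mxE => h.
by rewrite /ball /= distrC (le_lt_trans h yy').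
Qed.

Lemma continuous_path_eps g t e : continuous_path T g -> 0 <= t <= T -> 0 < e ->
  exists2 de, 0 < de & forall s, 0 <= s <= T -> `|s - t| < de -> enorm (g s - g t) < e.
Proof.
move=> cg tT e0; pose e' := e / ((d * 1)%:R + 1).
have d1 : 0 < (d * 1)%:R + 1 :> R by rewrite ltr_wpDl.
have e'0 : 0 < e' by rewrite divr_gt0.
have tin : `[0, T]%classic t by rewrite /= in_itv.
have /subspace_continuousP/(_ t tin)/cvgrPdist_lt/(_ e' e'0) := cg.
rewrite near_withinE => /nbhs_ballP[de /= de0 H]; exists de => // s sT st.
have := H s; rewrite /ball /= distrC => /(_ st); rewrite /= in_itv /= => /(_ sT) h.
rewrite enorm_distC (le_lt_trans (enorm_le_normr _))//.
apply: (@le_lt_trans _ _ ((d * 1)%:R * e')); first by rewrite ler_wpM2l// ltW.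
by rewrite /e' mulrCA gtr_pMr// ltr_pdivrMr// mul1r ltrDl.
Qed.

(** The Heine-Cantor theorem, from the covering form of compactness with a modulus tending to 0 from
    the right. *)
Lemma continuous_path_unif g e : continuous_path T g -> 0 < e ->
  exists2 de, 0 < de & forall s t, 0 <= s <= T -> 0 <= t <= T -> `|s - t| < de ->
    enorm (g s - g t) < e.
Proof.
move=> cg e0; have /compact_near_coveringP/near_covering_withinP := @segment_compact R 0 T.
move=> /(_ R 0^'+ (fun de t => forall s, 0 <= s <= T -> `|s - t| < de -> enorm (g s - g t) < e) _).
have e2 : 0 < e / 2 by rewrite divr_gt0.
move=> /(_ _)[|de /= de0 H].
  move=> t /=; rewrite in_itv /= => tT; have [de de0 H] := continuous_path_eps cg tT e2.
  have de2 : 0 < de / 2 by rewrite divr_gt0.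
  exists (ball t (de / 2), [set r | 0 < r < de / 2]) => /=.
    split; first exact: nbhsx_ballx.
    exists (de / 2) => //= r; rewrite /= sub0r normrN => rd r0.
    by rewrite r0 (le_lt_trans (ler_norm _) rd).
  move=> [t' r] /= [tt' /andP[r0 rd]]; rewrite in_itv /= => t'T s sT st'.
  rewrite /ball /= in tt'.
  rewrite (le_lt_trans (ler_enormB _ (g t) _))// [ltRHS](_ : _ = e / 2 + e / 2); last by field.
  apply: ltrD; first apply: H => //.
    by have := ler_distD t' s t; rewrite (distrC t' t); lra.
  by rewrite enorm_distC H// distrC; lra.
exists (de / 2); first by rewrite divr_gt0.
move=> s t sT tT st; apply: (H (de / 2)) => //=.
- by rewrite sub0r normrN gtr0_norm ?divr_gt0//; lra.
- by rewrite divr_gt0.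
Qed.

(** By uniform continuity the norm grows by at most 1 over each step of length de / 2. *)
Lemma continuous_path_bounded g : 0 <= T -> continuous_path T g ->
  exists M : nat, forall t, 0 <= t <= T -> enorm (g t) <= M%:R.
Proof.
move=> T0 cg; have [de de0 H] := continuous_path_unif cg ltr01.
have stepB (n : nat) t : 0 <= t <= T -> t <= n%:R * (de / 2) -> enorm (g t) <= enorm (g 0) + n%:R.
  elim: n t => [|n IH] t tT tn.
    have -> : t = 0 by apply/eqP; rewrite eq_le; move: tn; rewrite mul0r => ->; case/andP: tT.
    by rewrite addr0.
  have [tn'|tn'] := leP t (n%:R * (de / 2)).
    by rewrite (le_trans (IH t tT tn'))// lerD2l ler_nat.
  have tT' : 0 <= t - de / 2 <= T \/ t < de / 2.
    have [h|h] := leP (de / 2) t; [left|by right].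
    by case/andP: tT => t0 tT; rewrite subr_ge0 h /=; lra.
  have n1 : n.+1%:R = n%:R + 1 :> R by rewrite natr1.
  case: tT' => [tT'|tsmall].
    have h1 := IH _ tT' _; have h2 : enorm (g t - g (t - de / 2)) < 1.
      by apply: H => //; rewrite opprB addrC subrK gtr0_norm ?divr_gt0//; lra.
    have := ler_enorm_dist (g t) (g (t - de / 2)); have := h1 _.
    have tn2 : t - de / 2 <= n%:R * (de / 2) by move: tn; rewrite n1; lra.
    by move=> /(_ tn2); rewrite n1; lra.
  have t0T : 0 <= (0 : R) <= T by rewrite lexx.
  have h2 : enorm (g t - g 0) < 1.
    by apply: H => //; rewrite subr0 ger0_norm; case/andP: tT => //; lra.
  have := ler_enorm_dist (g t) (g 0); rewrite n1; have : 0 <= n%:R :> R by [].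
  lra.
pose n := (Num.truncn (T / (de / 2))).+1.
have nP : T <= n%:R * (de / 2).
  by rewrite -ler_pdivrMr ?divr_gt0// ltW// truncnS_gt.
exists (Num.truncn (enorm (g 0) + n%:R)).+1 => t tT.
apply: (le_trans (stepB n t tT _)); first by rewrite (le_trans _ nP)//; case/andP: tT.
by rewrite ltW// truncnS_gt.
Qed.

End path_continuity.

Section countable_partition.
Context {R : realType} d (S : measurableType d) (D : set S).

Lemma measurable_fun_partition (I : countType) (l : S -> I) (g : I -> S -> R) (f : S -> R) :
  measurable D -> (forall i, measurable (D `&` [set s | l s = i])) ->
  (forall i, measurable_fun D (g i)) ->
  (forall s, D s -> f s = g (l s) s) -> measurable_fun D f.
Proof.
move=> mD ml mg fg _ B mB.
rewrite (_ : D `&` f @^-1` B = \bigcup_(i in [set: I])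
    ((D `&` [set s | l s = i]) `&` (D `&` g i @^-1` B))); last first.
  apply/seteqP; split => s /=.
    by move=> [Ds Bs]; exists (l s) => //; split; split => //=; rewrite -fg.
  by move=> [i _ /= [[Ds li] [_ Bs]]]; split => //; rewrite fg// li.
apply: countable_bigcupT_measurable; first exact: countableP.
by move=> i; apply: measurableI => //; exact: mg.
Qed.

Lemma measurable_floor_set (u : S -> R) (k : int) : measurable D ->
  measurable_fun D u -> measurable (D `&` [set s | Num.floor (u s) = k]).
Proof.
move=> mD mu; rewrite (_ : [set s | _] = u @^-1` `[k%:~R, (k + 1)%:~R[%classic).
  exact: mu.
apply/seteqP; split => s /=; rewrite in_itv /=; first by move=> <-; exact: floor_itv.
by move=> h; apply/eqP; rewrite floor_eq.
Qed.

Definition quant n (m : nat) (y : 'cV[R]_n) : 'cV[R]_n :=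
  \col_i ((Num.floor (m.+1%:R * y i ord0))%:~R / m.+1%:R).

Lemma quant_dist n (m : nat) (y : 'cV[R]_n) : enorm (quant m y - y) <= n%:R / m.+1%:R.
Proof.
rewrite (le_trans (enorm_le_sum _))//.
apply: (@le_trans _ _ (\sum_(i < n) m.+1%:R^-1)); last first.
  by rewrite sumr_const card_ord; move: (m.+1%:R^-1) => u; rewrite mulr_natl.
apply: ler_sum => i _; rewrite big_ord1 !mxE.
have m0 : 0 < m.+1%:R :> R by [].
have /andP[h1 h2] := floor_itv (m.+1%:R * y i ord0).
rewrite -(ler_pM2l m0) divff ?gt_eqF// -{1}(ger0_norm (ltW m0)) -normrM mulrBr mulrCA divff ?gt_eqF// mulr1.
move: h1 h2; rewrite intrD (_ : 1%:~R = 1)//; rewrite ler_norml.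
by set a := _%:~R; set b := _ * _; lra.
Qed.

(* Carathéodory functions are limits of the compositions with the quantized argument *)
Lemma measurable_caratheodory n (c : S -> 'cV[R]_n -> R) (u : S -> 'cV[R]_n) :
  measurable D -> (forall y, measurable_fun D (c^~ y)) ->
  (forall s y e, D s -> 0 < e ->
    exists2 de, 0 < de & forall y', enorm (y' - y) < de -> `|c s y' - c s y| < e) ->
  (forall i, measurable_fun D (fun s => u s i ord0)) ->
  measurable_fun D (fun s => c s (u s)).
Proof.
move=> mD mc cc mu.
apply: (@measurable_fun_cvg _ _ _ _ (fun m s => c s (quant m (u s)))).
  move=> m; pose val (z : {ffun 'I_n -> int}) : 'cV[R]_n := \col_i ((z i)%:~R / m.+1%:R).
  apply: (@measurable_fun_partition _
    (fun s => [ffun i => Num.floor (m.+1%:R * u s i ord0)]) (fun z s => c s (val z))) => //.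
    move=> z; rewrite (_ : _ `&` _ = \bigcap_(i in [set: 'I_n])
        (D `&` [set s | Num.floor (m.+1%:R * u s i ord0) = z i]) `&` D); last first.
      apply/seteqP; split => s /=.
        by move=> [Ds <-]; split => // i _; rewrite ffunE.
      by move=> [h Ds]; split => //; apply/ffunP => i; rewrite ffunE; case: (h i).
    apply: measurableI => //; apply: fin_bigcap_measurable; first exact: finite_finset.
    by move=> i _; apply: measurable_floor_set => //; exact: measurable_funM.
  move=> s Ds; congr (c s _); apply/matrixP => i j.
  by rewrite !mxE ffunE.
move=> s Ds; apply/cvgrPdist_lt => e e0.
have [de de0 H] := cc s (u s) e Ds e0.
near=> m; rewrite distrC; apply: H; apply: (le_lt_trans (quant_dist _ _)).
rewrite ltr_pdivrMr// -ltr_pdivrMl//; near: m.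
exists (Num.truncn (de^-1 * n%:R)) => // m /= hm.
apply: (lt_le_trans (truncnS_gt _)); by rewrite ler_nat ltnS.
Unshelve. all: by end_near. Qed.

End countable_partition.

Section clip.
Context {R : realType} (T : R).
Hypothesis T0 : 0 <= T.

(** Projects times to [0, T], so that all rationals can serve as a dense set of times, end points
    included. *)
Definition clip (t : R) : R := Num.max 0 (Num.min t T).

Lemma clip_in t : 0 <= clip t <= T.
Proof. by rewrite /clip le_max lexx /= ge_max T0 ge_min lexx orbT. Qed.

Lemma clip_id t : 0 <= t <= T -> clip t = t.
Proof. by move=> /andP[t0 tT]; rewrite /clip (min_idPl tT) (max_idPr t0). Qed.

Lemma clip_dist s t : `|clip s - clip t| <= `|s - t|.
Proof.
have H (a b : R) : a <= b -> `|clip a - clip b| <= `|a - b|.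
  move=> ab; have cab : clip a <= clip b.
    rewrite /clip ge_max le_max lexx /= le_max ge_min; apply/orP; right.
    by rewrite le_min !ge_min ab lexx !orbT.
  rewrite distrC (distrC a) !ger0_norm ?subr_ge0//.
  rewrite /clip; have := T0; rewrite /Num.max /Num.min.
  by do 4 case: ifPn; rewrite -?leNgt; lra.
by have [/H|/ltW/H] := leP s t => // h; rewrite distrC (distrC s).
Qed.

End clip.

Section joint.
Context {R : realType} (T : R) (T0 : 0 <= T).
Context d (Omega : measurableType d) (n : nat) (X : Omega -> R -> 'cV[R]_n).
Hypothesis Xc : forall w, continuous_path T (X w).
Hypothesis Xm : forall t, 0 <= t <= T -> mx_measurable (fun w => X w t).
Context d' (S : measurableType d') (D : set S) (mD : measurable D).
Context (om : S -> Omega) (tau : S -> R).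
Hypothesis mom : measurable_fun [set: S] om.
Hypothesis mtau : measurable_fun D tau.
Hypothesis tauT : forall s, D s -> 0 <= tau s <= T.

(** A continuous process is a Carathéodory function of outcome and time; time is written as a vector
    of dimension 1 to reuse [measurable_caratheodory]. *)
Lemma measurable_joint_path i : measurable_fun D (fun s => X (om s) (tau s) i ord0).
Proof.
pose c (s : S) (y : 'cV[R]_1) := X (om s) (clip T (y ord0 ord0)) i ord0.
pose u (s : S) : 'cV[R]_1 := \col_(_ < 1) tau s.
apply: (@eq_measurable_fun _ _ _ _ _ (fun s => c s (u s))).
  by move=> s /[!inE] Ds; rewrite /c /u mxE clip_id// tauT.
apply: measurable_caratheodory => //.
- move=> y; apply: measurable_funTS.
  exact: (measurableT_comp (Xm (clip_in T0 _) i ord0) mom).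
- move=> s y e Ds e0.
  have [de de0 H] := continuous_path_eps (@Xc (om s)) (clip_in T0 (y ord0 ord0)) e0.
  exists de => // y' yy'; rewrite /c.
  have := normr_le_enorm (X (om s) (clip T (y' ord0 ord0)) - X (om s) (clip T (y ord0 ord0))) i ord0.
  rewrite !mxE => /le_lt_trans; apply; apply: H; first exact: clip_in.
  rewrite (le_lt_trans (clip_dist T0 _ _))// (le_lt_trans _ yy')//.
  by have := normr_le_enorm (y' - y) ord0 ord0; rewrite !mxE.
- by move=> j; apply: (@eq_measurable_fun _ _ _ _ _ tau) => // s _; rewrite mxE.
Qed.

Lemma measurable_joint_coef (c : R -> 'cV[R]_n -> R) :
  (forall y, measurable_fun D (fun s => c (tau s) y)) ->
  (forall t y e, 0 <= t <= T -> 0 < e ->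
    exists2 de, 0 < de & forall y', enorm (y' - y) < de -> `|c t y' - c t y| < e) ->
  measurable_fun D (fun s => c (tau s) (X (om s) (tau s))).
Proof.
move=> mc cc; apply: (@measurable_caratheodory _ _ _ _ _ (fun s => c (tau s))) => //.
- by move=> s y e Ds; apply: cc; exact: tauT.
- exact: measurable_joint_path.
Qed.

End joint.

(** * Distance from simple processes to the integrand *)

Lemma nondecreasing_upto (R : realType) (sz : nat) (u : nat -> R) :
  (forall i, (i < sz)%N -> u i <= u i.+1) ->
  forall i j, (i <= j)%N -> (j <= sz)%N -> u i <= u j.
Proof.
move=> nd i; elim=> [|j IH] ij jsz; first by move: ij; rewrite leqn0 => /eqP ->.
move: ij; rewrite leq_eqVlt => /orP[/eqP -> //|]; rewrite ltnS => ij.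
by rewrite (le_trans (IH ij (ltnW jsz)))// nd.
Qed.

(** The open intervals between nodes are disjoint, so at each s at most one indicator survives; the
    nodes themselves are negligible. *)
Lemma step_le_integral (R : realType) (T : R) (sz : nat) (u v : nat -> R) (f : R -> R) :
  (forall i, (i < sz)%N -> u i <= u i.+1) ->
  (forall i, (i <= sz)%N -> 0 <= u i <= T) ->
  (forall i, (i < sz)%N -> 0 <= v i) -> (forall s, 0 <= f s) ->
  (forall i s, (i < sz)%N -> u i < s -> s < u i.+1 -> v i <= f s) ->
  ((\sum_(i < sz) v i * (u i.+1 - u i))%:E <=
     \int[lebesgue_measure]_(s in `[0%R, T]) (f s)%:E)%E.
Proof.
move=> nd u0T v0 f0 vf; pose J (i : nat) : set R := `]u i, u i.+1[%classic.
have JT i : (i < sz)%N -> J i `<=` `[0, T]%classic.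
  move=> isz s; rewrite /J /= !in_itv /= => /andP[h1 h2].
  have /andP[a _] := u0T i (ltnW isz); have /andP[_ b] := u0T i.+1 isz.
  by rewrite (le_trans a (ltW h1)) (le_trans (ltW h2) b).
have -> : ((\sum_(i < sz) v i * (u i.+1 - u i))%:E =
    \int[lebesgue_measure]_(s in `[0%R, T]) \sum_(i < sz) (v i * \1_(J i) s)%:E)%E.
  rewrite ge0_integral_sum//; last 2 first.
    move=> i; apply/measurable_EFinP; apply: measurable_funM => //.
    by apply: measurable_indic; exact: measurable_itv.
    by move=> i s _; rewrite lee_fin mulr_ge0// v0.
  rewrite -sumEFin; apply: eq_bigr => i _.
  under eq_integral do rewrite EFinM.
  rewrite ge0_integralZl//; last 2 first.
    by apply/measurable_EFinP; apply: measurable_indic; exact: measurable_itv.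
    by rewrite lee_fin v0.
  rewrite integral_indic//; last exact: measurable_itv.
  rewrite setIidl; last exact: JT.
  rewrite EFinM; congr (_ * _)%E; apply/esym.
  apply: etrans (lebesgue_measure_itv _) _; rewrite /= lte_fin; have := nd i (ltn_ord i).
  rewrite le_eqVlt => /orP[/eqP ->|-> //]; first by rewrite ltxx subrr.
apply: ge0_le_integral_nonmeas => s _.
  by apply: sume_ge0 => i _; rewrite lee_fin mulr_ge0// v0.
rewrite sumEFin lee_fin.
have [/existsP[i si]|/existsPn none] := boolP [exists i : 'I_sz, s \in J i].
  rewrite (bigD1 i)//= indicE si mulr1 big1 ?addr0.
    by move: si; rewrite inE /J /= in_itv /= => /andP[h1 h2]; exact: vf h1 h2.
  move=> j ji; rewrite indicE; case: (boolP (s \in J j)) => [sj|]; last by rewrite mulr0.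
  move: si sj; rewrite !inE /J /= !in_itv /= => /andP[h1 h2] /andP[h3 h4].
  have mono := nondecreasing_upto nd.
  have := ltn_ord i; have := ltn_ord j; move: ji; rewrite neq_ltn => /orP[ji|ij] jsz isz.
    by have := mono _ _ ji (ltnW isz); lra.
  by have := mono _ _ ij (ltnW jsz); lra.
rewrite big1 ?f0// => i _; have := none i; rewrite indicE => /negbTE ->.
by rewrite mulr0.
Qed.

Section coef.
Context {R : realType} d (Omega : measurableType d) (P : probability Omega R).
Context (F : R -> set (set Omega)) (T : R) (q n : nat) (Hs : simple_process R Omega n q).
Hypothesis wfH : simple_wf F T Hs.

Lemma simple_valE i w s : (i < sp_size Hs)%N -> sp_time Hs i < s -> s <= sp_time Hs i.+1 ->
  simple_val Hs w s = sp_coef Hs i w.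
Proof.
move=> isz h1 h2; have [_ nd _ _] := wfH; have mono := nondecreasing_upto nd.
rewrite /simple_val (bigD1 (Ordinal isz))//= h1 h2 scale1r big1 ?addr0// => j ji.
suff /negbTE -> : ~~ (sp_time Hs j < s <= sp_time Hs j.+1) by rewrite scale0r.
apply/negP => /andP[h3 h4]; have := ltn_ord j.
move: ji; rewrite -val_eqE neq_ltn /= => /orP[ji|ij] jsz.
  by have := mono _ _ ji (ltnW isz); lra.
by have := mono _ _ ij (ltnW jsz); lra.
Qed.

Context (X : Omega -> R -> 'cV[R]_n) (C : R) (np ns : nat).
Hypothesis T0 : 0 < T.
Hypothesis np0 : (0 < np)%N.
Hypothesis ns0 : (0 < ns)%N.
Local Notation K := (np * ns)%N.

(** [ball_proj_dist] at each time s of the cell, with the true coefficient [S s] as the point of the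
    ball: the removed part is at most the distance from the simple process to S. *)
Lemma coef_error (S : R -> 'M[R]_(n, q)) w k delta : (k < K)%N ->
  (forall s, tk T np ns k < s -> s < tk T np ns k.+1 -> enorm (S s) <= diff_radius T X C np ns k w) ->
  (\int[lebesgue_measure]_(s in `[0%R, T]) (enorm (simple_val Hs w s - S s) ^+ 2)%:E
     <= delta%:E)%E ->
  \sum_(i < sp_size Hs) enorm (sp_coef Hs i w - ball_proj (diff_radius T X C np ns k w)
     (sp_coef Hs i w)) ^+ 2 * (clamp T np ns k (sp_time Hs i.+1) - clamp T np ns k (sp_time Hs i)) <= delta.
Proof.
move=> kK HS Hint; rewrite -lee_fin; apply: le_trans Hint.
have [_ nd _ _] := wfH.
apply: (step_le_integral (u := fun i => clamp T np ns k (sp_time Hs i))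
  (v := fun i => enorm (sp_coef Hs i w - ball_proj (diff_radius T X C np ns k w) (sp_coef Hs i w)) ^+ 2)).
- by move=> i isz; apply: clamp_mono => //; exact: nd.
- move=> i _; rewrite (le_trans (tk0 T0 np0 ns0 k)) ?clamp_ge//=.
  by rewrite (le_trans (clamp_le T0 np0 ns0 _ _))// tk_leT.
- by move=> i _; exact: sqr_ge0.
- by move=> s; exact: sqr_ge0.
move=> i s isz; rewrite /clamp => s1 s2.
move: s1; rewrite gt_max => /andP[ks]; rewrite gt_min => s1.
move: s2; rewrite lt_max lt_min => /orP[|/andP[s2 sk]]; first by lra.
have {}s1 : sp_time Hs i < s by case/orP: s1 => //; lra.
rewrite (simple_valE w isz s1 (ltW s2)) lerXn2r ?nnegrE ?enorm_ge0//.
by rewrite enorm_distC; apply: ball_proj_dist; exact: HS.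
Qed.

End coef.

Section gap.
Context {R : realType} d (Omega : measurableType d) (P : probability Omega R).
Context (F : R -> set (set Omega)) (T : R) (q n : nat) (Hs : simple_process R Omega n q).
Hypothesis hF : filtration F T.
Hypothesis T0 : 0 < T.
Hypothesis wfH : simple_wf F T Hs.
Context (X : Omega -> R -> 'cV[R]_n).
Hypothesis Xc : forall w, continuous_path T (X w).
Hypothesis Xm : forall t, 0 <= t <= T -> mx_measurable (fun w => X w t).
Context (tau : R -> R) (c : R -> 'cV[R]_n -> 'M[R]_(n, q)).
Hypothesis mtau : measurable_fun `[0, T] tau.
Hypothesis tauT : forall s, 0 <= s <= T -> 0 <= tau s <= T.
Hypothesis mc : forall y i j, measurable_fun `[0, T] (fun s => c (tau s) y i j).
Hypothesis cc : forall t, 0 <= t <= T -> continuous (c t).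

Let D : set (Omega * measurableTypeR R) := setT `*` `[0, T].

Let mD : measurable D.
Proof. by apply: measurableX. Qed.

Let msnd (f : R -> R) : measurable_fun `[0, T] f -> measurable_fun D (fun z => f z.2).
Proof.
move=> mf; apply: (measurable_comp (F := `[0, T]%classic)) => //.
  by move=> _ [[w s] [/= _ sT] <-].
by apply: measurable_funTS; exact: measurable_snd.
Qed.

Lemma measurable_coef_joint i j :
  measurable_fun D (fun z => c (tau z.2) (X z.1 (tau z.2)) i j).
Proof.
have := @measurable_joint_coef R T (ltW T0) _ Omega n X Xc Xm _ _ D mD fst (fun z => tau z.2)
  measurable_fst (msnd mtau) _ (fun t y => c t y i j).
apply.
- by move=> [w s] [_ /=]; rewrite in_itv /=; exact: tauT.
- by move=> y; exact: (msnd (mc y i j)).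
- by move=> t y e tT e0; apply: mx_continuous_eps => //; exact: cc.
Qed.

Lemma measurable_simple_val_joint i j :
  measurable_fun D (fun z => simple_val Hs z.1 z.2 i j).
Proof.
have [_ _ _ wf] := wfH; have [_ nd _ _] := wfH.
rewrite [X in measurable_fun _ X](_ : _ = fun z => \sum_(k < sp_size Hs)
   \1_(`]sp_time Hs k, sp_time Hs k.+1]%classic) z.2 * sp_coef Hs k z.1 i j); last first.
  apply/funext => z; rewrite /simple_val summxE; apply: eq_bigr => k _.
  by rewrite mxE indicE mem_setE in_itv.
apply: measurable_sum => k; apply: measurable_funM.
  apply: (msnd (f := \1_(`]sp_time Hs k, sp_time Hs k.+1]%classic))).
  by apply: measurable_indic; exact: measurable_itv.
have [mcf _] := wf k (ltn_ord k).
apply: measurable_funTS.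
suff h : measurable_fun [set: Omega] (fun w => sp_coef Hs k w i j).
  exact: (measurableT_comp h measurable_fst).
move=> _ B mB; rewrite setTI.
have tT : 0 <= sp_time Hs k /\ sp_time Hs k <= T.
  have := @tm_ge0 R _ Omega F T q n (sp_size Hs) (sp_time Hs) (sp_coef Hs).
  move=> h; split; first by apply: h; [case: (Hs) wfH|exact: ltnW].
  have [_ _ e _] := wfH; apply: le_trans e.
  exact: (nondecreasing_upto nd (ltnW (ltn_ord k)) (leqnn _)).
by apply: (F_sub hF tT.1 tT.2); exact: mcf.
Qed.

(** Makes the event that the simple process is far from the integrand measurable, so that it can
    enter a union bound. *)
Lemma measurable_gap : measurable_fun [set: Omega] (fun w =>
  (\int[lebesgue_measure]_(s in `[0%R, T])
    (enorm (simple_val Hs w s - c (tau s) (X w (tau s))) ^+ 2)%:E)%E).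
Proof.
pose f (z : Omega * measurableTypeR R) : \bar R :=
  ((fun z => (enorm (simple_val Hs z.1 z.2 - c (tau z.2) (X z.1 (tau z.2))) ^+ 2)%:E) \_ D) z.
rewrite [X in measurable_fun _ X](_ : _ = fubini_F lebesgue_measure f).
  apply: measurable_fun_fubini_tonelli_F.
    apply/(measurable_restrictT _ mD); apply/measurable_EFinP.
    rewrite [X in measurable_fun _ X](_ : _ = fun z => \sum_(i < n) \sum_(j < q)
      (simple_val Hs z.1 z.2 i j - c (tau z.2) (X z.1 (tau z.2)) i j) ^+ 2).
      apply: measurable_sum => i; apply: measurable_sum => j; apply: measurable_funX.
      apply: measurable_funB; [exact: measurable_simple_val_joint|exact: measurable_coef_joint].
    apply/funext => z; rewrite enorm_sqr; apply: eq_bigr => i _; apply: eq_bigr => j _.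
    by rewrite !mxE expr2.
  by move=> z; rewrite /f patchE; case: ifP => // _; rewrite lee_fin sqr_ge0.
apply/funext => w; rewrite /fubini_F [LHS]integral_mkcond; congr (integral _ _ _).
apply/funext => s; rewrite /f !patchE.
by rewrite (_ : ((w, s) \in D) = (s \in `[0, T]%classic))//; apply/idP/idP; rewrite !inE; [case|split].
Qed.

End gap.

(** * Tail of the running maximum of X *)

Section sup_tail.
Context {R : realType} d (Omega : measurableType d) (P : probability Omega R).
Context (F : R -> set (set Omega)) (T : R) (q : nat) (W : Omega -> R -> 'cV[R]_q).
Hypothesis hF : filtration F T.
Hypothesis hW : brownian_motion P F T W.
Hypothesis T0 : 0 < T.
Context (n : nat) (x : 'cV[R]_n) (X : Omega -> R -> 'cV[R]_n).
Hypothesis aX : adapted F T X.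
Context (C : R).
Hypothesis C0 : 0 <= C.
Context (S : Omega -> R -> 'M[R]_(n, q)) (I : Omega -> R -> 'cV[R]_n).
Hypothesis hI : ito_integral P F T W S I.
Hypothesis mgap : forall Hs, simple_wf F T Hs -> measurable_fun [set: Omega] (fun w =>
  (\int[lebesgue_measure]_(s in `[0%R, T]) (enorm (simple_val Hs w s - S w s) ^+ 2)%:E)%E).

Lemma cvg_in_prob0_near (Z : nat -> Omega -> \bar R) (e a : R) :
  cvg_in_prob0 P Z -> 0 < e -> 0 < a ->
  \forall n \near \oo, (P [set w | (e%:E <= Z n w)%E] < a%:E)%E.
Proof.
move=> cZ e0 a0; apply: (cZ e e0 [set y | (y < a%:E)%E]).
by apply: (@open_ereal_lt' _ 0%E a%:E); rewrite lte_fin.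
Qed.

Lemma simple_int_adapted (Hs : simple_process R Omega n q) t : simple_wf F T Hs ->
  0 <= t -> t <= T -> mx_measurable ((fun w => simple_int W Hs w t) : FT F t -> _).
Proof.
move=> wf t0 tT; have [h0 nd hT cf] := wf; have mono := nondecreasing_upto nd.
have tm i : (i <= sp_size Hs)%N -> 0 <= sp_time Hs i /\ sp_time Hs i <= T.
  move=> isz; split; first by rewrite (le_trans h0)// mono.
  by rewrite (le_trans _ hT)// mono.
apply: mx_measurable_sum => i _; have [a0 aT] := tm i (ltnW (ltn_ord i)).
have [b0 bT] := tm i.+1 (ltn_ord i).
have [tt|] := boolP (t <= sp_time Hs i).
  rewrite (_ : (fun _ => _) = fun=> 0); first exact: mx_measurable_cst.
  have tt' := le_trans tt (nd _ (ltn_ord i)).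
  by apply/funext => w; rewrite (min_idPl tt) (min_idPl tt') subrr mulmx0.
rewrite -ltNge => tt; apply: mx_measurable_mul.
  apply: (F_mono_mx hF a0 (ltW tt) tT).
  by apply/(rv_measurableP _ (F_sigma hF a0 aT)); have [] := cf i (ltn_ord i).
have mW s : 0 <= s -> mx_measurable ((fun w => W w (Num.min t s)) : FT F t -> _).
  move=> s0; have m0 : 0 <= Num.min t s by rewrite le_min t0.
  have mt : Num.min t s <= t by rewrite ge_min lexx.
  exact: (F_mono_mx hF m0 mt tT (W_measurable hF hW m0 (le_trans mt tT))).
by apply: mx_measurableB; apply: mW.
Qed.

(* The mesh T/(np ns) is coarse: it is chosen before the simple processes that
   approximate the integrand, and beta replaces the drift increments. *)
Definition trackable (eta : R) := exists np ns (E : set Omega) (gap : R),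
  [/\ (0 < np)%N, (0 < ns)%N & C * mesh T np ns <= 1 / 5] /\
  [/\ measurable E, (P (~` E) <= eta%:E)%E, 0 < gap,
   (forall w k s, E w -> (k < np * ns)%N -> tk T np ns k < s -> s < tk T np ns k.+1 ->
     enorm (S w s) <= diff_radius T X C np ns k w) &
   (forall w t, E w -> 0 <= t <= T -> exists2 k, (k <= np * ns)%N &
     enorm (X w t - X w (tk T np ns k)) <= eps)] /\
  forall Hs : simple_process R Omega n q, simple_wf F T Hs ->
  exists beta : nat -> Omega -> 'cV[R]_n,
  [/\ (forall k, (k < np * ns)%N -> mx_measurable (beta k : FT F (tk T np ns k) -> _)),
   (forall k w, (k < np * ns)%N -> enorm (beta k w) <= drift_radius T X C np ns k w) &
   (forall w, E w ->
     (forall k, (k <= np * ns)%N ->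
       enorm (simple_int W Hs w (tk T np ns k) - I w (tk T np ns k)) <= gap) ->
     forall k, (k <= np * ns)%N -> enorm (x + \sum_(j < k) beta j w +
       simple_int W Hs w (tk T np ns k) - X w (tk T np ns k)) <= eps / 2)].

(** For an arbitrary e, a simple process is chosen that is close to the integrand and whose integral
    is close to I at all grid times, outside an event of probability eta = e / 4. [core_tail] is
    applied with 2 eta, and the total error is e. *)
Lemma sup_tail (p : nat) (A : R) (B : set Omega) :
  (forall eta, 0 < eta -> trackable eta) -> 0 < A -> measurable B ->
  (forall w, B w -> exists2 t, 0 <= t <= T & 5 / 4 * A < 1 + enorm (X w t) ^+ 2) ->
  (P B <= ((A^-1 * ((1 + enorm x ^+ 2) * expR ((C + rate C p) * T))) ^+ p)%:E)%E.
Proof.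
move=> tr A0 mB HB; apply/lee_addgt0Pr => e e0.
pose eta : R := e / 4; have eta0 : 0 < eta by rewrite divr_gt0.
have [np [ns [E0 [gap [[np0 ns0 cm] [[mE0 PE0 gap0 rad osc] H]]]]]] := tr eta eta0.
set K := (np * ns)%N in rad osc H *.
have K0 : 0 < K%:R :> R by rewrite ltr0n muln_gt0 np0.
(* The value for which the K bounds of [chain_tail] sum to 2 eta. *)
pose delta : R := 2 * eta / (6 * K%:R) * (eps / (2 * K%:R)) ^+ 2.
have e20 : 0 < eps / (2 * K%:R) :> R by rewrite divr_gt0 ?eps0// mulr_gt0.
have d0 : 0 < delta.
  by rewrite mulr_gt0 ?exprn_gt0// divr_gt0// mulr_gt0.
have [mI [Hn [wfn gapcvg intcvg]]] := hI.
have tkT k : (k <= K)%N -> 0 <= tk T np ns k <= T.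
  by move=> kK; rewrite (tk0 T0 np0 ns0)/=; exact: tk_leT.
(* There are K + 2 bad events: one for the integrand and one for each of the K + 1 grid times. *)
pose c : R := eta / K.+2%:R; have c0 : 0 < c by rewrite divr_gt0.
have : \forall m \near \oo,
   (P [set w | (delta%:E <= (\int[lebesgue_measure]_(s in `[0%R, T])
      (enorm (simple_val (Hn m) w s - S w s) ^+ 2)%:E))%E] < c%:E)%E /\
   forall k, (k <= K)%N ->
     (P [set w | (gap%:E <= (enorm (simple_int W (Hn m) w (tk T np ns k) - I w (tk T np ns k)))%:E)%E] < c%:E)%E.
  apply: filterS2 (cvg_in_prob0_near gapcvg d0 c0) _; first by move=> m h1 h2; split; [exact: h1|exact: h2].
  suff ind k0 : (k0 <= K)%N -> \forall m \near \oo, forall k, (k <= k0)%N ->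
     (P [set w | (gap%:E <= (enorm (simple_int W (Hn m) w (tk T np ns k) - I w (tk T np ns k)))%:E)%E] < c%:E)%E.
    exact: ind (leqnn K).
  have one k : (k <= K)%N -> \forall m \near \oo,
     (P [set w | (gap%:E <= (enorm (simple_int W (Hn m) w (tk T np ns k) - I w (tk T np ns k)))%:E)%E] < c%:E)%E.
    move=> kK; apply: (cvg_in_prob0_near (intcvg _ _) gap0 c0).
    by rewrite in_itv /= tkT.
  elim: k0 => [|k0 IH] kK; first by apply: filterS (one 0%N kK) => m h [|//].
  apply: filterS2 (IH (ltnW kK)) (one _ kK) => m h1 h2 k.
  by rewrite leq_eqVlt => /orP[/eqP ->//|]; exact: h1.
move=> [m _ /(_ m (leqnn m))[Hgap Hint]].
move: (Hn m) (wfn m) Hgap Hint => [sz tm cf]; set Hs := SimpleProcess sz tm cf => wf Hgap Hint.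
have [beta [mbeta betaB track]] := H _ wf.
pose FF (k : nat) : set Omega := if k is k'.+1 then
   [set w | (gap <= enorm (simple_int W Hs w (tk T np ns k') - I w (tk T np ns k')))%R]
   else [set w | (delta%:E <= (\int[lebesgue_measure]_(s in `[0%R, T])
      (enorm (simple_val Hs w s - S w s) ^+ 2)%:E))%E].
have mFF k : `I_K.+2 k -> measurable (FF k).
  case: k => [|k] /= kK; rewrite -[X in measurable X]setTI.
    by apply: measurable_lee => //; exact: mgap.
  apply: measurable_fun_ler => //; apply: measurable_enorm; apply: mx_measurableB.
    have /andP[t0 tT] := tkT k kK.
    exact: (F_measurable_mx hF t0 tT (simple_int_adapted wf t0 tT)).
  move=> i j _ D mD; rewrite setTI; apply: mI => //.
  by rewrite in_itv /= tkT.
pose U := \bigcup_(k in `I_K.+2) FF k.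
have mU : measurable U by apply: fin_bigcup_measurable => //; exact: finite_II.
have PU : (P U <= eta%:E)%E.
  have cs := @content_subadditive _ _ _ P U FF K.+2 mFF mU.
  apply: le_trans (cs _) _; first by rewrite /U bigcup_mkord.
  apply: (@le_trans _ _ (\sum_(k < K.+2) c%:E)%E); last first.
    by rewrite sumEFin lee_fin sumr_const card_ord -mulr_natr /c divfK// pnatr_eq0.
  apply: lee_sum => -[[|k] kK] _ /=; first exact: ltW.
  by apply: ltW; apply: Hint.
pose E := E0 `\` U.
have mE : measurable E by exact: measurableD.
have PE : (P (~` E) <= (eta + eta)%:E)%E.
  rewrite /E setDE setCI setCK; apply: le_trans (measureU2 _ _ _) _ => //.
    exact: measurableC.
  by rewrite EFinD leeD.
rewrite (_ : e = (eta + eta) + (eta + eta)); last by rewrite /eta; field.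
rewrite addeC -EFinD.
apply: (@core_tail R d Omega P F T q W hF hW T0 n x X aX C np ns C0 np0 ns0 cm sz tm cf wf
  beta mbeta betaB A p (eta + eta) delta E B) => //.
- exact: ltW.
- rewrite -/K /delta le_eqVlt; apply/orP; left; apply/eqP.
  move: (eps / _) e20 => u u0; field; rewrite (gt_eqF K0) (gt_eqF u0) //.
- move=> w k [Ew nU] kK; apply: (@coef_error R d Omega F T q n Hs wf X C np ns T0 np0 ns0 (S w)) => //.
    by move=> s s1 s2; exact: rad.
  by rewrite leNgt; apply/negP => h; apply: nU; exists 0%N => //=; rewrite ltW.
- move=> w k [Ew nU] kK; apply: track => // j jK.
  by rewrite leNgt; apply/negP => h; apply: nU; exists j.+1 => //=; rewrite ltW.
- by move=> w t [Ew nU] tT; exact: osc.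
Qed.

End sup_tail.

(** * Drift integrals and good events *)

Lemma mdot_col (R : realType) n (u v : 'cV[R]_n) : mdot u v = \sum_(i < n) u i ord0 * v i ord0.
Proof. by apply: eq_bigr => i _; rewrite big_ord1. Qed.

Section vector_integral.
Context {R : realType} (T : R) (n : nat) (B : R -> 'cV[R]_n).
Local Notation leb := (@lebesgue_measure R).
Hypothesis mB : forall i, measurable_fun `[0, T] (fun s => B s i ord0).
Context (MB : R).
Hypothesis MBP : forall s, 0 <= s <= T -> enorm (B s) <= MB.

Definition vint (t : R) : 'cV[R]_n := \col_i \int[leb]_(s in `[0, t]) B s i ord0.

Lemma integrable_bounded (D : set R) (f : R -> R) M : measurable D -> (leb D < +oo)%E ->
  measurable_fun D f -> (forall s, D s -> `|f s| <= M) -> leb.-integrable D (EFin \o f).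
Proof.
move=> mD fD mf fM; apply: measurable_bounded_integrable => //.
exists M; split; first exact: num_real.
by move=> y My s Ds; apply: (le_trans (fM s Ds)); exact: ltW.
Qed.

(* The endpoints are excluded because the integrand of the Euler scheme jumps there. *)
Lemma vint_increment t t' c M : 0 <= t -> t <= t' -> t' <= T -> 0 <= M ->
  (forall s, t < s -> s < t' -> enorm (B s - c) <= M) ->
  enorm (vint t' - vint t - (t' - t) *: c) <= M * (t' - t).
Proof.
move=> t0 tt t'T M0 BM; set v := vint t' - _ - _.
have tt0 : 0 <= t' - t by rewrite subr_ge0.
have intB i : leb.-integrable `[0, t'] (EFin \o (fun s => B s i ord0)).
  apply: (@integrable_bounded _ _ MB) => //.
  - by rewrite lebesgue_measure_itv /=; case: ifP => _; rewrite ?ltry.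
  - apply: (measurable_funS _ _ (mB i)) => // s; rewrite /= !in_itv /= => /andP[-> h].
    by rewrite (le_trans h).
  - move=> s; rewrite /= in_itv /= => /andP[h1 h2].
    by rewrite (le_trans (normr_le_enorm _ _ _))// MBP// h1 (le_trans h2).
have intB' i : leb.-integrable `]t, t'[ (EFin \o (fun s => B s i ord0)).
  apply: integrableS (intB i) => // s; rewrite /= !in_itv /= => /andP[h1 h2].
  by rewrite (le_trans t0 (ltW h1)) ltW.
have muo : fine (leb `]t, t'[) = t' - t.
  rewrite lebesgue_measure_itv /= lte_fin; move: tt; rewrite le_eqVlt.
  by move=> /orP[/eqP ->|->] //; rewrite ltxx subrr.
have finO : (leb `]t, t'[ < +oo)%E.
  by rewrite lebesgue_measure_itv /=; case: ifP => _; rewrite ?ltry.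
have intc r : leb.-integrable `]t, t'[ (EFin \o (fun=> r)).
  exact: (@integrable_bounded _ _ `|r|).
have intD i : leb.-integrable `]t, t'[ (EFin \o (fun s => (B s - c) i ord0)).
  apply: (@integrable_bounded _ _ M) => //.
  - rewrite [X in measurable_fun _ X](_ : _ = fun s => B s i ord0 - c i ord0).
      apply: measurable_funB => //; apply: (measurable_funS _ _ (mB i)) => // s.
      rewrite /= !in_itv /= => /andP[h1 h2].
      by rewrite (le_trans t0 (ltW h1)) (le_trans (ltW h2)).
    by apply/funext => s; rewrite !mxE.
  - move=> s; rewrite /= in_itv /= => /andP[h1 h2].
    by rewrite (le_trans (normr_le_enorm _ _ _))// BM.
have vE i : v i ord0 = \int[leb]_(s in `]t, t'[) ((B s - c) i ord0).
  have -> : \int[leb]_(s in `]t, t'[) ((B s - c) i ord0) =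
      \int[leb]_(s in `]t, t'[) (B s i ord0 - c i ord0).
    by apply: eq_Rintegral => s _; rewrite !mxE.
  rewrite RintegralB// Rintegral_cst// muo !mxE; congr (_ - _); last by rewrite mulrC.
  rewrite (@Rintegral_itvB _ (fun s => B s i ord0) (BLeft 0) (BRight t') t)//.
    by rewrite -Rintegral_itv_bndo_bndc//; exact: intB'.
(* Pairing the increment with itself passes the Euclidean norm under the coordinatewise integral:
   |v|^2 is at most |v| M (t' - t). *)
have v2 : enorm v ^+ 2 = \int[leb]_(s in `]t, t'[) (\sum_(i < n) v i ord0 * (B s - c) i ord0).
  rewrite enorm_sqr mdot_col; under eq_bigr do rewrite {2}vE.
  have aux : forall r : seq 'I_n, \sum_(i <- r) v i ord0 * \int[leb]_(s in `]t, t'[) ((B s - c) i ord0) =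
      \int[leb]_(s in `]t, t'[) (\sum_(i <- r) v i ord0 * (B s - c) i ord0) /\
      leb.-integrable `]t, t'[ (EFin \o (fun s => \sum_(i <- r) v i ord0 * (B s - c) i ord0)).
    elim=> [|i r [IH1 IH2]].
      rewrite big_nil; split.
        have -> : \int[leb]_(s in `]t, t'[)
            (\sum_(i <- [::]) v i ord0 * (B s - c) i ord0) = \int[leb]_(s in `]t, t'[) 0.
          by apply: eq_Rintegral => s _; rewrite big_nil.
        by rewrite Rintegral_cst// mul0r.
      by apply: eq_integrable (intc 0) => // s _; rewrite /= big_nil.
    have iZ : leb.-integrable `]t, t'[ (EFin \o (fun s => v i ord0 * (B s - c) i ord0)).
      by apply: eq_integrable (integrableZl _ (v i ord0) (intD i)).
    split.
      rewrite big_cons IH1 -RintegralZl// -RintegralD//.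
      by apply: eq_Rintegral => s _; rewrite big_cons.
    apply: eq_integrable (integrableD _ iZ IH2) => // s _.
    by rewrite /= big_cons EFinD.
  by have [] := aux (index_enum 'I_n).
have : enorm v ^+ 2 <= enorm v * (M * (t' - t)).
  rewrite v2 mulrA -muo -Rintegral_cst//; apply: le_Rintegral => //.
    have iv : measurable_fun `]t, t'[ (fun s => \sum_(i < n) v i ord0 * (B s - c) i ord0).
      apply: measurable_sum => i; apply: measurable_funM => //.
      by have /measurable_int/measurable_EFinP := intD i.
    apply: (@integrable_bounded _ _ (enorm v * M)) => // s; rewrite /= in_itv /= => /andP[h1 h2].
    have := le_mdot_enorm v (B s - c); rewrite mdot_col.
    by move=> /le_trans; apply; rewrite ler_wpM2l ?enorm_ge0// BM.
  move=> s; rewrite /= in_itv /= => /andP[h1 h2].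
  have := le_mdot_enorm v (B s - c); rewrite mdot_col.
  move=> /(le_trans (ler_norm _))/le_trans; apply.
  by rewrite ler_wpM2l ?enorm_ge0// BM.
have := enorm_ge0 v; rewrite le_eqVlt => /orP[/eqP <- _|v0]; first by rewrite mulr_ge0.
by rewrite expr2 ler_pM2l.
Qed.

Lemma vint0 : vint 0 = 0.
Proof. by apply/matrixP => i j; rewrite !mxE set_itv1 Rintegral_set1. Qed.

End vector_integral.

Lemma countable_bigcap_measurable d (S : measurableType d) (I : countType) (D : set I)
    (G : I -> set S) : (forall i, D i -> measurable (G i)) -> measurable (\bigcap_(i in D) G i).
Proof.
move=> mG; rewrite -[X in measurable X]setCK setC_bigcap bigcup_mkcond; apply: measurableC.
apply: countable_bigcupT_measurable; first exact: countableP.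
by move=> i; case: ifPn => // /set_mem Di; apply: measurableC; exact: mG.
Qed.

Section good_events.
Context {R : realType} d (Omega : measurableType d) (P : probability Omega R).
Context (T : R) (T0 : 0 < T).

Lemma increasing_good_event (G : nat -> set Omega) (eta : R) :
  (forall n, measurable (G n)) -> nondecreasing_seq G -> \bigcup_n G n = setT -> 0 < eta ->
  exists n, (P (~` G n) <= eta%:E)%E.
Proof.
move=> mG ndG UG e0; have cG : P (G n) @[n --> \oo] --> 1%E.
  rewrite -(probability_setT P) -UG; apply: nondecreasing_cvg_mu => //.
  by rewrite UG.
have [|n _ /(_ n (leqnn n)) /= H] := cG [set y | ((1 - eta)%:E < y)%E].
  by apply: (@open_ereal_gt' _ 1%E); rewrite lte_fin ltrBlDr ltrDl.
exists n; rewrite probability_setC; last exact: mG.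
have fG : P (G n) \is a fin_num by exact: fin_num_measure.
move: H; rewrite -(fineK fG) -EFinB lte_fin lee_fin; lra.
Qed.

Lemma ae_event (Q : nat -> Omega -> Prop) : (forall k, {ae P, forall w, Q k w}) ->
  exists E, [/\ measurable E, P (~` E) = 0%E & forall w k, E w -> Q k w].
Proof.
move=> /ae_foralln [N [mN PN NQ]]; exists (~` N); split.
- exact: measurableC.
- by rewrite setCK.
- by move=> w k nN; apply: contrapT => h; apply: nN; apply: NQ => /(_ k).
Qed.

Lemma rat_near n (g : R -> 'cV[R]_n) t e : continuous_path T g -> 0 <= t <= T -> 0 < e ->
  exists r : rat, `|clip T (ratr r) - t| < e /\ enorm (g (clip T (ratr r)) - g t) < e.
Proof.
move=> cg tT e0; have [de de0 H] := continuous_path_eps cg tT e0.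
have m0 : 0 < Num.min de e by rewrite lt_min de0.
have /rat_in_itvoo[r] : t < t + Num.min de e by rewrite ltrDl.
rewrite in_itv /= => /andP[r1 r2]; exists r.
have : `|clip T (ratr r) - t| < Num.min de e.
  rewrite -{1}(clip_id tT) (le_lt_trans (clip_dist (ltW T0) _ _))//.
  by rewrite gtr0_norm ?subr_gt0// ltrBlDl.
by rewrite lt_min => /andP[h1 h2]; split => //; apply: H => //; exact: (clip_in (ltW T0) _).
Qed.

Context n (X : Omega -> R -> 'cV[R]_n).
Hypothesis Xc : forall w, continuous_path T (X w).
Hypothesis Xm : forall t, 0 <= t <= T -> mx_measurable (fun w => X w t).

Let mXclip (r : R) : mx_measurable (fun w => X w (clip T r)).
Proof. by apply: Xm; exact: (clip_in (ltW T0) _). Qed.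

(** Rational times make the event measurable, and continuity extends the bound to all times. The
    events increase to the whole space because each path is bounded. *)
Lemma bounded_event eta : 0 < eta -> exists (M : nat) E,
  [/\ measurable E, (P (~` E) <= eta%:E)%E &
    forall w t, E w -> 0 <= t <= T -> enorm (X w t) <= M%:R].
Proof.
move=> e0; pose G (m : nat) : set Omega :=
  \bigcap_(r in [set: rat]) [set w | enorm (X w (clip T (ratr r))) <= m%:R].
have mG m : measurable (G m).
  apply: countable_bigcap_measurable => r _.
  rewrite -[X in measurable X]setTI; apply: measurable_fun_ler => //.
  exact: measurable_enorm.
have [||M PM] := increasing_good_event (eta := eta) mG _ _ e0.
- move=> i j ij; apply/subsetPset => w Gw r _ /=.
  by rewrite (le_trans (Gw r I))// ler_nat.
- rewrite -subTset => w _; have [M MP] := continuous_path_bounded (ltW T0) (@Xc w).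
  by exists M => // r _ /=; apply: MP; exact: (clip_in (ltW T0) _).
exists M, (G M); split => // w t GM tT; apply/ler_addgt0Pr => e e0'.
have [r [_ h]] := rat_near (@Xc w) tT e0'.
have := GM r I => /= h2; have := ler_enorm_dist (X w t) (X w (clip T (ratr r))).
by rewrite enorm_distC; lra.
Qed.

Lemma oscillation_event eta e : 0 < eta -> 0 < e -> exists (m : nat) E,
  [/\ measurable E, (P (~` E) <= eta%:E)%E &
    forall w s t, E w -> 0 <= s <= T -> 0 <= t <= T -> `|s - t| < m.+1%:R^-1 ->
      enorm (X w s - X w t) <= e].
Proof.
move=> eta0 e0; pose G (m : nat) : set Omega :=
  \bigcap_(r in [set rr : rat * rat | `|clip T (ratr rr.1) - clip T (ratr rr.2)| < m.+1%:R^-1])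
    [set w | enorm (X w (clip T (ratr r.1)) - X w (clip T (ratr r.2))) <= e].
have mG m : measurable (G m).
  apply: countable_bigcap_measurable => r _.
  rewrite -[X in measurable X]setTI; apply: measurable_fun_ler => //.
  by apply: measurable_enorm; exact: mx_measurableB.
have [||m PM] := increasing_good_event (eta := eta) mG _ _ eta0.
- move=> i j ij; apply/subsetPset => w Gw r /= h; apply: Gw => /=.
  by rewrite (lt_le_trans h)// lef_pV2 ?posrE// ler_nat.
- rewrite -subTset => w _; have [de de0 H] := continuous_path_unif (@Xc w) e0.
  exists (Num.truncn de^-1) => // r /= h; apply: ltW; apply: H; try exact: (clip_in (ltW T0) _).
  rewrite (lt_le_trans h)// -[leRHS]invrK lef_pV2 ?posrE ?invr_gt0//.
  by rewrite ltW// truncnS_gt.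
exists m, (G m); split => // w s t Gm sT tT st.
(* The strict inequality between s and t leaves room for moving both to rational times. *)
apply/ler_addgt0Pr => e' e'0; pose z := Num.min (e' / 2) ((m.+1%:R^-1 - `|s - t|) / 2).
have z0 : 0 < z by rewrite lt_min !divr_gt0// subr_gt0.
have z1 : z <= (m.+1%:R^-1 - `|s - t|) / 2 by rewrite ge_min lexx orbT.
have z2 : z <= e' / 2 by rewrite ge_min lexx.
clearbody z; have [r1 [h1 h1']] := rat_near (@Xc w) sT z0; have [r2 [h2 h2']] := rat_near (@Xc w) tT z0.
have rr : `|clip T (ratr r1) - clip T (ratr r2)| < m.+1%:R^-1.
  have := ler_distD s (clip T (ratr r1)) (clip T (ratr r2)).
  by have := ler_distD t s (clip T (ratr r2)); rewrite (distrC t); move: st h1 h2 z1; set a := _^-1; lra.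
have := Gm (r1, r2) rr => /= h.
have := ler_enormB (X w s) (X w (clip T (ratr r1))) (X w t).
have := ler_enormB (X w (clip T (ratr r1))) (X w (clip T (ratr r2))) (X w t).
by rewrite (enorm_distC (X w s) (X w (clip T (ratr r1)))); lra.
Qed.

End good_events.

Section grid_floor.
Context {R : realType} (T : R) (T0 : 0 < T) (N : nat) (N0 : (0 < N)%N).
Local Notation phi := (grid_floor (T / N%:R)).

Let D0 : 0 < T / N%:R. Proof. by rewrite divr_gt0// ltr0n. Qed.

Lemma grid_floor_in s : 0 <= s <= T -> 0 <= phi s <= T.
Proof.
move=> /andP[s0 sT]; rewrite /grid_floor mulr_ge0 ?(ltW D0)//=.
  rewrite (le_trans _ sT)// -ler_pdivlMr//.
  by have /andP[] := floor_itv (s / (T / N%:R)).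
by rewrite ler0z floor_ge0 divr_ge0// ltW.
Qed.

Lemma measurable_grid_partition (g : R -> R) (D : set R) : measurable D ->
  measurable_fun D (fun s => g (phi s)).
Proof.
move=> mD; apply: (@measurable_fun_partition R _ (measurableTypeR R) D int
  (fun s => Num.floor (s / (T / N%:R))) (fun k _ => g (k%:~R * (T / N%:R)))) => //.
by move=> k; apply: measurable_floor_set => //; exact: measurable_funM.
Qed.

(** With np = N, the periods of the grid are exactly the steps of the Euler scheme. *)
Lemma grid_floor_tk ns k s : (0 < ns)%N -> tk T N ns k <= s -> s < tk T N ns k.+1 ->
  phi s = tk T N ns (period_start ns k).
Proof.
move=> ns0 h1 h2; have n0 : 0 < ns%:R :> R by rewrite ltr0n.
have NN : 0 < N%:R :> R by rewrite ltr0n.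
have m0 := mesh0 T0 N0 ns0.
have e : mesh T N ns = (T / N%:R) / ns%:R.
  by rewrite /mesh natrM; field; rewrite !gt_eqF.
have tkE j : tk T N ns j = j%:R / ns%:R * (T / N%:R) by rewrite /tk e mulrCA mulrC.
rewrite /grid_floor (_ : Num.floor _ = (k %/ ns)%N); last first.
  apply/eqP; rewrite floor_eq; apply/andP; split.
    rewrite ler_pdivlMr//; apply: le_trans h1; rewrite tkE ler_wpM2r ?(ltW D0)//.
    by rewrite ler_pdivlMr// -pmulrn -natrM ler_nat leq_trunc_div.
  rewrite ltr_pdivrMr//; apply: (lt_le_trans h2); rewrite tkE ler_wpM2r ?(ltW D0)//.
  by rewrite ler_pdivrMr// intrD -pmulrn natr1 -natrM ler_nat ltn_ceil.
by rewrite tkE /period_start natrM -pmulrn mulfK// gt_eqF.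
Qed.

End grid_floor.

(** * Tail of the Euler scheme and of the diffusion *)

Lemma enorm_eq0 (R : realType) m n (A : 'M[R]_(m, n)) : (enorm A == 0) = (A == 0).
Proof.
apply/eqP/eqP => [A0|->]; last exact: enorm0.
apply/matrixP => i j; rewrite mxE; apply/eqP; rewrite -normr_eq0 eq_le normr_ge0 andbT -A0.
exact: normr_le_enorm.
Qed.

Lemma setCI_le d (Omega : measurableType d) (R : realType) (P : probability Omega R)
    (E1 E2 : set Omega) (a b : R) : measurable E1 -> measurable E2 ->
  (P (~` E1) <= a%:E)%E -> (P (~` E2) <= b%:E)%E -> (P (~` (E1 `&` E2)) <= (a + b)%:E)%E.
Proof.
move=> m1 m2 h1 h2; rewrite setCI EFinD; apply: le_trans (measureU2 _ _ _) _ => //.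
- exact: measurableC.
- exact: measurableC.
- exact: leeD.
Qed.

Lemma mx_measurable_comp d (S : measurableType d) (R : realType) n m k
    (f : 'cV[R]_n -> 'M[R]_(m, k)) (Y : S -> 'cV[R]_n) :
  continuous f -> mx_measurable Y -> mx_measurable (fun w => f (Y w)).
Proof.
move=> cf mY i j; apply: (@measurable_caratheodory R _ S setT n (fun _ y => f y i j) Y) => //.
- by move=> s y e _ e0; exact: mx_continuous_eps.
Qed.

Section trackable.
Context {R : realType} d (Omega : measurableType d) (P : probability Omega R).
Context (F : R -> set (set Omega)) (T : R) (q : nat) (W : Omega -> R -> 'cV[R]_q).
Hypothesis hF : filtration F T.
Hypothesis hW : brownian_motion P F T W.
Hypothesis T0 : 0 < T.
Context (n : nat) (x : 'cV[R]_n) (X : Omega -> R -> 'cV[R]_n).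
Hypothesis aX : adapted F T X.
Hypothesis Xc : forall w, continuous_path T (X w).
Context (C : R).
Hypothesis C0 : 0 <= C.
Context (b : R -> 'cV[R]_n -> 'cV[R]_n) (sigma : R -> 'cV[R]_n -> 'M[R]_(n, q)).
Hypothesis b_cont : forall t, 0 <= t <= T -> continuous (b t).
Hypothesis b_growth : forall t y, 0 <= t <= T -> enorm (b t y) <= C * (1 + enorm y).
Hypothesis sigma_growth : forall t y, 0 <= t <= T ->
  enorm (sigma t y) ^+ 2 <= C * (1 + enorm y ^+ 2).
Context (tau : R -> R).
Hypothesis mtau : measurable_fun `[0, T] tau.
Hypothesis tauT : forall s, 0 <= s <= T -> 0 <= tau s <= T.
Hypothesis mb : forall y i, measurable_fun `[0, T] (fun s => b (tau s) y i ord0).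
Let S w s := sigma (tau s) (X w (tau s)).
Let B w s := b (tau s) (X w (tau s)).
Context (I : Omega -> R -> 'cV[R]_n).
Hypothesis hX : forall t, 0 <= t <= T -> {ae P, forall w, X w t = x + vint (B w) t + I w t}.

Lemma X_measurable_all t : 0 <= t <= T -> mx_measurable (fun w => X w t).
Proof.
by move=> /andP[t0 tT]; exact: (F_measurable_mx hF t0 tT (X_measurable hF aX t0 tT)).
Qed.

Let mB w i : measurable_fun `[0, T] (fun s => B w s i ord0).
Proof.
have := @measurable_joint_coef R T (ltW T0) _ (measurableTypeR R) n (fun _ => X w)
  (fun _ => @Xc w) _ _ (measurableTypeR R) `[0, T]%classic _ id tau _ mtau _
  (fun t y => b t y i ord0); apply => //.
- by move=> t _ u v; exact: measurable_cst.
- by move=> y; exact: mb.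
- by move=> t y e tT e0; apply: mx_continuous_eps => //; exact: b_cont.
Qed.

Let bndB w : exists MB, forall s, 0 <= s <= T -> enorm (B w s) <= MB.
Proof.
have [M MP] := continuous_path_bounded (ltW T0) (@Xc w); exists (C * (1 + M%:R)) => s sT.
rewrite (le_trans (b_growth _ (tauT sT)))// ler_wpM2l// lerD2l; exact: MP (tauT sT).
Qed.

Let vincr w t t' c M : 0 <= t -> t <= t' -> t' <= T -> 0 <= M ->
  (forall s, t < s -> s < t' -> enorm (B w s - c) <= M) ->
  enorm (vint (B w) t' - vint (B w) t - (t' - t) *: c) <= M * (t' - t).
Proof. by have [MB MBP] := bndB w; exact: (vint_increment (mB w) MBP). Qed.

(** The equation holds almost surely at each fixed time; finitely many grid times share one event of
    full probability. *)
Let eqn_event np ns : (0 < np)%N -> (0 < ns)%N ->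
  exists E, [/\ measurable E, P (~` E) = 0%E & forall w k, E w -> (k <= np * ns)%N ->
    X w (tk T np ns k) = x + vint (B w) (tk T np ns k) + I w (tk T np ns k)].
Proof.
move=> np0 ns0; have [|E [mE PE H]] := @ae_event R _ _ P (fun k w => (k <= np * ns)%N ->
    X w (tk T np ns k) = x + vint (B w) (tk T np ns k) + I w (tk T np ns k)); last by exists E.
move=> k; have [kK|kK] := boolP (k <= np * ns)%N; last by apply: aeW => w h; case/negP: kK.
have : 0 <= tk T np ns k <= T by rewrite (tk0 T0 np0 ns0)/=; exact: tk_leT.
by move/hX; apply: filterS => w ->.
Qed.

Let floor_tk np ns t : (0 < np)%N -> (0 < ns)%N -> 0 <= t <= T ->
  exists2 k, (k <= np * ns)%N & tk T np ns k <= t < tk T np ns k.+1.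
Proof.
move=> np0 ns0 /andP[t0 tT]; have m0 := mesh0 T0 np0 ns0.
exists (Num.truncn (t / mesh T np ns)).
  rewrite -ltnS -(ltr_nat R) (le_lt_trans (_ : _ <= t / mesh T np ns))//.
    by have /andP[] := truncn_itv (divr_ge0 t0 (ltW m0)).
  by rewrite ltr_pdivrMr// (le_lt_trans tT)// -[ltLHS](tkK T np0 ns0) /tk ltr_pM2r// ltr_nat ltnSn.
have /andP[h1 h2] := truncn_itv (divr_ge0 t0 (ltW m0)).
by rewrite /tk -(ler_pdivlMr _ _ m0) h1 -(ltr_pdivrMr _ _ m0).
Qed.

Let mesh_small (np m : nat) : (0 < np)%N -> exists ns, [/\ (0 < ns)%N,
  C * mesh T np ns <= 1 / 5 & mesh T np ns < m.+1%:R^-1].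
Proof.
move=> np0; have N0 : 1 <= np%:R :> R by rewrite ler1n.
pose z := (5 * C * T + m.+1%:R * T); pose ns := (Num.truncn z).+1.
have zns : z < ns%:R by exact: truncnS_gt.
have ns0 : 0 < ns%:R :> R by [].
have nsK : ns%:R <= (np * ns)%:R :> R by rewrite natrM ler_peMl// ltW.
have CT : 0 <= C * T by rewrite mulr_ge0// ltW.
have mT : 0 < m.+1%:R * T by rewrite mulr_gt0.
have K0 : 0 < (np * ns)%:R :> R by exact: lt_le_trans nsK.
exists ns; split => //; rewrite /mesh.
  by rewrite mulrA ler_pdivrMr//; move: zns; rewrite /z; lra.
by rewrite ltr_pdivrMr// -ltr_pdivrMl ?invr_gt0// invrK; move: zns; rewrite /z; lra.
Qed.

Section euler.
Context (N : nat) (N0 : (0 < N)%N).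
Hypothesis tauE : tau = grid_floor (T / N%:R).

(** The drift of the scheme is constant on each open cell, so [beta] reproduces its integral
    exactly. Only the error of the stochastic integral remains, hence the gap eps / 2. *)
Lemma euler_trackable eta : 0 < eta -> trackable P F T W x X C S I eta.
Proof.
move=> eta0; have [m [E1 [mE1 PE1 H1]]] := oscillation_event P T0 Xc X_measurable_all eta0 (@eps0 R).
have [ns [ns0 cm mm]] := mesh_small m N0; have m0 := mesh0 T0 N0 ns0.
have [E2 [mE2 PE2 H2]] := eqn_event N0 ns0.
have psT k : (k <= N * ns)%N -> 0 <= tk T N ns (period_start ns k) <= T.
  move=> kK; rewrite (tk0 T0 N0 ns0)/=; apply: tk_leT => //.
  by rewrite (leq_trans (period_start_le _ _)).
exists N, ns, (E1 `&` E2), (eps / 2); split=> //; split; first split.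
- exact: measurableI.
- by rewrite -[eta]addr0; apply: setCI_le => //; rewrite PE2.
- by rewrite divr_gt0// eps0.
- move=> w k s _ kK s1 s2; rewrite -(@ler_pXn2r _ 2) ?nnegrE ?enorm_ge0 ?diff_radius_ge0//.
  rewrite diff_radius_sqr// /S tauE (grid_floor_tk T0 N0 ns0 (ltW s1) s2).
  rewrite (le_trans (sigma_growth _ (psT k (ltnW kK))))// ler_wpM2l// lerD2l.
  by rewrite lerXn2r ?nnegrE ?addr_ge0 ?enorm_ge0 ?(ltW (@eps0 R))// lerDl ltW// eps0.
- move=> w t [Ew _] tT; have [k kK /andP[k1 k2]] := floor_tk N0 ns0 tT; exists k => //.
  apply: H1 => //; first by rewrite (tk0 T0 N0 ns0)/=; exact: tk_leT.
  by apply: le_lt_trans mm; rewrite ger0_norm ?subr_ge0//; move: k2; rewrite tkS; lra.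
move=> Hs wf; pose beta k w := mesh T N ns *:
  b (tk T N ns (period_start ns k)) (X w (tk T N ns (period_start ns k))).
exists beta; split.
- move=> k kK; apply: mx_measurableZ => //; apply: mx_measurable_comp.
    by apply: b_cont; exact: psT (ltnW kK).
  exact: (X_measurable_tk hF T0 aX N0 ns0 (period_start_le ns k) (ltnW kK)).
- move=> k w kK; rewrite /beta enormZ (ger0_norm (ltW m0)) /drift_radius.
  rewrite (mulrC C) -[leRHS]mulrA ler_wpM2l// ?(ltW m0)//.
  rewrite (le_trans (b_growth _ (psT k (ltnW kK))))// ler_wpM2l//.
  by have := @eps0 R; lra.
move=> w [_ Ew] Hgap k kK.
have betaE j : (j < N * ns)%N -> beta j w = vint (B w) (tk T N ns j.+1) - vint (B w) (tk T N ns j).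
  move=> jK; apply/eqP; rewrite eq_sym -subr_eq0.
  have tt : tk T N ns j.+1 - tk T N ns j = mesh T N ns by rewrite tkS addrC addKr.
  have tjj : tk T N ns j <= tk T N ns j.+1 by rewrite -subr_ge0 tt ltW.
  have h := vincr (w := w) (tk0 T0 N0 ns0 j) tjj (tk_leT T0 N0 ns0 jK) (lexx 0)
    (c := b (tk T N ns (period_start ns j)) (X w (tk T N ns (period_start ns j)))) _.
  rewrite tt mul0r in h; rewrite -enorm_eq0 eq_le enorm_ge0 andbT; apply: h.
  move=> s s1 s2; rewrite /B tauE (grid_floor_tk T0 N0 ns0 (ltW s1) s2).
  by rewrite subrr enorm0.
have -> : \sum_(j < k) beta j w = vint (B w) (tk T N ns k).
  elim: k kK => [|k IH] kK; first by rewrite big_ord0 /tk mul0r vint0.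
  by rewrite big_ord_recr /= IH ?(ltnW kK)// betaE// addrC subrK.
rewrite (H2 w k Ew kK) (_ : _ - _ = simple_int W Hs w (tk T N ns k) - I w (tk T N ns k)).
  exact: Hgap.
by rewrite opprD addrACA subrr add0r.
Qed.

End euler.
Section diffusion.
Hypothesis tauE : tau = id.

(** The obstacle is that the drift increment over a cell is not known at its start. The chain
    therefore uses the increment of the preceding cell, a delay that costs a single drift increment
    in total. Half of the allowed eps / 2 goes to this delay, half to the approximation errors. *)
Lemma diffusion_trackable eta : 0 < eta -> trackable P F T W x X C S I eta.
Proof.
move=> eta0; have e2 : 0 < eta / 2 by rewrite divr_gt0.
have ep := @eps0 R.
have [m [E1 [mE1 PE1 H1]]] := oscillation_event P T0 Xc X_measurable_all e2 ep.
have [M [E3 [mE3 PE3 H3]]] := bounded_event P T0 Xc X_measurable_all e2.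
pose CM : R := C * (1 + M%:R); have CM0 : 0 <= CM by rewrite mulr_ge0// addr_ge0.
(* The mesh must be below the modulus of oscillation and so small that a drift increment is at most
   eps / 4. *)
pose m' := maxn m (Num.truncn (CM * (4 / eps))).
(* [mesh_small] refines one period into many cells; as the mesh depends only on the product, the
   result is read as many periods of one cell. *)
have [np [np0]] := mesh_small m' (leqnn 1); rewrite /mesh mul1n -[np]muln1.
rewrite -/(mesh T np 1) => cm mm.
have mm1 : mesh T np 1 < m.+1%:R^-1.
  by rewrite (lt_le_trans mm)// lef_pV2 ?posrE// ler_nat ltnS leq_maxl.
have m0 := mesh0 T0 np0 (leqnn 1).
have CMm : CM * mesh T np 1 <= eps / 4.
  have h : CM * (4 / eps) < m'.+1%:R.
    by rewrite (lt_le_trans (truncnS_gt _))// ler_nat ltnS leq_maxr.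
  have := ltW mm; rewrite -div1r ler_pdivlMr// => h2.
  have e4 : 0 < 4 / eps :> R by rewrite divr_gt0.
  rewrite -[leRHS]mul1r -ler_pdivrMr ?divr_gt0//.
  rewrite (_ : _ / (eps / 4) = CM * (4 / eps) * mesh T np 1); last by field; rewrite gt_eqF.
  by apply: le_trans h2; rewrite mulrC ler_wpM2l ?(ltW m0)// ltW.
have [E2 [mE2 PE2 H2]] := eqn_event np0 (leqnn 1).
have ps k : period_start 1 k = k by rewrite /period_start divn1 muln1.
have ttS k : tk T np 1 k.+1 - tk T np 1 k = mesh T np 1 by rewrite tkS addrC addKr.
have tle k : tk T np 1 k <= tk T np 1 k.+1 by rewrite -subr_ge0 ttS ltW.
pose K := (np * 1)%N; have K0 : 0 < K%:R :> R by rewrite ltr0n /K muln1.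
have tkT k : (k <= K)%N -> 0 <= tk T np 1 k <= T.
  by move=> kK; rewrite (tk0 T0 np0 (leqnn 1))/=; exact: tk_leT.
have osc w s k : E1 w -> (k <= K)%N -> 0 <= s <= T -> `|s - tk T np 1 k| <= mesh T np 1 ->
    enorm (X w s - X w (tk T np 1 k)) <= eps.
  move=> Ew kK sT h; apply: H1 => //; first exact: tkT.
  exact: le_lt_trans mm1.
(* Each cell contributes at most 4 gap and the final time one more: 4 K gap + gap <= 5 K gap = eps /
   4. *)
exists np, 1%N, ((E1 `&` E3) `&` E2), (eps / (20 * K%:R)); split=> //; split; first split.
- by apply: measurableI => //; exact: measurableI.
- rewrite -[eta]addr0; apply: setCI_le => //; first exact: measurableI.
    by rewrite [eta]splitr; exact: setCI_le.
  by rewrite PE2.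
- by rewrite divr_gt0// mulr_gt0.
- move=> w k s [[Ew _] _] kK s1 s2.
  have sT : 0 <= s <= T.
    rewrite (le_trans _ (ltW s1)) ?(tk0 T0 np0)//= (le_trans (ltW s2))//.
    by have /andP[] := tkT _ kK.
  rewrite -(@ler_pXn2r _ 2) ?nnegrE ?enorm_ge0 ?diff_radius_ge0//.
  rewrite diff_radius_sqr// /S tauE ps (le_trans (sigma_growth _ sT))// ler_wpM2l// lerD2l.
  rewrite lerXn2r ?nnegrE ?addr_ge0 ?enorm_ge0 ?(ltW ep)//.
  rewrite (le_trans (ler_enorm_dist _ (X w (tk T np 1 k))))// lerD2l osc//; first exact: ltnW.
  by rewrite gtr0_norm ?subr_gt0//; have := ttS k; lra.
- move=> w t [[Ew _] _] tT; have [k kK /andP[k1 k2]] := floor_tk np0 (leqnn 1) tT.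
  exists k => //; apply: osc => //.
  by rewrite ger0_norm ?subr_ge0//; have := ttS k; lra.
move=> Hs wf; set gap : R := eps / (20 * K%:R).
have gap0 : 0 < gap by rewrite divr_gt0// mulr_gt0.
(* The drift increments are recovered as increments of X minus the simple integral: both are
   adapted, and on the good event the result differs from the true increment by at most 2 gap. *)
pose U k w := X w (tk T np 1 k) - simple_int W Hs w (tk T np 1 k).
pose beta k w := if k is k'.+1 then
  ball_proj (drift_radius T X C np 1 k w) (U k w - U k' w) else 0.
have mU j k : (j <= k)%N -> (k <= K)%N -> mx_measurable (U j : FT F (tk T np 1 k) -> _).
  move=> jk kK; apply: mx_measurableB.
    exact: (X_measurable_tk hF T0 aX np0 (leqnn 1) jk kK).
  have /andP[k0 kT] := tkT k kK; have j0 := tk0 T0 np0 (leqnn 1) j.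
  have jk' := tk_le T0 np0 (leqnn 1) jk.
  exact: (F_mono_mx hF j0 jk' kT (simple_int_adapted hF hW wf j0 (le_trans jk' kT))).
have rad0 k w : 0 <= drift_radius T X C np 1 k w.
  apply: mulr_ge0; first exact: mulr_ge0 C0 (ltW m0).
  by rewrite !addr_ge0 ?enorm_ge0 ?(ltW ep).
exists beta; split.
- move=> [|k] kK; first exact: mx_measurable_cst.
  apply: mx_measurable_ball_proj; last by apply: mx_measurableB; apply: mU => //; exact: ltnW.
  apply: measurable_funM => //; apply: measurable_funD => //; apply: measurable_funD => //.
  apply: measurable_enorm; rewrite ps.
  exact: (X_measurable_tk hF T0 aX np0 (leqnn 1) (leqnn _) (ltnW kK)).
- by move=> [|k] w kK; rewrite /beta ?enorm0// enorm_ball_proj.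
move=> w [[Ew1 Ew3] Ew2] Hgap k kK.
pose v k := vint (B w) (tk T np 1 k.+1) - vint (B w) (tk T np 1 k).
have XB s : 0 <= s <= T -> enorm (B w s) <= C * (1 + enorm (X w s)).
  by move=> sT; rewrite /B tauE; exact: b_growth.
have sin j s : (j < K)%N -> tk T np 1 j < s -> s < tk T np 1 j.+1 -> 0 <= s <= T.
  move=> jK s1 s2; have /andP[a _] := tkT _ (ltnW jK); have /andP[_ a'] := tkT _ jK.
  by rewrite (le_trans a (ltW s1)) (le_trans (ltW s2)).
have vM j : (j < K)%N -> enorm (v j) <= eps / 4.
  move=> jK; have /andP[j0 _] := tkT _ (ltnW jK); have /andP[_ jT] := tkT _ jK.
  have := vincr (w := w) j0 (tle j) jT CM0 (c := 0); rewrite scaler0 subr0 => h.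
  rewrite (le_trans (h _))// ?ttS// => s s1 s2; have sT := sin _ _ jK s1 s2.
  by rewrite subr0 (le_trans (XB _ sT))// ler_wpM2l// lerD2l H3.
(* The drift on cell j is bounded through X at the right end of the cell, where [beta j.+1] is
   evaluated; so the true increment lies in the ball of the projection. *)
have vrad j : (j.+1 < K)%N -> enorm (v j) <= drift_radius T X C np 1 j.+1 w.
  move=> jK; have /andP[j0 _] := tkT _ (ltnW (ltnW jK)); have /andP[_ jT] := tkT _ (ltnW jK).
  have r0 : 0 <= C * (1 + enorm (X w (tk T np 1 j.+1)) + eps).
    by rewrite mulr_ge0// !addr_ge0 ?enorm_ge0 ?(ltW ep).
  have := vincr (w := w) j0 (tle j) jT r0 (c := 0); rewrite scaler0 subr0 => h.
  rewrite (le_trans (h _))//; last by rewrite ttS /drift_radius ps mulrAC.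
  move=> s s1 s2; have sT := sin _ _ (ltnW jK) s1 s2.
  rewrite subr0 (le_trans (XB _ sT))// ler_wpM2l// -addrA lerD2l.
  rewrite (le_trans (ler_enorm_dist _ (X w (tk T np 1 j.+1))))// lerD2l osc//; first exact: ltnW.
  by rewrite distrC gtr0_norm ?subr_gt0//; have := ttS j; lra.
pose D k := simple_int W Hs w (tk T np 1 k) - I w (tk T np 1 k).
have UE j : (j <= K)%N -> U j w = x + vint (B w) (tk T np 1 j) - D j.
  by move=> jK; rewrite /U (H2 w j Ew2 jK) /D opprB addrA.
have Ub j : (j < K)%N -> enorm (U j.+1 w - U j w - v j) <= gap + gap.
  move=> jK; rewrite !UE//; last exact: ltnW.
  rewrite (_ : _ - v j = D j - D j.+1).
    rewrite (le_trans (ler_enormD _ _))// enormN lerD//; apply: Hgap => //; exact: ltnW.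
  apply/matrixP => i l; rewrite !mxE; ring.
(* 2 gap from [Ub], and 2 gap more for the projection, by [ball_proj_dist]. *)
have bv j : (j.+1 < K)%N -> enorm (beta j.+1 w - v j) <= 4 * gap.
  move=> jK; have h := Ub j (ltnW jK).
  have h2 := ball_proj_dist (U j.+1 w - U j w) (vrad j jK).
  have := ler_enormB (beta j.+1 w) (U j.+1 w - U j w) (v j).
  by move: h2; rewrite /beta; lra.
have sumb : enorm (\sum_(j < k) beta j w - vint (B w) (tk T np 1 k.-1)) <= k%:R * (4 * gap).
  case: k kK => [|k] kK /=; first by rewrite big_ord0 /tk mul0r vint0 subr0 enorm0 mul0r.
  elim: k kK => [|k IH] kK.
    rewrite big_ord_recr big_ord0 /= /tk mul0r vint0 subr0 addr0 enorm0.
    by rewrite mul1r mulr_ge0// ltW.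
  rewrite big_ord_recr [leRHS](_ : _ = k.+1%:R * (4 * gap) + 4 * gap); last first.
    by rewrite -natr1 mulrDl mul1r.
  apply: (le_trans _ (lerD (IH (ltnW kK)) (bv k kK))).
  apply: (le_trans _ (ler_enormD _ _)); rewrite le_eqVlt; apply/orP; left; apply/eqP.
  by congr enorm; apply/matrixP => i l; rewrite /v !mxE; ring.
have gapK : k%:R * (4 * gap) + gap <= eps / 4.
  have kK' : k%:R <= K%:R :> R by rewrite ler_nat.
  have K1 : 1 <= K%:R :> R by rewrite ler1n /K muln1.
  have g : K%:R * gap = eps / 20 by rewrite /gap; field; rewrite gt_eqF.
  have := ler_wpM2r (ltW gap0) kK'; have := ler_wpM2r (ltW gap0) K1; rewrite g; lra.
have vk : enorm (vint (B w) (tk T np 1 k) - vint (B w) (tk T np 1 k.-1)) <= eps / 4.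
  case: k kK {sumb gapK} => [|k] kK /=; last exact: vM.
  by rewrite subrr enorm0 divr_ge0// ltW.
have Dk := Hgap k kK; rewrite -/(D k) in Dk.
rewrite (H2 w k Ew2 kK) (_ : _ - _ = (\sum_(j < k) beta j w - vint (B w) (tk T np 1 k.-1)) + D k
   - (vint (B w) (tk T np 1 k) - vint (B w) (tk T np 1 k.-1))); last first.
  by apply/matrixP => i l; rewrite /D !mxE; ring.
rewrite (le_trans (ler_enormD _ _))// enormN.
have := ler_enormD (\sum_(j < k) beta j w - vint (B w) (tk T np 1 k.-1)) (D k).
by move: sumb gapK vk Dk; rewrite -/gap; lra.
Qed.

End diffusion.
End trackable.

(** * Moments from tail bounds *)

Lemma nneseries_le_partial (R : realType) (u : nat -> R) (b : R) : (forall n, 0 <= u n) ->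
  (forall n, \sum_(0 <= j < n) u j <= b) -> (\sum_(j <oo) (u j)%:E <= b%:E)%E.
Proof.
move=> u0 ub; apply: lime_le; first by apply: is_cvg_nneseries => n _ _; rewrite lee_fin.
by apply: nearW => n; rewrite sumEFin lee_fin.
Qed.

(** Between consecutive levels D 2^(j/m) the power V^m only doubles, so it is at most D^m times 1
    plus the sum of 2^(j+1) over the levels exceeded. The tail exponent 2 m gives level j the
    probability 4^(-j), and the series 2 2^(-j) has sum 4, whence 5. *)
Lemma dyadic_moment (R : realType) d (Omega : measurableType d) (P : probability Omega R)
    (V : Omega -> R) (m : nat) (D : R) : (0 < m)%N -> 0 < D -> (forall w, 0 <= V w) ->
  measurable_fun [set: Omega] V ->
  (forall A, 0 < A -> (P [set w | (A < V w)%R] <= ((D / A) ^+ (2 * m))%:E)%E) ->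
  (\int[P]_w (V w ^+ m)%:E <= (5 * D ^+ m)%:E)%E.
Proof.
(* This is 2^(j/m). *)
move=> m0 D0 V0 mV tail; pose s (j : nat) : R := expR (j%:R * ln 2 / m%:R).
have mR : m%:R != 0 :> R by rewrite pnatr_eq0 -lt0n.
have s0 j : 0 < s j by exact: expR_gt0.
have sm j : s j ^+ m = 2 ^+ j.
  by rewrite -expRM_natl mulrCA divff// mulr1 expRM_natl lnK// posrE.
pose Bj j := [set w | D * s j < V w].
have mBj j : measurable (Bj j).
  by rewrite -[X in measurable X]setTI; apply: measurable_fun_ltr.
pose u (j : nat) w : R := 2 ^+ j.+1 * \1_(Bj j) w.
have u0 j w : 0 <= u j w by rewrite mulr_ge0.
have mu j : measurable_fun [set: Omega] (fun w => (u j w)%:E).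
  by apply/measurable_EFinP; apply: measurable_funM => //; exact: measurable_indic.
have Iu j : (\int[P]_w (u j w)%:E <= (2 * 2^-1 ^+ j)%:E)%E.
  rewrite (_ : (\int[P]_w (u j w)%:E = (2 ^+ j.+1)%:E * P (Bj j))%E); last first.
    have -> : (\int[P]_w (u j w)%:E = \int[P]_w ((2 ^+ j.+1)%:E * (\1_(Bj j) w)%:E))%E.
      by apply: eq_integral => w _; rewrite EFinM.
    rewrite ge0_integralZl//.
      by rewrite integral_indic// setIT.
    by apply/measurable_EFinP; exact: measurable_indic.
  have h := tail _ (mulr_gt0 D0 (s0 j)).
  apply: le_trans (lee_wpmul2l _ h) _; rewrite -?EFinM lee_fin//.
  have -> : D / (D * s j) = (s j)^-1 by rewrite invfM mulrA divff ?gt_eqF// mul1r.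
  have -> : (s j)^-1 ^+ (2 * m) = (2 ^+ j)^-1 * (2 ^+ j)^-1.
    by rewrite mulnC exprM exprVn sm expr2.
  rewrite exprS exprVn.
  have : 2 ^+ j != 0 :> R by rewrite expf_neq0.
  move: (2 ^+ j) => z z0; rewrite le_eqVlt; apply/orP; left; apply/eqP.
  by field.
pose G w : \bar R := (1 + \sum_(j <oo) (u j w)%:E)%E.
have VG w : ((V w ^+ m)%:E <= (D ^+ m)%:E * G w)%E.
  have S0 n : ((\sum_(0 <= j < n) u j w)%:E <= \sum_(j <oo) (u j w)%:E)%E.
    by rewrite -sumEFin; apply: nneseries_lim_ge => j _ _; rewrite lee_fin.
  suff [n Hn] : exists n, (V w / D) ^+ m <= 1 + \sum_(0 <= j < n) u j w.
    have -> : V w ^+ m = D ^+ m * (V w / D) ^+ m by rewrite -exprMn mulrCA divff ?gt_eqF// mulr1.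
    rewrite EFinM lee_wpmul2l//.
      by rewrite lee_fin exprn_ge0// ltW.
    apply: (@le_trans _ _ (1 + \sum_(0 <= j < n) u j w)%:E); first by rewrite lee_fin.
    by rewrite EFinD leeD2l.
  have Q0 : 0 <= (V w / D) ^+ m by rewrite exprn_ge0// divr_ge0// ltW.
  set Q := _ ^+ m in Q0 *.
  have [Q1|Q1] := leP Q 1; first by exists 0%N; rewrite big_geq// addr0.
  have ind (n : nat) : Q <= 2 ^+ n -> exists n, Q <= 1 + \sum_(0 <= j < n) u j w.
    elim: n => [|n IH] Qn; first by move: Q1; rewrite ltNge Qn.
    have [/IH//|nQ] := leP Q (2 ^+ n).
    exists n.+1; rewrite big_nat_recr//= {2}/u indicE (_ : w \in Bj n).
      by rewrite mulr1 (le_trans Qn)// addrA lerDr addr_ge0// sumr_ge0.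
    rewrite inE /Bj /= mulrC -ltr_pdivlMr// ltNge; apply/negP => h.
    move: nQ; rewrite ltNge -(sm n); case/negP; rewrite lerXn2r ?nnegrE ?(ltW (s0 n))//.
    by rewrite divr_ge0// ltW.
  apply: (ind (Num.truncn Q).+1).
  rewrite (le_trans (ltW (truncnS_gt _)))// -natrX ler_nat; exact/ltnW/ltn_expl.
apply: (@le_trans _ _ (\int[P]_w ((D ^+ m)%:E * G w))%E).
  by apply: ge0_le_integral_nonmeas => w _; [rewrite lee_fin exprn_ge0|exact: VG].
have S0 w : (0 <= \sum_(j <oo) (u j w)%:E)%E.
  by apply: nneseries_ge0 => j _ _; rewrite lee_fin.
have mS : measurable_fun [set: Omega] (fun w => \sum_(j <oo) (u j w)%:E)%E.
  by apply: ge0_emeasurable_sum => // j w _ _; rewrite lee_fin.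
have mG : measurable_fun [set: Omega] G by exact: emeasurable_funD.
rewrite ge0_integralZl//; last 2 first.
- by move=> w _; rewrite adde_ge0.
- by rewrite lee_fin exprn_ge0// ltW.
rewrite mulrC EFinM lee_wpmul2l//; first by rewrite lee_fin exprn_ge0// ltW.
have I1 : (\int[P]_(w in setT) 1%E = 1 :> \bar R)%E.
  by rewrite integral_cst// mul1e; exact: probability_setT.
rewrite ge0_integralD// I1.
have -> : (5%:E = 1%:E + 4%:E :> \bar R)%E by rewrite -EFinD; congr EFin; ring.
apply: leeD2l.
rewrite integral_nneseries//; last by move=> j w _; rewrite lee_fin.
apply: (@le_trans _ _ (\sum_(j <oo) (2 * 2^-1 ^+ j)%:E)%E).
  by apply: lee_nneseries => [j _ _|j _]; [apply: integral_ge0 => w _; rewrite lee_fin|exact: Iu].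
apply: nneseries_le_partial => n; first by rewrite mulr_ge0// exprn_ge0.
suff -> : \sum_(0 <= j < n) 2 * 2^-1 ^+ j = 4 - 4 * 2^-1 ^+ n :> R.
  by rewrite gerBl mulr_ge0// exprn_ge0.
elim: n => [|n IH]; first by rewrite big_geq// expr0 mulr1 subrr.
by rewrite big_nat_recr//= IH exprS; field.
Qed.

(** * Lipschitz functionals *)

Section functional.
Context {R : realType} (n : nat) (T : R).
Hypothesis T0 : 0 < T.

Let gen : set (set (R -> 'cV[R]_n)) := [set A | exists (t : R) (i : 'I_n) (B : set R),
  [/\ t \in `[0, T], measurable B & A = [set g : R -> 'cV[R]_n | B (g t i ord0)]] ].

Lemma path_measurable_eval t : 0 <= t <= T ->
  mx_measurable ((fun g => g t) : g_sigma_algebraType gen -> _).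
Proof.
move=> tT i j _ B mB; rewrite setTI; apply: sub_sigma_algebra.
exists t, i, B; split => //.
by rewrite (ord1 j).
Qed.

Lemma path_measurable_ball (h : R -> 'cV[R]_n) (e : R) :
  path_measurable T [set g | forall r : rat, enorm (g (clip T (ratr r)) - h (clip T (ratr r))) <= e].
Proof.
rewrite (_ : [set g | _] = \bigcap_(r in [set: rat])
    [set g | enorm (g (clip T (ratr r)) - h (clip T (ratr r))) <= e]); last first.
  by apply/seteqP; split => [g H r _|g H r]; apply: H.
apply: (@countable_bigcap_measurable _ (g_sigma_algebraType gen)) => r _.
rewrite -[X in measurable X]setTI; apply: measurable_fun_ler => //.
apply: measurable_enorm; apply: mx_measurableB; last exact: mx_measurable_cst.
by apply: path_measurable_eval; exact: (clip_in (ltW T0) _).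
Qed.

Lemma unorm_le (g : R -> 'cV[R]_n) e :
  (forall t, 0 <= t <= T -> enorm (g t) <= e) -> (unorm T g <= e%:E)%E.
Proof.
move=> H; apply: ub_ereal_sup => _ [t tT <-]; rewrite lee_fin; apply: H.
by move: tT; rewrite /= in_itv.
Qed.

Lemma enorm_le_rat (g : R -> 'cV[R]_n) e : continuous_path T g ->
  (forall r : rat, enorm (g (clip T (ratr r))) <= e) -> forall t, 0 <= t <= T -> enorm (g t) <= e.
Proof.
move=> cg H t tT; apply/ler_addgt0Pr => e' e0'; have [r [_ h]] := rat_near T0 cg tT e0'.
by have := H r; have := ler_enorm_dist (g t) (g (clip T (ratr r))); rewrite enorm_distC; lra.
Qed.

Lemma continuous_pathB (g h : R -> 'cV[R]_n) : continuous_path T g -> continuous_path T h ->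
  continuous_path T (fun t => g t - h t).
Proof. by move=> cg ch t; apply: cvgB; [exact: cg|exact: ch]. Qed.

(* Codes of a countable family of step functions with rational values. *)
Let code : Type := (nat * nat * seq {ffun 'I_n -> int})%type.
Definition code_val (c : code) (s : R) : 'cV[R]_n :=
  \col_i ((nth [ffun=> 0] c.2 (Num.truncn (s / (T / c.1.2.+1%:R))) i)%:~R / c.1.2.+1%:R).
Definition close_to_code (c : code) (h : R -> 'cV[R]_n) : Prop :=
  continuous_path T h /\
  forall s, 0 <= s <= T -> enorm (h s - code_val c s) <= c.1.1.+1%:R^-1.
(** A Lipschitz functional is controlled on continuous paths only, so a continuous representative is
    chosen near each code. The default 0 occurs when no continuous path is close to the code. *)
Definition code_path (c : code) : R -> 'cV[R]_n := xget (fun=> 0) (close_to_code c).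

Lemma close_code g (e : R) : continuous_path T g -> 0 < e ->
  exists c : code, [/\ close_to_code c (code_path c) &
    forall s, 0 <= s <= T -> enorm (g s - code_path c s) <= e].
Proof.
move=> cg e0; pose m := Num.truncn (2 / e); pose a : R := m.+1%:R^-1.
have a0 : 0 < a by rewrite invr_gt0.
have ae : 2 * a <= e.
  rewrite /a ler_pdivrMr// mulrC -ler_pdivrMr//; exact/ltW/truncnS_gt.
have a2 : 0 < a / 2 by rewrite divr_gt0.
have [de de0 H] := continuous_path_unif cg a2.
(* One integer k governs both the rounding error n / (k + 1) and the time mesh T / (k + 1). *)
pose z := Num.max (2 * n%:R / a) (T / de).
pose k := Num.truncn z; have kz : z < k.+1%:R by exact: truncnS_gt.
have k1 : 2 * n%:R / a < k.+1%:R by apply: le_lt_trans kz; rewrite le_max lexx.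
have k2 : T / de < k.+1%:R by apply: le_lt_trans kz; rewrite le_max lexx orbT.
pose u (j : nat) : R := clip T (j%:R * (T / k.+1%:R)).
(* k + 2 values are stored because s = T has index k + 1. *)
pose c : code := ((m, k), mkseq (fun j => [ffun i => Num.floor (k.+1%:R * g (u j) i ord0)]) k.+2).
have D0 : 0 < T / k.+1%:R by rewrite divr_gt0.
have gc : close_to_code c g.
  split=> // s sT; have s0 : 0 <= s by case/andP: sT.
  have /andP[h1 h2] := truncn_itv (divr_ge0 s0 (ltW D0)).
  set j := Num.truncn (s / (T / k.+1%:R)) in h1 h2.
  have js : j%:R * (T / k.+1%:R) <= s by rewrite -ler_pdivlMr.
  have uj : u j = j%:R * (T / k.+1%:R).
    by rewrite /u clip_id// mulr_ge0 ?(ltW D0)//= (le_trans js)//; case/andP: sT.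
  have jk : (j < k.+2)%N.
    rewrite -(ltr_nat R) (le_lt_trans h1)// ltr_pdivrMr//.
    rewrite (le_lt_trans (_ : s <= T))//; first by case/andP: sT.
    by rewrite mulrCA ltr_pMr// ltr_pdivlMr// mul1r ltr_nat.
  have -> : code_val c s = quant k (g (u j)).
    by apply/matrixP => i l; rewrite !mxE /= -/j nth_mkseq// ffunE.
  have hq := quant_dist k (g (u j)).
  have hn : n%:R / k.+1%:R <= a / 2.
    rewrite ler_pdivrMr// ltW// -ltr_pdivrMl//; move: k1; rewrite (_ : _ / a = (a / 2)^-1 * n%:R)//.
    by field; rewrite gt_eqF.
  have hu : enorm (g s - g (u j)) < a / 2.
    apply: H => //; first exact: (clip_in (ltW T0) _).
    rewrite uj ger0_norm ?subr_ge0//.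
    apply: (@lt_le_trans _ _ (T / k.+1%:R)).
      by move: h2; rewrite ltr_pdivrMr// -natr1 mulrDl mul1r ltrBlDl.
    by rewrite ler_pdivrMr// mulrC -ler_pdivrMr// ltW.
  rewrite (le_trans (ler_enormB _ (g (u j)) _))// -/a [leRHS]splitr lerD//; first exact: ltW.
  by rewrite enorm_distC (le_trans hq).
have hc : close_to_code c (code_path c) by apply: (xgetPex _ (P := close_to_code c)); exists g.
exists c; split => // s sT; rewrite (le_trans _ ae)// mulrDl mul1r.
rewrite (le_trans (ler_enormB _ (code_val c s) _))// lerD//; first exact: gc.2.
by rewrite enorm_distC; exact: hc.2.
Qed.

(** Separability: on continuous paths, {f > a} is a countable union of closed balls of rational
    radius e centred at code paths c with f(c) - e > a. *)
Lemma lipschitz1_gt (f : (R -> 'cV[R]_n) -> R) (a : R) : lipschitz1 T f ->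
  exists S, path_measurable T S /\ forall g, continuous_path T g -> (S g <-> a < f g).
Proof.
move=> lf; pose D : set (code * rat) := [set ce | close_to_code ce.1 (code_path ce.1) /\
  a < f (code_path ce.1) - ratr ce.2].
pose S := \bigcup_(ce in D) [set g | forall r : rat,
  enorm (g (clip T (ratr r)) - code_path ce.1 (clip T (ratr r))) <= ratr ce.2].
exists S; split.
  rewrite /S bigcup_mkcond; apply: (@countable_bigcupT_measurable _ (g_sigma_algebraType gen)).
    exact: countableP.
  by move=> ce; case: ifP => // _; exact: path_measurable_ball.
move=> g cg; split.
  move=> [[c e] [/= hc ha] H].
  have h t : 0 <= t <= T -> enorm (g t - code_path c t) <= ratr e.
    by move=> tT; apply: (enorm_le_rat (continuous_pathB cg hc.1)).
  have := le_trans (lf _ _ cg hc.1) (unorm_le h); rewrite lee_fin ler_norml.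
  by case/andP; lra.
(* A centre within e of g has value at least a + 3 e, so a rational radius between e and 2 e is
   admissible and the ball contains g. *)
move=> afg; pose e := (f g - a) / 4; have e0 : 0 < e by rewrite divr_gt0// subr_gt0.
have [c [hc H]] := close_code cg e0.
have /rat_in_itvoo[r] : e < 2 * e by lra.
rewrite in_itv /= => /andP[r1 r2].
have fc := le_trans (lf _ _ cg hc.1) (unorm_le H).
exists (c, r) => /=; first split => //=.
  by move: fc; rewrite lee_fin ler_norml => /andP[_]; move: r2; rewrite /e; lra.
by move=> r'; apply: le_trans (ltW r1); apply: H; exact: (clip_in (ltW T0) _).
Qed.

(** The sets B with this property form a sigma-algebra that contains the half-lines by
    [lipschitz1_gt]. As f is arbitrary off the continuous paths, preimages are matched on these
    alone. *)
Lemma lipschitz1_measurable (f : (R -> 'cV[R]_n) -> R) (B : set R) : lipschitz1 T f ->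
  measurable B ->
  exists S, path_measurable T S /\ forall g, continuous_path T g -> (S g <-> B (f g)).
Proof.
move=> lf mB; pose good := [set B : set R | exists S, path_measurable T S /\
  forall g, continuous_path T g -> (S g <-> B (f g))].
have mB' : (@RGenOInfty.G R).-sigma.-measurable B by rewrite -RGenOInfty.measurableE.
apply: (mB' good); split; last first.
  move=> _ [a ->]; have [S [mS HS]] := lipschitz1_gt a lf; exists S; split => // g cg.
  by rewrite HS//= in_itv /= andbT.
have [s0 sC sU] := @smallest_sigma_algebra _ setT gen.
split.
- by exists set0; split.
- move=> A [S [mS HS]]; exists (setT `\` S); split; first exact: sC.
  by move=> g cg; have := HS g cg; rewrite /= /setD /=; tauto.
- move=> A /choice[S HS]; exists (\bigcup_i S i); split.
    by apply: sU => i; case: (HS i).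
  by move=> g cg; split => -[i _ h]; exists i => //; apply/((HS i).2 g cg).
Qed.

End functional.

(** * Moments of sums of independent variables *)

Section power_expansion.
Context {R : realType}.
Implicit Types (A s z B : R).

(** Recombines the terms of [shifted_moment] into a single power, so that the next summand can be
    treated in the same way. *)
Lemma exprD_ge A B m : 0 <= A -> 0 <= B ->
  A ^+ m.+1 + A ^+ m * B + B ^+ m.+1 <= (A + 2 * B) ^+ m.+1.
Proof.
move=> A0 B0; elim: m => [|m IH]; first by rewrite !expr1 expr0; lra.
have a0 := exprn_ge0 m A0; have b0 := exprn_ge0 m.+1 B0.
have h0 : 0 <= A + 2 * B by lra.
rewrite exprS; apply: le_trans (ler_wpM2l h0 IH).
have := mulr_ge0 A0 b0; have := mulr_ge0 B0 b0; rewrite !(exprS A) (exprS B m.+1).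
move: (B ^+ m.+1) (A ^+ m) a0 b0 => b a a0 b0 h1 h2.
have := mulr_ge0 (mulr_ge0 A0 B0) a0; have := mulr_ge0 (mulr_ge0 B0 B0) a0; nra.
Qed.

Lemma expr_expand_small A p y m : 0 <= A -> 0 <= y -> y <= A -> p ^+ 2 <= A * y -> 0 <= A + 2 * p + y ->
  (A + 2 * p + y) ^+ m.+1 <= A ^+ m.+1 + 2 * m.+1%:R * p * A ^+ m + 16 ^+ m.+1 * (A ^+ m * y).
Proof.
move=> A0 y0 yA p2 x0; elim: m => [|m IH]; first by rewrite !expr1 expr0; nra.
rewrite exprS; apply: le_trans (ler_wpM2l x0 IH) _.
have a0 := exprn_ge0 m A0; rewrite !(exprS A) (exprS 16 m.+1).
have c1 : m.+1%:R <= 16 ^+ m.+1 :> R by rewrite -natrX ler_nat ltnW// ltn_expl.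
have -> : m.+2%:R = m.+1%:R + 1 :> R by rewrite natr1.
have k0 : 1 <= m.+1%:R :> R by rewrite ler1n.
move: (A ^+ m) (16 ^+ m.+1) (m.+1%:R) a0 c1 k0 => a c k a0 c1 k0 {IH}.
rewrite -subr_ge0 (_ : _ - _ = a * (A * (15 * c - 1) * y - 4 * k * p ^+ 2 - 2 * (c + k) * (p * y)
   - c * y ^+ 2)); last by ring.
rewrite mulr_ge0//; have pA : p <= A.
  rewrite leNgt; apply/negP => Ap; have := ler_wpM2l A0 yA.
  have : 0 < (p - A) * (p + A) by rewrite mulr_gt0//; lra.
  by move: p2; rewrite expr2; lra.
have h1 : p * y <= A * y by exact: ler_wpM2r.
have h2 : y ^+ 2 <= A * y by rewrite expr2; exact: ler_wpM2r.
have k00 : 0 <= 4 * k by lra.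
have ck : 0 <= 2 * (c + k) by lra.
have c0 : 0 <= c by lra.
have e1 := ler_wpM2l k00 p2; have e2 := ler_wpM2l ck h1; have e3 := ler_wpM2l c0 h2.
have Ay : 0 <= A * y by rewrite mulr_ge0.
have e4 : 0 <= (A * y) * (12 * c - 6 * k - 1) by rewrite mulr_ge0//; lra.
move: (p ^+ 2) (p * y) (y ^+ 2) e1 e2 e3 => u v w e1 e2 e3; nra.
Qed.

(** The term linear in z is kept exactly, since its expectation vanishes; all others are bounded by
    even powers of z. *)
Lemma expr_expand A s z m : s ^+ 2 <= A ->
  (A + 2 * s * z + z ^+ 2) ^+ m.+1 <= A ^+ m.+1 + 2 * m.+1%:R * s * A ^+ m * z +
    16 ^+ m.+1 * (A ^+ m * z ^+ 2 + (z ^+ 2) ^+ m.+1).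
Proof.
move=> sA; have A0 : 0 <= A := le_trans (sqr_ge0 s) sA.
have z0 := sqr_ge0 z; have x0 : 0 <= A + 2 * (s * z) + z ^+ 2.
  by have := sqr_ge0 (s + z); rewrite sqrrD; nra.
have sz2 : (s * z) ^+ 2 <= A * z ^+ 2 by rewrite exprMn ler_wpM2r.
rewrite -[2 * s * z]mulrA (_ : 2 * m.+1%:R * s * A ^+ m * z = 2 * m.+1%:R * (s * z) * A ^+ m); last by ring.
move: (s * z) (z ^+ 2) x0 sz2 z0 => p y x0 p2 y0 {sA s z}.
have c0 : 0 <= 16 ^+ m.+1 :> R by rewrite exprn_ge0.
have a0 := exprn_ge0 m A0.
have [yA|Ay] := leP y A.
  rewrite (le_trans (expr_expand_small m A0 y0 yA p2 x0))// lerD2l ler_wpM2l// lerDl.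
  exact: exprn_ge0.
have py : `|p| <= y.
  rewrite -(@ler_pXn2r _ 2) ?nnegrE// real_normK ?num_real//.
  by rewrite (le_trans p2)// expr2 ler_wpM2r// ltW.
have [p1 p2'] : - y <= p /\ p <= y by move: py; rewrite ler_norml => /andP[].
(* When z^2 exceeds A, it dominates A and |s z|. The factor 16 = 4 4 also leaves room for the linear
   term, which may be negative. *)
have h1 : (A + 2 * p + y) ^+ m.+1 <= 4 ^+ m.+1 * y ^+ m.+1.
  by rewrite -exprMn lerXn2r ?nnegrE ?mulr_ge0//; lra.
have h2 : A ^+ m <= y ^+ m by rewrite lerXn2r ?nnegrE// ltW.
have h3 : - (y * y ^+ m) <= p * A ^+ m.
  have := ler_wpM2r a0 p1; have := ler_wpM2l y0 h2; lra.
have c1 : m.+1%:R <= 4 ^+ m.+1 :> R by rewrite -natrX ler_nat ltnW// ltn_expl.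
have c4 : 4 <= 4 ^+ m.+1 :> R by rewrite exprS ler_peMr// exprn_ege1// ler1n.
have e16 : 16 ^+ m.+1 = 4 ^+ m.+1 * 4 ^+ m.+1 :> R by rewrite -exprMn; congr (_ ^+ _); ring.
have k0 : 0 <= m.+1%:R :> R by [].
have yy := exprn_ge0 m y0; have A1 := exprn_ge0 m.+1 A0.
have w0 : 0 <= y * y ^+ m by rewrite mulr_ge0.
have w1 : 0 <= A ^+ m * y by rewrite mulr_ge0.
move: h1; rewrite e16 !(exprS y m) => h1; apply: le_trans h1 _.
move: c0 c1 c4 k0 h3 w0 w1 A1; rewrite e16.
move: (4 ^+ m.+1) (m.+1%:R) (A ^+ m.+1) => c k a c0 c1 c4 k0 h3 w0 w1 A1.
rewrite -[2 * k * p * _]mulrA; move: (p * A ^+ m) (y * y ^+ m) (A ^+ m * y) h3 w0 w1 => u v w h3 w0 w1.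
have t1 : - (2 * k * v) <= 2 * k * u.
  by rewrite -mulrN ler_wpM2l// mulr_ge0.
have t2 : 0 <= (c * c - c - 2 * k) * v by rewrite mulr_ge0//; nra.
have t3 : 0 <= c * c * w by rewrite mulr_ge0.
by move: t1 t2 t3; move: (c * c) => cc; nra.
Qed.

End power_expansion.

Section sums.
Context {R : realType} (mu : probability R R) (m : nat) (zt : R).
Hypothesis zt0 : 0 <= zt.
Hypothesis mean_int : mu.-integrable setT (fun z : R => z%:E).
Hypothesis mean0 : (\int[mu]_z z%:E = 0)%E.
Hypothesis mom2 : (\int[mu]_z (z ^+ 2)%:E <= zt%:E)%E.
Hypothesis mom2m : (\int[mu]_z ((z ^+ 2) ^+ m.+1)%:E <= (zt ^+ m.+1)%:E)%E.

(** One summand integrated out: the linear term disappears, and the two moment bounds combine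
    through [exprD_ge] with B = 16^(m+1) zt. *)
Lemma shifted_moment (A s : R) : s ^+ 2 <= A ->
  (\int[mu]_z ((A + 2 * s * z + z ^+ 2) ^+ m.+1)%:E <=
     ((A + 2 * (16 ^+ m.+1 * zt)) ^+ m.+1)%:E)%E.
Proof.
move=> sA; have A0 : 0 <= A := le_trans (sqr_ge0 s) sA.
pose c : R := 16 ^+ m.+1; have c0 : 0 <= c by exact: exprn_ge0.
have c1 : 1 <= c by rewrite exprn_ege1// ler1n.
have Am0 := exprn_ge0 m A0.
pose h (z : R) : R := A ^+ m.+1 + (c * A ^+ m * z ^+ 2 + c * (z ^+ 2) ^+ m.+1).
have h0 z : 0 <= h z.
  have z2 := sqr_ge0 z; apply: addr_ge0; first exact: exprn_ge0.
  apply: addr_ge0; first exact: mulr_ge0 (mulr_ge0 c0 Am0) z2.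
  by apply: mulr_ge0 => //; exact: exprn_ge0.
have mh : measurable_fun [set: R] h.
  apply: measurable_funD => //; apply: measurable_funD; apply: measurable_funM => //.
  by apply: measurable_funX; exact: measurable_funX.
have Ih : (\int[mu]_z (h z)%:E <= (A ^+ m.+1 + (c * A ^+ m * zt + c * zt ^+ m.+1))%:E)%E.
  have -> : (\int[mu]_z (h z)%:E = \int[mu]_z ((A ^+ m.+1)%:E + ((c * A ^+ m)%:E * (z ^+ 2)%:E +
      c%:E * ((z ^+ 2) ^+ m.+1)%:E)))%E.
    by apply: eq_integral => z _.
  have m2 : measurable_fun [set: R] (fun z : R => ((z ^+ 2)%:E : \bar R)).
    by apply/measurable_EFinP; exact: measurable_funX.
  have m2m : measurable_fun [set: R] (fun z : R => (((z ^+ 2) ^+ m.+1)%:E : \bar R)).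
    by apply/measurable_EFinP; apply: measurable_funX; exact: measurable_funX.
  have p1 (z : R) : (0 <= (z ^+ 2)%:E)%E by rewrite lee_fin sqr_ge0.
  have p2 (z : R) : (0 <= ((z ^+ 2) ^+ m.+1)%:E)%E by rewrite lee_fin exprn_ge0// sqr_ge0.
  have q1 : (0 <= (c * A ^+ m)%:E :> \bar R)%E by rewrite lee_fin mulr_ge0.
  have q2 : (0 <= c%:E :> \bar R)%E by rewrite lee_fin.
  have r1 : measurable_fun [set: R] (fun z : R => ((c * A ^+ m)%:E * (z ^+ 2)%:E)%E).
    exact: measurable_funeM.
  have r2 : measurable_fun [set: R] (fun z : R => (c%:E * ((z ^+ 2) ^+ m.+1)%:E)%E).
    exact: measurable_funeM.
  rewrite ge0_integralD//; last 3 first.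
  - by move=> z _; rewrite lee_fin exprn_ge0.
  - by move=> z _; rewrite adde_ge0// mule_ge0.
  - exact: emeasurable_funD.
  rewrite ge0_integralD//; last 2 first.
  - by move=> z _; rewrite mule_ge0.
  - by move=> z _; rewrite mule_ge0.
  rewrite !ge0_integralZl// integral_cst// [X in (_ * X + _)%E](_ : _ = 1%E) ?mule1; last exact: probability_setT.
  rewrite !EFinD leeD2l//; apply: leeD.
    by rewrite (EFinM (c * A ^+ m) zt); exact: lee_wpmul2l.
  by rewrite (EFinM c (zt ^+ m.+1)); exact: lee_wpmul2l.
have ih : mu.-integrable setT (EFin \o h).
  apply/integrableP; split; first by apply/measurable_EFinP.
  apply: le_lt_trans (ltry (A ^+ m.+1 + (c * A ^+ m * zt + c * zt ^+ m.+1))).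
  apply: le_trans Ih; rewrite le_eqVlt; apply/orP; left; apply/eqP.
  by apply: eq_integral => z _; rewrite /= ger0_norm.
pose k := 2 * m.+1%:R * s * A ^+ m.
have ikz : mu.-integrable setT (fun z : R => (k%:E * z%:E)%E) by exact: integrableZl.
apply: (@le_trans _ _ (\int[mu]_z (k%:E * z%:E + (h z)%:E))%E).
  apply: ge0_le_integral_nonmeas => z _.
    by rewrite lee_fin exprn_ge0//; have := sqr_ge0 (s + z); rewrite sqrrD; lra.
  rewrite -EFinM -EFinD lee_fin (le_trans (expr_expand z m sA))// /h /k -/c.
  rewrite le_eqVlt; apply/orP; left; apply/eqP; ring.
rewrite (integralD _ ikz ih)// integralZl// mean0 mule0 add0e (le_trans Ih)// lee_fin.
apply: le_trans (exprD_ge m A0 (mulr_ge0 c0 zt0)).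
rewrite addrA lerD//; first by rewrite lerD2l// [leLHS]mulrC mulrCA mulrA [leLHS]mulrC mulrA lexx.
rewrite exprMn ler_wpM2r ?exprn_ge0// exprS ler_peMr// exprn_ege1//.
Qed.

Context d (Omega : measurableType d) (P : probability Omega R) (M : nat).
Context (Z : 'I_M -> Omega -> R).
Hypothesis mZ : forall k, measurable_fun [set: Omega] (Z k).
Hypothesis indep : forall B : 'I_M -> set R, (forall k, measurable (B k)) ->
  P [set w | forall k, B k (Z k w)] = (\prod_(k < M) mu (B k))%E.

(** The induction needs the free constant a: integrating out one summand replaces a by a + 2
    16^(m+1) zt. *)
Lemma partial_sum_moment j (a : R) : (j <= M)%N -> 0 <= a ->
  (\int[P]_w ((a + (\sum_(k < M | (k < j)%N) Z k w) ^+ 2) ^+ m.+1)%:E <=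
     ((a + j%:R * (2 * (16 ^+ m.+1 * zt))) ^+ m.+1)%:E)%E.
Proof.
have b0 : 0 <= 2 * (16 ^+ m.+1 * zt) by rewrite !mulr_ge0.
set b := 2 * _ in b0 *.
elim: j a => [|j IH] a jM a0.
  rewrite mul0r addr0 (_ : (\int[P]_w _ = \int[P]_w (a ^+ m.+1)%:E)%E); last first.
    by apply: eq_integral => w _; rewrite big_pred0// expr0n addr0.
  rewrite integral_cst// [X in (_ * X)%E](_ : _ = 1%E) ?mule1//; exact: probability_setT.
pose jo : 'I_M := Ordinal jM.
pose S (w : Omega) := \sum_(k < M | (k < j)%N) Z k w.
have Sj w : \sum_(k < M | (k < j.+1)%N) Z k w = S w + Z jo w.
  rewrite (bigD1 jo)//= addrC; congr (_ + _); apply: eq_bigl => k.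
  by rewrite ltnS -val_eqE /= ltn_neqAle andbC.
(* The summands are independent of one another, so the prior information is trivial. *)
pose FF : set (set Omega) := [set setT].
have FFM : FF `<=` measurable by move=> _ ->.
have FFI : setI_closed FF by move=> _ _ -> ->; rewrite setIT.
have ind A (B : 'I_M -> set R) : FF A -> (forall i, measurable (B i)) ->
    P (A `&` [set w | forall i, B i (Z i w)]) = (P A * \prod_(i < M) mu (B i))%E.
  by move=> -> mB; rewrite setTI indep// (_ : P setT = 1%E) ?mul1e//; exact: probability_setT.
pose g (u : Omega * R) : \bar R := ((a + (S u.1 + u.2) ^+ 2) ^+ m.+1)%:E.
have mS : measurable_fun [set: g_sigma_algebraType (others FF Z jo)] S.
  apply: measurable_fun_bigsum => k kj; apply: others_xi => //.
  by apply/eqP => e; rewrite e /= ltnn in kj.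
have := @family_tonelli R _ _ P FF M Z (fun=> mu) FFM FFI erefl mZ ind jo g.
rewrite (_ : (\int[P]_w g (w, Z jo w) = \int[P]_w ((a + (\sum_(k < M | (k < j.+1)%N) Z k w) ^+ 2) ^+ m.+1)%:E)%E); last first.
  by apply: eq_integral => w _; rewrite Sj.
move=> ->; last 2 first.
- apply/measurable_EFinP; apply: measurable_funX; apply: measurable_funD => //.
  apply: measurable_funX; apply: measurable_funD.
    by apply: (measurableT_comp mS); exact: measurable_fst.
  exact: measurable_snd.
- by move=> u; rewrite lee_fin exprn_ge0// addr_ge0// sqr_ge0.
rewrite -natr1 mulrDl mul1r (addrC _ b) addrA.
apply: le_trans (IH (a + b) (ltnW jM) (addr_ge0 a0 b0)).
apply: ge0_le_integral_nonmeas => w _.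
  by apply: integral_ge0 => z _; rewrite lee_fin exprn_ge0// addr_ge0// sqr_ge0.
have := @shifted_moment (a + S w ^+ 2) (S w) _; rewrite lerDr => /(_ a0).
rewrite addrAC -/b; apply: le_trans.
rewrite le_eqVlt; apply/orP; left; apply/eqP; apply: eq_integral => z _.
by rewrite /g /=; congr EFin; congr (_ ^+ _); ring.
Qed.

Lemma sum_moment :
  (\int[P]_w (((\sum_(k < M) Z k w) ^+ 2) ^+ m.+1)%:E <=
     ((M%:R * (2 * (16 ^+ m.+1 * zt))) ^+ m.+1)%:E)%E.
Proof.
have := partial_sum_moment (leqnn M) (lexx 0); rewrite add0r; apply: le_trans.
rewrite le_eqVlt; apply/orP; left; apply/eqP; apply: eq_integral => w _.
rewrite add0r; congr (((_ ^+ 2) ^+ _)%:E); apply: eq_bigl => k.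
by rewrite ltn_ord.
Qed.

End sums.

(** * Deviation bound *)

(** With u = r^2 M / c^2, the threshold on r reads u <= exp (2 K). *)
Lemma deviation_numeric (R : realType) d (x : 'cV[R]_d) (M : nat) (r a Pr : R) :
  (0 < M)%N -> 0 <= r -> 1 <= a -> Pr <= 1 ->
  (forall m : nat, 0 < r -> Pr <= ((r ^+ 2 * M%:R / (2 * (1 + enorm x)) ^+ 2)^-1 *
     expR (21 * m.+1%:R * a)) ^+ m.+1) ->
  Pr <= deviation_bound (28 * a) x M r.
Proof.
move=> M0 r0 a1 P1 H; rewrite /deviation_bound; set K := 28 * a; set c := 2 * _.
have c0 : 0 < c by rewrite mulr_gt0// ltr_wpDr// sqrtr_ge0.
have MR : 0 < M%:R :> R by rewrite ltr0n.
have c2 : 0 < c ^+ 2 by exact: exprn_gt0.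
have uE : r ^+ 2 * M%:R / c ^+ 2 = (r * Num.sqrt M%:R / c) ^+ 2.
  have {1}-> : M%:R = Num.sqrt M%:R ^+ 2 :> R by rewrite sqr_sqrtr// ltW.
  by move: (Num.sqrt _) => s; clear c2 H; move: c c0 => b b0; field; rewrite gt_eqF.
have e2K : expR (2 * K) = expR K ^+ 2 by rewrite expRM_natl.
have eK := expR_gt0 K; have sM : 0 < Num.sqrt M%:R :> R by rewrite sqrtr_gt0.
have cond : (r <= (Num.sqrt M%:R)^-1 * c * expR K) = (r ^+ 2 * M%:R / c ^+ 2 <= expR (2 * K)).
  rewrite uE e2K ler_sqr ?nnegrE ?(ltW eK)//; last by rewrite !mulr_ge0 ?invr_ge0// ltW.
  by rewrite ler_pdivrMr// -ler_pdivlMr// -mulrA mulrC (mulrC c).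
rewrite cond; set u := r ^+ 2 * M%:R / c ^+ 2 in H *.
have u0 : 0 <= u by apply: divr_ge0 (ltW c2); exact: mulr_ge0 (sqr_ge0 r) (ltW MR).
case: ifPn => [uK|]; last rewrite -ltNge => uK.
  rewrite (_ : _ / (_ * _) = u / expR (2 * K)); last by rewrite invfM mulrA.
  set v := u / _; have eK2 : 0 < expR (2 * K) by exact: expR_gt0.
  have v1 : v <= 1 by rewrite ler_pdivrMr// mul1r.
  (* For v <= 1/2 the claimed bound is at least 2 (1 - v) >= 1. Otherwise m = 0 gives 2 exp (21 a -
     2 K), and 2 K - 21 a = 35 a >= 1 >= v. *)
  have [vh|vh] := leP v (1 / 2).
    by have := expR_ge1Dx (- v); lra.
  have rp : 0 < r.
    rewrite lt_neqAle r0 andbT; apply/eqP => r00; move: vh.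
    by rewrite /v /u -r00 expr0n /= !mul0r; lra.
  have := H 0%N rp; rewrite expr1 => h; apply: (le_trans h).
  have ui : u^-1 <= 2 * expR (- (2 * K)).
    have up : 0 < u by move: vh; rewrite /v ltr_pdivlMr//; apply: lt_trans; rewrite mulr_gt0.
    by rewrite expRN -div1r ler_pdivrMr// -mulrA [_^-1 * u]mulrC -/v; lra.
  apply: (le_trans (ler_wpM2r (expR_ge0 _) ui)); rewrite -[leLHS]mulrA -expRD ler_wpM2l// ler_expR.
  by rewrite /K mulr1; lra.
have up : 0 < u by apply: lt_trans uK; exact: expR_gt0.
have rp : 0 < r.
  rewrite lt_neqAle r0 andbT; apply/eqP => r00; move: up.
  by rewrite /u -r00 expr0n /= !mul0r ltxx.
have K0 : 0 < K by rewrite /K; lra.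
set L := ln u; have LK : 2 * K < L by rewrite -ltr_expR lnK.
(* In terms of [mu] the target exponent is - K mu^2; the power taken is the integer z = k + 1
   following [mu], hence 1 < mu < z <= mu + 1. *)
pose mu := L / (2 * K); have K20 : 0 < 2 * K by rewrite mulr_gt0.
have mu1 : 1 < mu by rewrite ltr_pdivlMr// mul1r.
have LE : L = 2 * K * mu by rewrite mulrC divfK// gt_eqF.
have /andP[t1 t2] := truncn_itv (ltW (lt_trans ltr01 mu1)).
set k := Num.truncn mu in t1 t2.
have k1 : (0 < k)%N by rewrite -ltnS -(ltr_nat R) (lt_trans mu1).
have k2 : 2 <= k.+1%:R :> R by rewrite ler_nat.
have kmu : k.+1%:R - mu <= 1 by rewrite -natr1; lra.
apply: (le_trans (H k rp)).
have -> : u^-1 = expR (- L) by rewrite expRN lnK.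
rewrite -expRD -expRM_natl.
apply: (@le_trans _ _ (expR (- ((4 * K)^-1 * L ^+ 2)))); last first.
  by rewrite ler_peMl ?expR_ge0// ler1n.
rewrite ler_expR (_ : (4 * K)^-1 * L ^+ 2 = K * mu ^+ 2); last first.
  by rewrite LE; field; rewrite gt_eqF.
rewrite LE (_ : 21 * k.+1%:R * a = 3 / 4 * K * k.+1%:R); last by rewrite /K; field.
move: (k.+1%:R) k2 kmu t2 => z z2 zmu t2; rewrite -subr_ge0.
(* Since 21 a = 3 K / 4, a quarter of K z^2 is left over; it is at least K because z >= 2, and so
   covers the rounding error K (z - mu)^2. *)
rewrite (_ : _ - _ = K * (z ^+ 2 / 4 - (z - mu) ^+ 2)); last by field.
rewrite mulr_ge0 ?(ltW K0)//.
have : (z - mu) ^+ 2 <= 1 by rewrite expr_le1//; lra.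
by have : 2 ^+ 2 <= z ^+ 2 by [rewrite lerXn2r ?nnegrE//; lra]; lra.
Qed.

Section deviation.
Context {R : realType} (n : nat) (T : R).
Hypothesis T0 : 0 < T.

Lemma path_preimage_measurable d (Omega : measurableType d) (X : Omega -> R -> 'cV[R]_n)
    (S : set (R -> 'cV[R]_n)) :
  (forall t, t \in `[0, T] -> rv_measurable measurable (fun w => X w t)) ->
  path_measurable T S -> measurable (X @^-1` S).
Proof.
move=> mX /(_ [set S | measurable (X @^-1` S)]); apply; split; last first.
  by move=> _ [t [i [B [tT mB ->]]]]; exact: mX.
split.
- by rewrite /= preimage_set0.
- by move=> A mA /=; rewrite setTD preimage_setC; exact: measurableC.
- by move=> A mA /=; rewrite preimage_bigcup; apply: bigcup_measurable => k _; exact: mA.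
Qed.

Lemma lipschitz1_measurable_comp d (Omega : measurableType d) (X : Omega -> R -> 'cV[R]_n) f :
  (forall w, continuous_path T (X w)) ->
  (forall t, t \in `[0, T] -> rv_measurable measurable (fun w => X w t)) ->
  lipschitz1 T f -> measurable_fun [set: Omega] (fun w => f (X w)).
Proof.
move=> Xc mX lf _ B mB; rewrite setTI; have [S [mS HS]] := lipschitz1_measurable T0 lf mB.
rewrite (_ : _ @^-1` _ = X @^-1` S); first exact: path_preimage_measurable.
by apply/seteqP; split => w /=; rewrite (HS _ (Xc w)).
Qed.

Context d (Omega : measurableType d) (P : probability Omega R).
Context (X : Omega -> R -> 'cV[R]_n) (x : 'cV[R]_n) (C : R).
Hypothesis C0 : 0 <= C.
Hypothesis Xc : forall w, continuous_path T (X w).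
Hypothesis mX : forall t, t \in `[0, T] -> rv_measurable measurable (fun w => X w t).
Hypothesis tail : forall (p : nat) (A : R) (B : set Omega), 0 < A -> measurable B ->
  (forall w, B w -> exists2 t, 0 <= t <= T & 5 / 4 * A < 1 + enorm (X w t) ^+ 2) ->
  (P B <= ((A^-1 * ((1 + enorm x ^+ 2) * expR ((C + rate C p) * T))) ^+ p)%:E)%E.
Context (f : (R -> 'cV[R]_n) -> R).
Hypothesis lf : lipschitz1 T f.

Let psi w := f (X w) - f (fun=> 0).

Let mpsi : measurable_fun [set: Omega] psi.
Proof. by apply: measurable_funB => //; exact: lipschitz1_measurable_comp. Qed.

Let V w := 1 + psi w ^+ 2.

Let mV : measurable_fun [set: Omega] V.
Proof. by apply: measurable_funD => //; exact: measurable_funX. Qed.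

(** The Lipschitz bound against the zero path gives |psi| <= sup |X|. The measurable variable V thus
    replaces the supremum in the tail estimate. *)
Let V_exceeds A w : A < V w -> exists2 t, 0 <= t <= T & A < 1 + enorm (X w t) ^+ 2.
Proof.
move=> AV; apply: contrapT => H.
have HA t : 0 <= t <= T -> enorm (X w t) ^+ 2 <= A - 1.
  move=> tT; rewrite lerBrDl leNgt; apply/negP => h; apply: H; by exists t.
have A1 : 0 <= A - 1.
  by apply: le_trans (HA 0 _); rewrite ?sqr_ge0// lexx ltW.
have c0 : continuous_path T (fun=> 0 : 'cV[R]_n) by move=> t; exact: cvg_cst.
have := le_trans (lf (@Xc w) c0) (@unorm_le R n T _ (Num.sqrt (A - 1)) _).
rewrite lee_fin => h; have {}h : `|psi w| <= Num.sqrt (A - 1).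
  apply: h => t tT; rewrite subr0 -(@ler_pXn2r _ 2) ?nnegrE ?sqrtr_ge0 ?enorm_ge0//.
  by rewrite [leRHS]sqr_sqrtr//; exact: HA.
move: AV; rewrite /V -real_normK ?num_real// ltNge => /negP; apply.
rewrite -lerBrDl -[leRHS]sqr_sqrtr// lerXn2r ?nnegrE ?sqrtr_ge0//.
Qed.

(** [dyadic_moment] for the power m + 1 needs the tail with p = 2 (m + 1), whose exponent 4 + 15 (m
    + 1) is at most 19 (m + 1). *)
Definition sup_scale (m : nat) : R := (1 + enorm x ^+ 2) * expR (19 * m.+1%:R * (C * T)).

Let D0 m : 0 < sup_scale m.
Proof. by rewrite mulr_gt0 ?expR_gt0// ltr_pwDl// sqr_ge0. Qed.

Let DS m : sup_scale 0 <= sup_scale m.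
Proof.
have CT : 0 <= C * T by rewrite mulr_ge0// ltW.
by rewrite ler_wpM2l ?addr_ge0 ?sqr_ge0// ler_expR ler_wpM2r// ler_wpM2l// ler_nat ltnS.
Qed.

Let V_moment m : (\int[P]_w (V w ^+ m.+1)%:E <= (5 * (5 / 4 * sup_scale m) ^+ m.+1)%:E)%E.
Proof.
have CT : 0 <= C * T by rewrite mulr_ge0// ltW.
apply: dyadic_moment => //.
- by rewrite mulr_gt0.
- by move=> w; rewrite /V addr_ge0// sqr_ge0.
move=> A A0; have A0' : 0 < 4 / 5 * A by rewrite mulr_gt0.
have mB : measurable [set w | A < V w].
  by rewrite -[X in measurable X]setTI; exact: measurable_fun_ltr.
have := @tail (2 * m.+1)%N (4 / 5 * A) [set w | A < V w] A0' mB _.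
rewrite (_ : 5 / 4 * (4 / 5 * A) = A); last by field.
move=> /(_ (fun w => @V_exceeds A w)) /le_trans; apply; rewrite lee_fin.
have e0 : 0 < 1 + enorm x ^+ 2 by rewrite ltr_pwDl// sqr_ge0.
rewrite lerXn2r ?nnegrE//.
- by rewrite !mulr_ge0 ?invr_ge0 ?expR_ge0 ?(ltW A0')// ltW.
- by rewrite divr_ge0 ?mulr_ge0// ?ltW.
rewrite (_ : 5 / 4 * sup_scale m / A = (4 / 5 * A)^-1 * sup_scale m); last first.
  by field; rewrite gt_eqF.
rewrite ler_wpM2l ?invr_ge0 ?(ltW A0')// ler_wpM2l ?(ltW e0)// ler_expR.
rewrite /rate natrM; have m1 : 1 <= m.+1%:R :> R by rewrite ler1n.
move: (m.+1%:R) m1 => z z1.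
rewrite (_ : (C + _) * T = C * T * (4 + 15 * z)); last by field.
by rewrite (mulrC _ (C * T)) ler_wpM2l//; lra.
Qed.

Let ipsi : P.-integrable setT (EFin \o psi).
Proof.
apply/integrableP; split; first exact/measurable_EFinP.
apply: le_lt_trans (ltry (5 * (5 / 4 * sup_scale 0) ^+ 1)).
apply: le_trans (V_moment 0); apply: ge0_le_integral_nonmeas => w _; first exact: abse_ge0.
rewrite /= lee_fin expr1 /V; have := sqr_ge0 (1 - `|psi w|).
by rewrite sqrrB expr1n mul1r real_normK ?num_real//; have := normr_ge0 (psi w); lra.
Qed.

Let iV : P.-integrable setT (EFin \o V).
Proof.
apply/integrableP; split; first exact/measurable_EFinP.
apply: le_lt_trans (ltry (5 * (5 / 4 * sup_scale 0) ^+ 1)).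
apply: le_trans (V_moment 0); apply: ge0_le_integral_nonmeas => w _; first exact: abse_ge0.
by rewrite /= expr1 ger0_norm// /V addr_ge0// sqr_ge0.
Qed.

Let e : R := fine (\int[P]_w (psi w)%:E).

Let eE : (\int[P]_w (psi w)%:E = e%:E)%E.
Proof. by rewrite /e fineK//; exact: integrable_fin_num. Qed.

(** Integrate 2 e psi <= V + e^2 and use 25/4 = 5 (5/4) from [V_moment 0]. *)
Lemma e_sqr_le : e ^+ 2 <= 25 / 4 * sup_scale 0.
Proof.
have i1 : P.-integrable setT (fun w => ((2 * e)%:E * (psi w)%:E)%E) by exact: integrableZl.
have h : (\int[P]_w ((2 * e)%:E * (psi w)%:E) <= \int[P]_w ((V w)%:E + (e ^+ 2)%:E))%E.
  apply: le_integral => //; first by apply: integrableD => //; exact: finite_measure_integrable_cst.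
  move=> w _; rewrite -EFinM -EFinD lee_fin /V; have := sqr_ge0 (psi w - e).
  by rewrite sqrrB; lra.
move: h; rewrite integralZl// eE integralD//; last exact: finite_measure_integrable_cst.
rewrite integral_cst// [X in (_ + _ * X)%E](_ : _ = 1%E); last exact: probability_setT.
rewrite mule1 -EFinM => h.
have := le_trans h (leeD2r (e ^+ 2)%:E (V_moment 0)).
by rewrite !expr1 => h'; have := h' ; rewrite -EFinD lee_fin expr2; lra.
Qed.

Let Z w := psi w - e.

Let mZ : measurable_fun [set: Omega] Z.
Proof. exact: measurable_funB. Qed.

(** (psi - e)^2 <= 2 V + (25/2) [sup_scale m]; convexity of the power separates the two terms, and 5
    (5/2)^(m+1) <= (25/2)^(m+1) makes them equal in size, whence 25 = 2 (25/2). *)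
Let Z_moment m : (\int[P]_w ((Z w ^+ 2) ^+ m.+1)%:E <= ((25 * sup_scale m) ^+ m.+1)%:E)%E.
Proof.
have Dm := D0 m; pose k : R := 2 ^+ m.+1 * (25 / 2 * sup_scale m) ^+ m.+1 / 2.
have k0 : 0 <= k by rewrite divr_ge0// mulr_ge0// exprn_ge0// mulr_ge0// ltW.
pose c : R := 2 ^+ m.+1 * 2 ^+ m.+1 / 2; have c0 : 0 <= c by rewrite divr_ge0// mulr_ge0.
apply: (@le_trans _ _ (\int[P]_w (c%:E * (V w ^+ m.+1)%:E + k%:E))%E).
  apply: ge0_le_integral_nonmeas => w _; first by rewrite lee_fin exprn_ge0// sqr_ge0.
  rewrite -EFinM -EFinD lee_fin.
  have a0 : 0 <= 2 * V w by rewrite mulr_ge0// addr_ge0// sqr_ge0.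
  have b0 : 0 <= 25 / 2 * sup_scale m by rewrite mulr_ge0// ltW.
  apply: (@le_trans _ _ ((2 * V w + 25 / 2 * sup_scale m) ^+ m.+1)).
    rewrite lerXn2r ?nnegrE ?sqr_ge0 ?addr_ge0//.
    have := e_sqr_le; have := DS m; have := sqr_ge0 (psi w + e); rewrite /V /Z sqrrB sqrrD; lra.
  have half : 0 <= (1 / 2 : R) <= 1 by apply/andP; split; lra.
  have := @exprn_convex R (1 / 2) _ _ m.+1 half a0 b0.
  rewrite (_ : 1 - 1 / 2 = 1 / 2); last by field.
  rewrite -!mulrDr => h.
  rewrite (_ : c * _ + k = 2 ^+ m.+1 * (((2 * V w) ^+ m.+1 + (25 / 2 * sup_scale m) ^+ m.+1) / 2)).
    move: h; set u := 2 * V w + _; set v := (2 * V w) ^+ _ + _ => h.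
    have -> : u ^+ m.+1 = 2 ^+ m.+1 * (1 / 2 * u) ^+ m.+1 by rewrite -exprMn; congr (_ ^+ _); field.
    by rewrite ler_wpM2l// (le_trans h)// mulrC div1r.
  by rewrite exprMn /c /k; field.
have Vm0 w : (0 <= (V w ^+ m.+1)%:E)%E by rewrite lee_fin exprn_ge0// addr_ge0// sqr_ge0.
have mVm : measurable_fun [set: Omega] (fun w => ((V w ^+ m.+1)%:E : \bar R)).
  by apply/measurable_EFinP; exact: measurable_funX.
rewrite ge0_integralD//; last 2 first.
- by move=> w _; rewrite mule_ge0.
- exact: measurable_funeM.
rewrite ge0_integralZl// integral_cst// [X in (_ + _ * X)%E](_ : _ = 1%E); last exact: probability_setT.
rewrite mule1; have c0' : (0 <= c%:E :> \bar R)%E by rewrite lee_fin.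
apply: le_trans (leeD2r _ (lee_wpmul2l c0' (V_moment m))) _.
rewrite -EFinM -EFinD lee_fin /c /k.
have pM a : (a * sup_scale m) ^+ m.+1 = a ^+ m.+1 * sup_scale m ^+ m.+1 by rewrite exprMn.
rewrite !pM.
have h5 : 5 * (5 / 4) ^+ m.+1 * 2 ^+ m.+1 <= (25 / 2) ^+ m.+1 :> R.
  rewrite -mulrA -exprMn (_ : 5 / 4 * 2 = 5 / 2); last by field.
  rewrite (_ : 25 / 2 = 5 * (5 / 2)); last by field.
  move: (5 / 2) (divr_ge0 (ler0n R 5) (ler0n R 2)) => z z0.
  by rewrite exprMn ler_wpM2r ?exprn_ge0// exprS ler_peMr// exprn_ege1// ler1n.
have h25 : 25 ^+ m.+1 = 2 ^+ m.+1 * (25 / 2) ^+ m.+1 :> R by rewrite -exprMn; congr (_ ^+ _); field.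
have Dm1 : 0 <= sup_scale m ^+ m.+1 by rewrite exprn_ge0// ltW.
have t0 : 0 <= 2 ^+ m.+1 :> R by [].
rewrite h25; move: h5; move: ((5 / 4) ^+ m.+1) ((25 / 2) ^+ m.+1) (2 ^+ m.+1) t0 (sup_scale m ^+ m.+1) Dm1.
move=> u v t t0 z z0 h5; have := ler_wpM2r (mulr_ge0 t0 z0) h5.
by lra.
Qed.

Let iZ : P.-integrable setT (EFin \o Z).
Proof.
have i1 : P.-integrable setT (fun w => ((psi w)%:E - e%:E)%E).
  by apply: integrableB => //; exact: finite_measure_integrable_cst.
by apply: eq_integrable i1 => // w _; rewrite /= EFinB.
Qed.

Let mean_f : ('E_P[fun w => f (X w)] = (f (fun=> 0) + e)%:E)%E.
Proof.
rewrite unlock (_ : (\int[P]_w (f (X w))%:E = \int[P]_w ((psi w)%:E + (f (fun=> 0))%:E))%E).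
  rewrite integralD//; last exact: finite_measure_integrable_cst.
  rewrite eE integral_cst// [X in (_ + _ * X)%E](_ : _ = 1%E); last exact: probability_setT.
  by rewrite mule1 -EFinD addrC.
by apply: eq_integral => w _; rewrite -EFinD /psi subrK.
Qed.

Let Zrv : {RV P >-> R} := mfun_Sub (mem_set mZ).
Let mu : probability R R := distribution P Zrv.

(** 50 is 25 from [Z_moment] times 2 from [sum_moment]. As e >= 2 and 50 <= 4 16, the numerical
    factors are below 4 exp (21 (m + 1)), and 4 (1 + |x|^2) is at most (2 (1 + |x|))^2. *)
Lemma scale_le m : 50 * (16 ^+ m.+1 * sup_scale m) <=
  (2 * (1 + enorm x)) ^+ 2 * expR (21 * m.+1%:R * (1 + C * T)).
Proof.
have CT : 0 <= C * T by rewrite mulr_ge0// ltW.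
have x0 := enorm_ge0 x; have e0 : 0 <= 1 + enorm x ^+ 2 by rewrite addr_ge0 ?sqr_ge0.
have k0 : 0 <= m.+1%:R :> R by [].
have h1 : 4 * (1 + enorm x ^+ 2) <= (2 * (1 + enorm x)) ^+ 2.
  by rewrite exprMn sqrrD expr1n mul1r; lra.
have h2 : 50 * 16 ^+ m.+1 <= 4 * expR (21 * m.+1%:R) :> R.
  have e2 : 2 <= expR 1 :> R by have := expR_ge1Dx (1 : R); lra.
  have -> : expR (21 * m.+1%:R) = expR 1 ^+ (21 * m.+1) :> R by rewrite -expRM_natl natrM mulr1.
  have p2 : 2 ^+ (21 * m.+1) <= expR 1 ^+ (21 * m.+1) :> R.
    by rewrite lerXn2r ?nnegrE ?expR_ge0.
  have p3 : 2 ^+ (8 * m.+1) <= 2 ^+ (21 * m.+1) :> R.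
    by rewrite ler_weXn2l ?ler1n// leq_mul2r orbT.
  have e16 : 2 ^+ (8 * m.+1) = 16 ^+ m.+1 * 16 ^+ m.+1 :> R.
    by rewrite exprM -exprMn; congr (_ ^+ _); ring.
  have q : 16 <= 16 ^+ m.+1 :> R by rewrite exprS ler_peMr// exprn_ege1// ler1n.
  rewrite e16 in p3; apply: (@le_trans _ _ (4 * (16 ^+ m.+1 * 16 ^+ m.+1))).
    by rewrite mulrA ler_wpM2r//; lra.
  by rewrite ler_wpM2l// (le_trans p3).
have h3 : expR (19 * m.+1%:R * (C * T)) * expR (21 * m.+1%:R) <= expR (21 * m.+1%:R * (1 + C * T)).
  rewrite -expRD ler_expR; have := mulr_ge0 k0 CT; lra.
rewrite /sup_scale (_ : 50 * _ = 50 * 16 ^+ m.+1 * ((1 + enorm x ^+ 2) * expR (19 * m.+1%:R * (C * T)))); last first.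
  by rewrite mulrA.
have g0 : 0 <= (1 + enorm x ^+ 2) * expR (19 * m.+1%:R * (C * T)) by rewrite mulr_ge0// expR_ge0.
apply: (le_trans (ler_wpM2r g0 h2)).
apply: (le_trans _ (ler_wpM2r (expR_ge0 _) h1)).
rewrite (_ : 4 * _ * _ = 4 * (1 + enorm x ^+ 2) * (expR (19 * m.+1%:R * (C * T)) * expR (21 * m.+1%:R))).
  by rewrite ler_wpM2l// mulr_ge0.
by ring.
Qed.

Lemma monte_carlo_bound (M : nat) (r : R) d' (Omega' : measurableType d')
    (P' : probability Omega' R) (Y : 'I_M -> Omega' -> R -> 'cV[R]_n) :
  (0 < M)%N -> 0 <= r -> independent_copies T P X P' Y ->
  (P' [set w | r%:E <= `| ((M%:R)^-1 * \sum_(k < M) f (Y k w))%R%:E - 'E_P[fun w0 => f (X w0)] |]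
    <= (deviation_bound (28 * (1 + C * T)) x M r)%:E)%E.
Proof.
move=> M0 r0 [Yc mY lawY indY]; have MR : 0 < M%:R :> R by rewrite ltr0n.
have CT : 0 <= C * T by rewrite mulr_ge0// ltW.
pose ZY k w := f (Y k w) - f (fun=> 0) - e.
have mZY k : measurable_fun [set: Omega'] (ZY k).
  apply: measurable_funB => //; apply: measurable_funB => //.
  exact: lipschitz1_measurable_comp (Yc k) (mY k) lf.
have mean_int : mu.-integrable setT (fun z : R => z%:E).
  apply/integrableP; split; first by apply/measurable_EFinP.
  rewrite ge0_integral_distribution//; first by case/integrableP : iZ.
  by apply/measurable_EFinP; exact: normr_measurable.
have mean0 : (\int[mu]_z z%:E = 0)%E.
  rewrite integral_distribution//.
  rewrite (_ : (\int[P]_w _ = \int[P]_w ((psi w)%:E - e%:E))%E); last first.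
    by apply: eq_integral => w _; rewrite /= /Z EFinB.
  rewrite integralB//; last exact: finite_measure_integrable_cst.
  rewrite eE integral_cst// [X in (_ - _ * X)%E](_ : _ = 1%E); last exact: probability_setT.
  by rewrite mule1 subee.
have mom m : (\int[mu]_z ((z ^+ 2) ^+ m.+1)%:E <= ((25 * sup_scale m) ^+ m.+1)%:E)%E.
  rewrite ge0_integral_distribution; first exact: Z_moment.
    by apply/measurable_EFinP; apply: measurable_funX; exact: measurable_funX.
  by move=> z; rewrite lee_fin exprn_ge0// sqr_ge0.
have indep (B : 'I_M -> set R) : (forall k, measurable (B k)) ->
    P' [set w | forall k, B k (ZY k w)] = (\prod_(k < M) mu (B k))%E.
  move=> mB; pose B' k := (fun y => y - f (fun=> 0) - e) @^-1` B k.
  have mB' k : measurable (B' k).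
    rewrite /B' -[X in measurable X]setTI.
    have : measurable_fun [set: R] (fun y : R => y - f (fun=> 0) - e).
      by apply: measurable_funB => //; exact: measurable_funB.
    by apply => //; exact: measurableT.
  (* Independence and equality of laws are given for path events, so each Borel condition on f(Y k)
     is first rewritten as one. *)
  have /choice[S HS] k := lipschitz1_measurable T0 lf (mB' k).
  rewrite (_ : [set w | _] = [set w | forall k, S k (Y k w)]); last first.
    apply/seteqP; split => w /= h k; first by apply/(HS k).2; [exact: Yc|exact: h].
    by have /(HS k).2 := h k; apply; exact: Yc.
  rewrite indY; last by move=> k; case: (HS k).
  apply: eq_bigr => k _; rewrite lawY; last by case: (HS k).
  congr (P _); apply/seteqP; split => w /=.
    by move=> h; apply/(HS k).2.
  by move=> h; apply/((HS k).2 _ (@Xc w)).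
pose S w := \sum_(k < M) ZY k w.
have SE w : (M%:R)^-1 * \sum_(k < M) f (Y k w) - (f (fun=> 0) + e) = S w / M%:R.
  rewrite (_ : S w = \sum_(k < M) (f (Y k w) - (f (fun=> 0) + e))); last first.
    by apply: eq_bigr => k _; rewrite /ZY opprD addrA.
  rewrite sumrB sumr_const card_ord; move: (f _ + e) (\sum_(k < M) _) => z u.
  by rewrite -[z *+ M]mulr_natl mulrBl [M%:R * z]mulrC mulfK ?gt_eqF// [u / _]mulrC.
have mS : measurable_fun [set: Omega'] S by apply: measurable_sum => k.
rewrite mean_f (_ : [set w | _] = [set w | r * M%:R <= `|S w|]); last first.
  apply/funext => w; rewrite /mkset -EFinB abse_EFin lee_fin SE normrM normfV.
  by rewrite (gtr0_norm MR) ler_pdivlMr.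
set A := [set w | _].
have mA : measurable A.
  rewrite -[X in measurable X]setTI; apply: measurable_fun_ler => //.
  by apply: measurableT_comp => //; exact: normr_measurable.
have PA : P' A = (fine (P' A))%:E by rewrite fineK//; exact: fin_num_measure.
rewrite PA lee_fin; apply: deviation_numeric => //.
- by rewrite lerDl.
- by rewrite -lee_fin -PA; exact: probability_le1.
move=> m rp; have rM : 0 < r * M%:R by rewrite mulr_gt0.
have zt0 : 0 <= 25 * sup_scale m by rewrite mulr_ge0// ltW.
have mom2 : (\int[mu]_z (z ^+ 2)%:E <= (25 * sup_scale m)%:E)%E.
  apply: (@le_trans _ _ (25 * sup_scale 0)%:E); last by rewrite lee_fin ler_wpM2l.
  by apply: le_trans (mom 0%N); rewrite le_eqVlt; apply/orP; left; apply/eqP.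
have h := sum_moment zt0 mean_int mean0 mom2 (mom m) mZY indep.
have h2 : ((((r * M%:R) ^+ 2) ^+ m.+1)%:E * P' A <= \int[P']_w ((S w ^+ 2) ^+ m.+1)%:E)%E.
  apply: markov_le => //; first by rewrite exprn_ge0// sqr_ge0.
    by move=> w; rewrite lee_fin exprn_ge0// sqr_ge0.
  move=> w Aw; rewrite lee_fin lerXn2r ?nnegrE ?sqr_ge0//.
  by rewrite -(real_normK (num_real (S w))) lerXn2r ?nnegrE ?(ltW rM).
have := le_trans h2 h; rewrite PA -EFinM lee_fin -ler_pdivlMl ?exprn_gt0//.
move=> /le_trans; apply; rewrite -exprVn -exprMn lerXn2r ?nnegrE//.
- apply: mulr_ge0; first by rewrite invr_ge0 sqr_ge0.
  by do 3 (apply: mulr_ge0 => //).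
- apply: mulr_ge0 (expR_ge0 _); rewrite invr_ge0; apply: divr_ge0 (sqr_ge0 _).
  by apply: mulr_ge0 => //; exact: sqr_ge0.
rewrite (_ : ((r * M%:R) ^+ 2)^-1 * _ = (r ^+ 2 * M%:R)^-1 * (50 * (16 ^+ m.+1 * sup_scale m))); last first.
  move: (16 ^+ m.+1) (sup_scale m) (M%:R) MR => u v z z0.
  by field; rewrite !gt_eqF.
rewrite invf_div (_ : _ / _ * expR _ = (r ^+ 2 * M%:R)^-1 *
  ((2 * (1 + enorm x)) ^+ 2 * expR (21 * m.+1%:R * (1 + C * T)))); last by rewrite mulrAC mulrC.
apply: ler_wpM2l (scale_le m); rewrite invr_ge0; apply: mulr_ge0 => //; exact: sqr_ge0.
Qed.

End deviation.

Lemma le_ereal_sup_itv (R : realType) (T : R) (g : R -> R) (c : R) :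
  (ereal_sup [set (g t)%:E | t in `[0%R, T]] <= c%:E)%E -> forall t, 0 <= t <= T -> g t <= c.
Proof.
move=> H t tT; rewrite -lee_fin; apply: le_trans H; apply: ereal_sup_ubound.
by exists t => //=; rewrite in_itv.
Qed.

(** Common to both processes: tau is the grid floor for the Euler scheme and the identity for the
    diffusion, and only the proof of trackability differs. *)
Lemma equation_deviation (R : realType) (n q : nat) (T C : R) (disp : measure_display)
    (Omega : measurableType disp) (P : probability Omega R) (F : R -> set (set Omega))
    (W : Omega -> R -> 'cV[R]_q) (x : 'cV[R]_n) (tau : R -> R)
    (b : R -> 'cV[R]_n -> 'cV[R]_n) (sigma : R -> 'cV[R]_n -> 'M[R]_(n, q))
    (X : Omega -> R -> 'cV[R]_n) :
  filtration F T -> brownian_motion P F T W -> 0 < T -> 0 <= C ->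
  (forall t, 0 <= t <= T -> continuous (sigma t)) ->
  measurable_fun `[0, T] tau -> (forall s, 0 <= s <= T -> 0 <= tau s <= T) ->
  (forall y i j, measurable_fun `[0, T] (fun s => sigma (tau s) y i j)) ->
  ito_equation P F T W x (fun w s => b (tau s) (X w (tau s)))
    (fun w s => sigma (tau s) (X w (tau s))) X ->
  (forall I, (forall t, 0 <= t <= T ->
       {ae P, forall w, X w t = x + vint (fun s => b (tau s) (X w (tau s))) t + I w t}) ->
     forall eta, 0 < eta ->
     trackable P F T W x X C (fun w s => sigma (tau s) (X w (tau s))) I eta) ->
  monte_carlo_deviation T (28 * (1 + C * T)) x P X.
Proof.
move=> hF hW T0 C0 sc mtau tauT ms [Xc aX [I hI hX]] tr f lf M M0 r r0 disp' Omega' P' Y hY.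
have Xm t : 0 <= t <= T -> mx_measurable (fun w => X w t).
  by move=> /andP[t0 tT]; exact: (F_measurable_mx hF t0 tT (X_measurable hF aX t0 tT)).
have mX t : t \in `[0, T] -> rv_measurable measurable (fun w => X w t).
  move=> tT i j B mB; rewrite in_itv /= in tT.
  by have := Xm t tT i j measurableT B mB; rewrite setTI.
apply: (monte_carlo_bound T0 C0 Xc mX _ lf M0 r0 hY) => p A B A0 mB HB.
apply: (sup_tail hF hW T0 aX C0 hI _ p _ A0 mB HB).
- by move=> Hs wf; exact: (measurable_gap hF T0 wf Xc Xm mtau tauT ms sc).
- by apply: tr => t tT; apply: hX; rewrite in_itv.
Qed.

Unset Implicit Arguments.

Theorem theorem2p2 (R : realType) (d q : nat) (hd : (1 <= d)%N) (hq : (1 <= q)%N)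
  (T : R) (hT : 0 < T)
  (b : R -> 'cV[R]_d -> 'cV[R]_d) (sigma : R -> 'cV[R]_d -> 'M[R]_(d, q))
  (b_meas : forall y i, measurable_fun `[0, T] (fun t => b t y i ord0))
  (sigma_meas : forall y i j, measurable_fun `[0, T] (fun t => sigma t y i j))
  (b_cont : forall t, t \in `[0, T] -> continuous (b t))
  (sigma_cont : forall t, t \in `[0, T] -> continuous (sigma t))
  (Cb Csigma : R)
  (b_growth : forall y, (ereal_sup [set (enorm (b t y))%:E | t in `[0%R, T]]
      <= (Cb * (1 + enorm y))%:E)%E)
  (sigma_growth : forall y,
      (ereal_sup [set (\tr (sigma t y *m (sigma t y)^T))%:E | t in `[0%R, T]]
      <= (Csigma * (1 + enorm y ^+ 2))%:E)%E)
  (disp : measure_display) (Omega : measurableType disp)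
  (P : probability Omega R) (F : R -> set (set Omega)) (hF : filtration F T)
  (W : Omega -> R -> 'cV[R]_q) (hW : brownian_motion P F T W)
  (x : 'cV[R]_d) :
  (forall N : nat, (0 < N)%N ->
   forall X : Omega -> R -> 'cV[R]_d, euler_scheme P F T W b sigma x N X ->
   monte_carlo_deviation T (kappa Cb Csigma T) x P X) /\
  (forall X : Omega -> R -> 'cV[R]_d, diffusion P F T W b sigma x X ->
   monte_carlo_deviation T (kappa Cb Csigma T) x P X).
Proof.
(* One constant serves both coefficients; it is nonnegative because [Cb] bounds the norm of b at
   0. *)
set C := Num.max Csigma Cb.
have T0T : 0 <= (0 : R) <= T by rewrite lexx ltW.
have itvT t : 0 <= t <= T -> t \in `[0, T] by rewrite in_itv.
have C0 : 0 <= C.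
  have := le_ereal_sup_itv (b_growth 0) T0T; rewrite enorm0 addr0 mulr1 => h.
  by rewrite le_max (le_trans (enorm_ge0 _) h) orbT.
have bg t y : 0 <= t <= T -> enorm (b t y) <= C * (1 + enorm y).
  move=> tT; rewrite (le_trans (le_ereal_sup_itv (b_growth y) tT))//.
  by rewrite ler_wpM2r ?addr_ge0 ?enorm_ge0// le_max lexx orbT.
have sg t y : 0 <= t <= T -> enorm (sigma t y) ^+ 2 <= C * (1 + enorm y ^+ 2).
  move=> tT; rewrite -mxtrace_mul_tr (le_trans (le_ereal_sup_itv (sigma_growth y) tT))//.
  by rewrite ler_wpM2r ?addr_ge0 ?sqr_ge0// le_max lexx.
have bc t : 0 <= t <= T -> continuous (b t) by move=> /itvT; exact: b_cont.
have sc t : 0 <= t <= T -> continuous (sigma t) by move=> /itvT; exact: sigma_cont.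
split => [N N0 X hX|X hX].
- have mphi := measurable_grid_partition T N id (measurable_itv `[0, T]).
  have phiT := grid_floor_in hT N0.
  apply: (equation_deviation hF hW hT C0 sc mphi phiT _ hX) => [y i j|I HI eta eta0].
    exact: (measurable_grid_partition T N (fun t => sigma t y i j) (measurable_itv `[0, T])).
  have [Xc aX _] := hX.
  apply: (euler_trackable W hF hT aX Xc C0 bc bg sg mphi phiT _ HI N0 erefl eta0) => y i.
  exact: (measurable_grid_partition T N (fun t => b t y i ord0) (measurable_itv `[0, T])).
- have mid : measurable_fun `[0, T] (id : R -> R) by exact: measurable_id.
  apply: (equation_deviation hF hW hT C0 sc mid (fun _ h => h) sigma_meas hX) => I HI eta eta0.
  have [Xc aX _] := hX.
  exact: (diffusion_trackable hF hW hT aX Xc C0 bc bg sg mid (fun _ h => h) b_meas HI erefl eta0).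
Qed.
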